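(* Let $M=\mathsf G/\Gamma$ be a solvmanifold, i.e. $\mathsf G$ is a solvable Lie group and $\Gamma\le\mathsf G$ is a discrete subgroup ($M$ is not assumed compact). Then any invariant solution $(g_t,b_t)$ of the generalized Ricci flow on $M$ exists for all positive times; that is, the maximal forward existence interval of any invariant solution starting at $t=0$ is $[0,\infty)$.
   Context: Let $H_0$ be a closed 3-form on $M$. A smooth family $(g_t,b_t)$ of Riemannian metrics $g_t$ and 2-forms $b_t$ on $M$ solves the generalized Ricci flow on $(M,[H_0])$ if, with $H_t:=H_0+\mathrm d b_t$, $$\tfrac{\partial}{\partial t} g_t=-2\operatorname{Ric}(g_t)+\tfrac12 (H_t)^2_{g_t},\qquad \tfrac{\partial}{\partial t} b_t=-\mathrm d^*_{g_t}H_t .$$ Here, for a 3-form $H$ and a metric $g$, $H^2_g$ is the symmetric 2-tensor with $H_g^2(X,X)=|\iota_XH|_g^2$, where for a $k$-form $|\alpha|_g^2=\sum_{i_1,\dots,i_k}\alpha(e_{i_1},\dots,e_{i_k})^2$ for a $g$-orthonormal frame (sum over all indices), and $\mathrm d_g^*$ is the usual codifferential. A solution on $\mathsf G/\Gamma$ is called invariant if $H_0$, $g_t$, $b_t$ lift to left-invariant tensors on $\mathsf G$; the lifted system is then an ODE for left-invariant tensors, and the maximal existence interval is that of this ODE. *)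

(* Defs.v *)
From HB Require Import structures.
From mathcomp Require Import all_boot all_order all_algebra.
From mathcomp Require Import all_classical all_reals all_analysis.

Set Implicit Arguments.
Unset Strict Implicit.
Unset Printing Implicit Defensive.

Import Order.TTheory GRing.Theory Num.Theory.
Import numFieldTopology.Exports numFieldNormedType.Exports.

Local Open Scope classical_set_scope.
Local Open Scope ring_scope.

Fixpoint Ck (R : realType) (d k : nat) (U : set 'rV[R]_d) (f : 'rV[R]_d -> R)
    : Prop :=
  (forall x, U x -> {for x, continuous f}) /\
  match k with
  | 0 => True
  | k'.+1 => forall i : 'I_d,
      (forall x, U x -> derivable f x (delta_mx 0 i)) /\
      Ck k' U (fun x => 'D_(delta_mx 0 i) f x)
  end.

Definition smooth_on (R : realType) (d : nat) (U : set 'rV[R]_d)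
    (f : 'rV[R]_d -> R) : Prop :=
  forall k, Ck k U f.

(* Only the values of [cmap] on [cdom] and of [cinv] on [cdom]'s image matter. *)
Record chart (R : realType) (n : nat) (G : Type) := Chart {
  cdom : set G;
  cmap : G -> 'rV[R]_n;
  cinv : 'rV[R]_n -> G }.

Definition cimg (R : realType) (n : nat) (G : Type) (u : chart R n G)
    : set 'rV[R]_n :=
  cmap u @` cdom u.

Record is_chart (R : realType) (n : nat) (G : topologicalType)
    (u : chart R n G) : Prop := IsChart {
  open_cdom : open (cdom u);
  open_cimg : open (cimg u);
  cmapK : {in cdom u, cancel (cmap u) (cinv u)};
  cmap_continuous : forall p, cdom u p -> {for p, continuous (cmap u)};
  cinv_continuous : forall x, cimg u x -> {for x, continuous (cinv u)} }.

Definition compatible (R : realType) (n : nat) (G : Type) (u v : chart R n G)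
    : Prop :=
  forall j : 'I_n, smooth_on (cmap u @` (cdom u `&` cdom v))
                             (fun x => cmap v (cinv u x) 0 j).

HB.mixin Record isLieGroup (R : realType) (n : nat) G
    of Topological G & Group G := {
  atlas : set (chart R n G);
  hausdorffG : hausdorff_space G;
  second_countableG : @second_countable G;
  atlas_chart : forall u, atlas u -> is_chart u;
  atlas_cover : forall p : G, exists2 u, atlas u & cdom u p;
  atlas_compatible : forall u v, atlas u -> atlas v -> compatible u v;
  mulg_continuous : continuous (fun z : G * G => (z.1 * z.2)%g);
  invg_continuous : continuous (fun p : G => (p^-1)%g);
  mulg_smooth : forall u v w, atlas u -> atlas v -> atlas w ->
    forall j : 'I_n, smooth_on
      [set x : 'rV[R]_(n + n) |
        [/\ cimg u (lsubmx x), cimg v (rsubmx x)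
          & cdom w (cinv u (lsubmx x) * cinv v (rsubmx x))%g]]
      (fun x => cmap w (cinv u (lsubmx x) * cinv v (rsubmx x))%g 0 j);
  invg_smooth : forall u w, atlas u -> atlas w ->
    forall j : 'I_n, smooth_on
      [set x : 'rV[R]_n | cimg u x /\ cdom w ((cinv u x)^-1)%g]
      (fun x => cmap w ((cinv u x)^-1)%g 0 j) }.

#[short(type="lieGroupType")]
HB.structure Definition LieGroup (R : realType) (n : nat) :=
  {G of isLieGroup R n G & Topological G & Group G}.

Definition discrete_subgroup (R : realType) (n : nat) (G : lieGroupType R n)
    (Gam : set G) : Prop :=
  [/\ Gam 1%g,
      forall x y, Gam x -> Gam y -> Gam (x * y)%g,
      forall x, Gam x -> Gam (x^-1)%g
    & forall x, Gam x -> \forall y \near x, Gam y -> y = x].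

Section LieAlgebra.
Context (R : realType) (n : nat) (G : lieGroupType R n).
Implicit Types (f h : G -> R) (X Y : (G -> R) -> (G -> R)).

Definition smooth f : Prop :=
  forall u : chart R n G, atlas u -> smooth_on (cimg u) (f \o cinv u).

(* Vector fields are derivations of the algebra of smooth functions; the values
   of [X] on non-smooth functions are irrelevant, hence [vf_eq]. *)
Record vector_field X : Prop := VectorField {
  vf_smooth : forall f, smooth f -> smooth (X f);
  vf_linear : forall (a : R) f h, smooth f -> smooth h -> forall p,
    X (fun q => a * f q + h q) p = a * X f p + X h p;
  vf_leibniz : forall f h, smooth f -> smooth h -> forall p,
    X (fun q => f q * h q) p = X f p * h p + f p * X h p }.

Definition vf_eq X Y : Prop := forall f, smooth f -> forall p, X f p = Y f p.

Definition vf_bracket X Y : (G -> R) -> (G -> R) :=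
  fun f p => X (Y f) p - Y (X f) p.

(* The Lie algebra of [G]: the left-invariant vector fields. *)
Definition lie_alg X : Prop :=
  vector_field X /\
  forall (a : G) f, smooth f -> forall p,
    X (fun q => f (a * q)%g) p = X f (a * p)%g.

Definition derived_alg (S : set ((G -> R) -> (G -> R)))
    : set ((G -> R) -> (G -> R)) :=
  [set X | lie_alg X /\
    exists (m : nat) (Y Z : 'I_m -> (G -> R) -> (G -> R)),
      (forall i, S (Y i) /\ S (Z i)) /\
      vf_eq X (fun f p => \sum_(i < m) vf_bracket (Y i) (Z i) f p)].

(* A Lie group is solvable when the derived series of its Lie algebra reaches
   zero; connectedness is not required. *)
Definition solvable_lie_group : Prop :=
  exists k : nat, forall X,
    iter k derived_alg lie_alg X -> vf_eq X (fun _ _ => 0).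

Definition lie_alg_basis (E : 'I_n -> (G -> R) -> (G -> R)) : Prop :=
  (forall i, lie_alg (E i)) /\
  forall X, lie_alg X ->
    exists! v : 'rV[R]_n, vf_eq X (fun f p => \sum_i v 0 i * E i f p).

(* [E_i, E_j] = \sum_k c i j k E_k *)
Definition structure_constants (E : 'I_n -> (G -> R) -> (G -> R))
    (c : 'I_n -> 'I_n -> 'I_n -> R) : Prop :=
  forall i j, vf_eq (vf_bracket (E i) (E j))
                    (fun f p => \sum_k c i j k * E k f p).

End LieAlgebra.

(* Tensor fields are given by their component functions in a global frame
   E_0, ..., E_(n-1) of left-invariant vector fields. The components are
   arbitrary functions on [G] here, so that the formulas are those of a
   non-holonomic frame, derivatives of the components included. *)
Section FrameGeometry.
Context (R : realType) (n : nat) (G : lieGroupType R n).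
Variable E : 'I_n -> (G -> R) -> (G -> R).
Variable c : 'I_n -> 'I_n -> 'I_n -> R.

Definition tensor2 := 'I_n -> 'I_n -> G -> R.
Definition tensor3 := 'I_n -> 'I_n -> 'I_n -> G -> R.

Implicit Types (g b : tensor2) (H : tensor3) (i j k l : 'I_n) (p : G).

Definition gram g p : 'M[R]_n := \matrix_(i, j) g i j p.

Definition is_metric g : Prop :=
  (forall i j p, g i j p = g j i p) /\
  (forall p (v : 'rV[R]_n), v != 0 -> 0 < (v *m gram g p *m v^T) 0 0).

Definition is_form2 b : Prop := forall i j p, b i j p = - b j i p.

Definition is_form3 H : Prop :=
  forall i j k p, H i j k p = - H j i k p /\ H i j k p = - H i k j p.

Definition ext_d2 b : tensor3 := fun i j k p =>
  E i (b j k) p - E j (b i k) p + E k (b i j) p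
  - \sum_m c i j m * b m k p
  + \sum_m c i k m * b m j p
  - \sum_m c j k m * b m i p.

Definition ext_d3 H i j k l p : R :=
  E i (H j k l) p - E j (H i k l) p + E k (H i j l) p - E l (H i j k) p
  - \sum_m c i j m * H m k l p
  + \sum_m c i k m * H m j l p
  - \sum_m c i l m * H m j k p
  - \sum_m c j k m * H m i l p
  + \sum_m c j l m * H m i k p
  - \sum_m c k l m * H m i j p.

Definition ginv g i j p : R := invmx (gram g p) i j.

(* Koszul formula for 2 g(nabla_{E_i} E_j, E_k) *)
Definition koszul g i j k p : R :=
  E i (g j k) p + E j (g i k) p - E k (g i j) p
  + \sum_m c i j m * g m k p
  - \sum_m c i k m * g m j p
  - \sum_m c j k m * g m i p.

(* nabla_{E_i} E_j = \sum_k christoffel g i j k E_k *)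
Definition christoffel g i j k p : R :=
  2^-1 * \sum_l ginv g k l p * koszul g i j l p.

(* R(E_i, E_j) E_k = \sum_l riemann g i j k l E_l, with
   R(X, Y) = nabla_X nabla_Y - nabla_Y nabla_X - nabla_[X, Y] *)
Definition riemann g i j k l p : R :=
  E i (christoffel g j k l) p - E j (christoffel g i k l) p
  + \sum_m (christoffel g j k m p * christoffel g i m l p
            - christoffel g i k m p * christoffel g j m l p
            - c i j m * christoffel g m k l p).

(* Ric(Y, Z) is the trace of X |-> R(X, Y) Z. *)
Definition ricci g : tensor2 := fun j k p => \sum_i riemann g i j k i p.

(* H^2_g(X, Y) = <i_X H, i_Y H>, summing over all index pairs (no 1/2). *)
Definition H_square g H : tensor2 := fun i j p =>
  \sum_k \sum_l \sum_r \sum_s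
    ginv g k l p * ginv g r s p * H i k r p * H j l s p.

Definition nabla3 g H m i j k p : R :=
  E m (H i j k) p
  - \sum_r (christoffel g m i r p * H r j k p
            + christoffel g m j r p * H i r k p
            + christoffel g m k r p * H i j r p).

(* (d^* H)(X, Y) = - \sum_a (nabla_{e_a} H)(e_a, X, Y), (e_a) orthonormal *)
Definition codiff3 g H : tensor2 := fun i j p =>
  - \sum_k \sum_l ginv g k l p * nabla3 g H k l i j p.

Definition time_dom (T : \bar R) : set R := [set t | 0 <= t /\ (t%:E < T)%E].

(* One-sided at t = 0. *)
Definition time_deriv (T : \bar R) (u : R -> R) (t l : R) : Prop :=
  (fun s => (s - t)^-1 * (u s - u t)) @ within (time_dom T) t^' --> l.

(* [f] is of class C^k on [0, T) x G. *)
Fixpoint Ck_family (k : nat) (T : \bar R) (f : R -> G -> R) : Prop :=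
  [/\ forall t, time_dom T t -> smooth (f t),
      {within [set z : R * G | time_dom T z.1],
        continuous (fun z : R * G => f z.1 z.2)}
    & match k with
      | 0 => True
      | k'.+1 =>
          (forall i, Ck_family k' T (fun t => E i (f t))) /\
          exists f' : R -> G -> R,
            (forall t p, time_dom T t ->
               time_deriv T (fun s => f s p) t (f' t p)) /\
            Ck_family k' T f'
      end].

Definition smooth_family (T : \bar R) (f : R -> G -> R) : Prop :=
  forall k, Ck_family k T f.

(* A function on the quotient M of G by the left translations of [Gam]. As these
   translations preserve the frame E, tensor fields on M are the tensor fields
   on G whose components descend to M. *)
Definition on_quotient (Gam : set G) (f : G -> R) : Prop :=
  forall a p, Gam a -> f (a * p)%g = f p.

Definition left_invariant (f : G -> R) : Prop :=
  forall a p, f (a * p)%g = f p.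

Definition closed_form3 (Gam : set G) H : Prop :=
  [/\ is_form3 H,
      forall i j k, smooth (H i j k),
      forall i j k, on_quotient Gam (H i j k)
    & forall i j k l p, ext_d3 H i j k l p = 0].

Definition torsion (H0 : tensor3) (b : tensor2) : tensor3 :=
  fun i j k p => H0 i j k p + ext_d2 b i j k p.

Record gen_ricci_flow (Gam : set G) (H0 : tensor3) (T : \bar R)
    (g b : R -> tensor2) : Prop := GenRicciFlow {
  grf_time : (0 < T)%E;
  grf_metric : forall t, time_dom T t -> is_metric (g t);
  grf_form : forall t, time_dom T t -> is_form2 (b t);
  grf_quotient : forall t i j, time_dom T t ->
    on_quotient Gam (g t i j) /\ on_quotient Gam (b t i j);
  grf_smooth : forall i j, smooth_family T (fun t => g t i j) /\
                           smooth_family T (fun t => b t i j);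
  grf_eq_g : forall t i j p, time_dom T t ->
    time_deriv T (fun s => g s i j p) t
      (- 2 * ricci (g t) i j p
       + 2^-1 * H_square (g t) (torsion H0 (b t)) i j p);
  grf_eq_b : forall t i j p, time_dom T t ->
    time_deriv T (fun s => b s i j p) t
      (- codiff3 (g t) (torsion H0 (b t)) i j p) }.

Definition invariant_solution (Gam : set G) (H0 : tensor3) (T : \bar R)
    (g b : R -> tensor2) : Prop :=
  [/\ gen_ricci_flow Gam H0 T g b,
      forall i j k, left_invariant (H0 i j k)
    & forall t i j, time_dom T t ->
        left_invariant (g t i j) /\ left_invariant (b t i j)].

Definition agree_on (T : \bar R) (g b g' b' : R -> tensor2) : Prop :=
  forall t i j p, time_dom T t ->
    g' t i j p = g t i j p /\ b' t i j p = b t i j p.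

Definition maximal_invariant_solution (Gam : set G) (H0 : tensor3)
    (T : \bar R) (g b : R -> tensor2) : Prop :=
  invariant_solution Gam H0 T g b /\
  forall (T' : \bar R) (g' b' : R -> tensor2),
    invariant_solution Gam H0 T' g' b' -> (T <= T')%E ->
    agree_on T g b g' b' -> T' = T.

End FrameGeometry.

(* Main.v *)
Require Import Defs.
From HB Require Import structures.
From mathcomp Require Import all_boot all_order all_algebra all_fingroup.
From mathcomp Require Import all_classical all_reals all_analysis.
From mathcomp Require Import ring lra.

(* Left-invariant tensors have constant components, so the flow is an ODE for
   (g, b). With c the structure constants, B the Killing form, theta(X) = tr ad_X
   and H = H0 + db, consider
     Phi = R_g - |H|^2 / 12
         = - |c|^2 / 4 - (tr_g B) / 2 - |theta|^2 - |H|^2 / 12.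
   Along the flow Phi' = (|g'|^2 + |b'|^2) / 2. For a solvable Lie algebra
   Phi <= 0: in an orthonormal basis adapted to the derived series, tr_g B only
   involves products c_ij^l c_il^j in which j and l have the same level and i a
   strictly smaller one, and these are absorbed by |c|^2. Since
   |g'(v, v)| <= |g'| g(v, v) <= (1/2 + Phi') g(v, v), the metric stays between
   two multiples of its initial value that depend only on the elapsed time and on
   Phi(0); b is bounded in the same way. A solution hence stays in a compact set
   of admissible pairs on bounded time intervals.
   Global solutions are obtained without a maximality argument: the field is
   cut off outside such a compact set, which makes it bounded and globally
   Lipschitz, and the bounds above show that the solution of the cut-off equation
   never meets the cut-off before a prescribed time. *)

Set Implicit Arguments.
Unset Strict Implicit.
Unset Printing Implicit Defensive.

Import Order.TTheory GRing.Theory Num.Theory.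
Import numFieldTopology.Exports numFieldNormedType.Exports.

Local Open Scope classical_set_scope.
Local Open Scope ring_scope.

(** * Curvature identities in an orthonormal frame *)

(** Up to factors and up to terms in theta, the flow is the gradient flow of Phi: the gradient in g
    combines the moment map of the bracket, the Killing form and H^2, and the gradient in b is the
    codifferential of a unimodular bracket. A solvable bracket need not be unimodular, and then the
    Ricci tensor and d^*H contain further terms in theta. They do not spoil the formula for Phi'
    because ad_theta is a derivation, theta vanishes on brackets, and H is closed.

    The summand 1/2 in the bound for g' comes from |g'| <= (1 + |g'|^2) / 2, which trades the norm
    of g' for its square, the quantity controlled by Phi'. Since Phi is nonpositive, the integral of
    Phi' is at most -Phi(0), so the relative change of the metric over a bounded time is bounded.

    The curvature identities are polynomial in the structure constants of an orthonormal frame.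
    Along the flow, however, the basis is fixed and the metric moves. Hence Phi is differentiated in
    the fixed basis, and the outcome at each single time is evaluated in a frame chosen for that
    metric; frames are never differentiated. *)

Section OrthonormalFrame.
Context (R : realFieldType) (I : finType).

Definition pairing (X Y : I -> I -> R) : R := \sum_i \sum_j X i j * Y i j.

Definition alternating2 (c : I -> I -> I -> R) := forall i j k, c i j k = - c j i k.

Definition jacobi (c : I -> I -> I -> R) := forall i j k m,
  \sum_l (c i j l * c l k m + c j k l * c l i m + c k i l * c l j m) = 0.

Lemma eq_sum2 (F G : I -> I -> R) :
  (forall i j, F i j = G i j) -> \sum_i \sum_j F i j = \sum_i \sum_j G i j.
Proof. by move=> FG; apply: eq_bigr => i _; apply: eq_bigr => j _. Qed.

Lemma sum2D (F G : I -> I -> R) :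
  \sum_i \sum_j F i j + \sum_i \sum_j G i j = \sum_i \sum_j (F i j + G i j).
Proof. by rewrite -big_split; apply: eq_bigr => i _; rewrite big_split. Qed.

Lemma sum2Z (a : R) (F : I -> I -> R) :
  a * (\sum_i \sum_j F i j) = \sum_i \sum_j (a * F i j).
Proof. by rewrite mulr_sumr; apply: eq_bigr => i _; rewrite mulr_sumr. Qed.

Lemma sum_swap23 (F : I -> I -> I -> R) :
  \sum_i \sum_j \sum_k F i j k = \sum_i \sum_k \sum_j F i j k.
Proof. by apply: eq_bigr => i _; rewrite exchange_big. Qed.

Lemma sum_swap34 (F : I -> I -> I -> I -> R) :
  \sum_i \sum_j \sum_k \sum_l F i j k l = \sum_i \sum_j \sum_l \sum_k F i j k l.
Proof. by apply: eq_bigr => i _; rewrite sum_swap23. Qed.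

Lemma sum4_rot (F : I -> I -> I -> I -> R) :
  \sum_i \sum_j \sum_k \sum_l F i j k l = \sum_k \sum_l \sum_i \sum_j F i j k l.
Proof.
transitivity (\sum_i \sum_k \sum_j \sum_l F i j k l).
  by apply: eq_bigr => i _; rewrite exchange_big.
rewrite exchange_big /=; apply: eq_bigr => k _; rewrite sum_swap23.
by rewrite exchange_big.
Qed.

(** Many identities below hold only after exchanging the two summation indices. Symmetrising the
    summands reduces them to pointwise identities that [ring] or [field] can decide. *)
Lemma sum2_sym (F G : I -> I -> R) :
  (forall i j, F i j + F j i = G i j + G j i) ->
  \sum_i \sum_j F i j = \sum_i \sum_j G i j.
Proof.
move=> FG.
have D (A : I -> I -> R) :
    (\sum_i \sum_j A i j) * 2 = \sum_i \sum_j (A i j + A j i).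
  by rewrite -sum2D [X in _ + X]exchange_big /= mulr_natr mulr2n.
apply: (@mulIf R 2); first by rewrite pnatr_eq0.
by rewrite !D; apply: eq_sum2.
Qed.

Section Bracket.
Variable c : I -> I -> I -> R.

Definition theta i := \sum_j c i j j.
(** The Koszul formula: g(nabla_{e_i} e_j, e_k) for the Levi-Civita connection of an orthonormal
    left-invariant frame. *)
Definition levi i j k := 2^-1 * (c i j k - c i k j - c j k i).
Definition ric_frame j k :=
  \sum_i \sum_m (levi j k m * levi i m i - levi i k m * levi j m i
                 - c i j m * levi m k i).
(** Up to scale, the moment map for the action of GL_n on brackets. It enters as the gradient of
    |c|^2 with respect to the metric. *)
Definition moment j k :=
  - 2^-1 * (\sum_i \sum_m c j i m * c k i m)
  + 4^-1 * (\sum_i \sum_m c i m j * c i m k).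
Definition killing j k := \sum_i \sum_m c j i m * c k m i.
(** The matrix of ad Z, where Z is the vector metrically dual to theta. *)
Definition ad_theta j k := \sum_m theta m * c m j k.
Definition sym_theta j k := 2^-1 * (ad_theta j k + ad_theta k j).

Hypothesis calt : alternating2 c.
Hypothesis cjac : jacobi c.

(* Once c is written as an antisymmetrisation, identities that hold modulo its
   antisymmetry become plain ring identities. *)
Lemma alternating2_ex : exists a, forall i j k, c i j k = a i j k - a j i k.
Proof.
exists (fun i j k => 2^-1 * c i j k) => i j k.
by rewrite (calt j i k); field.
Qed.

(** The trace of ad [x, y] is the trace of a commutator. In the Jacobi identity traced over its last
    argument, the two other terms cancel after exchanging the summation indices. *)
Lemma theta_bracket i j : \sum_l c i j l * theta l = 0.
Proof.
have H : \sum_k \sum_l (c i j l * c l k k + c j k l * c l i k + c k i l * c l j k) = 0.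
  by rewrite big1 // => k _; rewrite cjac.
have H2 : \sum_k \sum_l (c j k l * c l i k + c k i l * c l j k) = \sum_(k : I) \sum_(l : I) 0.
  have [a ca] := alternating2_ex.
  by apply: (sum2_sym (G := fun=> fun=> 0)) => k l; rewrite !ca; ring.
rewrite -[RHS]H; transitivity (\sum_k \sum_l c i j l * c l k k).
  by rewrite exchange_big; apply: eq_bigr => l _; rewrite mulr_sumr.
transitivity (\sum_k \sum_l c i j l * c l k k
              + \sum_k \sum_l (c j k l * c l i k + c k i l * c l j k)).
  by rewrite H2 [X in _ + X]big1 ?addr0 // => k _; rewrite big1.
by rewrite sum2D; apply: eq_sum2 => k l; rewrite addrA.
Qed.

Lemma ric_frameE j k :
  ric_frame j k = moment j k - 2^-1 * killing j k - sym_theta j k.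
Proof.
have S0 : sym_theta j k =
    2^-1 * \sum_i \sum_m (c m i i * (c m j k + c m k j)).
  rewrite /sym_theta /ad_theta -big_split /= exchange_big /=.
  congr (_ * _); apply: eq_bigr => m _.
  by rewrite -mulrDr /theta mulr_suml.
have T0 : \sum_i \sum_m c j k m * c m i i = 0.
  rewrite exchange_big /= -[RHS](theta_bracket j k).
  by apply: eq_bigr => m _; rewrite mulr_sumr.
(* The product [levi j k m * levi i m i] also contributes theta of a bracket. This vanishes by
   [theta_bracket] but not by antisymmetry alone, so it is inserted by hand before the summands are
   compared. *)
have -> : sym_theta j k = sym_theta j k + 2^-1 * \sum_i \sum_m c j k m * c m i i.
  by rewrite T0 mulr0 addr0.
rewrite S0 /ric_frame /moment /killing.
rewrite opprD -!mulNr !sum2Z !sum2D.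
have [a ca] := alternating2_ex.
by apply: sum2_sym => i m; rewrite /levi !ca; field.
Qed.

Lemma ric_frame_sym j k : ric_frame j k = ric_frame k j.
Proof.
rewrite !ric_frameE; congr (_ - _ * _ - _); last by rewrite /sym_theta addrC.
  by rewrite /moment; congr (_ * _ + _ * _); apply: eq_sum2 => i m; rewrite mulrC.
by rewrite /killing exchange_big; apply: eq_sum2 => i m; rewrite mulrC.
Qed.

(** The Jacobi identity contracted with theta: ad of a fixed vector is a derivation of the
    bracket. *)
Lemma ad_theta_derivation i j k :
  \sum_l c i j l * ad_theta l k =
  \sum_l (ad_theta i l * c l j k + ad_theta j l * c i l k).
Proof.
have J0 : \sum_m theta m *
    (\sum_l (c i j l * c l m k + c j m l * c l i k + c m i l * c l j k)) = 0.
  by rewrite big1 // => m _; rewrite cjac mulr0.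
apply/eqP; rewrite -subr_eq0 -oppr_eq0; apply/eqP; rewrite -[RHS]J0.
rewrite (eq_bigr (fun l => \sum_m theta m * (c i j l * c m l k))); last first.
  by move=> l _; rewrite /ad_theta mulr_sumr; apply: eq_bigr => m _; ring.
rewrite [X in _ - X](eq_bigr (fun l => \sum_m theta m *
    (c m i l * c l j k + c m j l * c i l k))); last first.
  move=> l _; rewrite /ad_theta !mulr_suml -big_split /=.
  by apply: eq_bigr => m _; ring.
rewrite [RHS](eq_bigr (fun m => \sum_l theta m *
    (c i j l * c l m k + c j m l * c l i k + c m i l * c l j k))); last first.
  by move=> m _; rewrite mulr_sumr.
rewrite [RHS]exchange_big /= -sumrB -sumrN; apply: eq_bigr => l _.
rewrite -sumrB -sumrN; apply: eq_bigr => m _.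
have [a ca] := alternating2_ex.
by rewrite !ca; ring.
Qed.

Lemma moment_sym j k : moment j k = moment k j.
Proof.
by rewrite /moment; congr (_ * _ + _ * _); apply: eq_sum2 => i m; rewrite mulrC.
Qed.

Lemma killing_sym j k : killing j k = killing k j.
Proof.
by rewrite /killing exchange_big; apply: eq_sum2 => i m; rewrite mulrC.
Qed.

Lemma pairing_sym_theta X : (forall i j, X i j = X j i) ->
  pairing sym_theta X = pairing ad_theta X.
Proof.
move=> Xs; apply: sum2_sym => i j; rewrite /sym_theta (Xs j i).
by field.
Qed.

(** The moment map is orthogonal to derivations. Contracting the derivation property of [ad_theta]
    with the bracket gives [X = Y + Y], and the pairing equals X/4 - Y/2. *)
Lemma pairing_theta_moment : pairing sym_theta moment = 0.
Proof.
rewrite (pairing_sym_theta moment_sym).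
pose X := \sum_i \sum_j \sum_k \sum_l c i j l * ad_theta l k * c i j k.
pose Y := \sum_i \sum_l ad_theta i l * \sum_j \sum_k c l j k * c i j k.
have XY : X = Y + Y.
  transitivity (\sum_i \sum_j \sum_k
      \sum_l (ad_theta i l * c l j k + ad_theta j l * c i l k) * c i j k).
    by apply: eq_sum2 => i j; apply: eq_bigr => k _;
       rewrite -!mulr_suml ad_theta_derivation.
  transitivity (\sum_i \sum_j \sum_k \sum_l ad_theta i l * (c l j k * c i j k)
     + \sum_i \sum_j \sum_k \sum_l ad_theta j l * (c i l k * c i j k)).
    rewrite sum2D; apply: eq_sum2 => i j; rewrite sum2D; apply: eq_sum2 => k l.
    by rewrite !mulrDl !mulrA.
  congr (_ + _).
    rewrite sum_swap34 sum_swap23; apply: eq_sum2 => i l; rewrite sum2Z.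
    by apply: eq_sum2 => j k.
  rewrite exchange_big sum_swap34 sum_swap23; apply: eq_sum2 => j l; rewrite sum2Z.
  by apply: eq_sum2 => i k; rewrite (calt l i) (calt j i) mulrNN.
have XE : X = \sum_j \sum_k ad_theta j k * \sum_i \sum_m c i m j * c i m k.
  rewrite /X sum4_rot exchange_big /=; apply: eq_sum2 => l k.
  rewrite sum2Z; apply: eq_sum2 => i j; by ring.
have YE : Y = \sum_j \sum_k ad_theta j k * \sum_i \sum_m c j i m * c k i m.
  apply: eq_sum2 => j k; congr (_ * _); apply: eq_sum2 => i m; exact: mulrC.
have : pairing ad_theta moment = - 2^-1 * Y + 4^-1 * X.
  rewrite XE YE /pairing /moment sum2Z [4^-1 * _]sum2Z sum2D.
  by apply: eq_sum2 => j k; ring.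
by rewrite XY => ->; field.
Qed.

(** For a derivation D, ad (D x) is the commutator of D with ad x, so its trace against ad x
    vanishes. [XZ] is the cyclicity of the trace. *)
Lemma pairing_theta_killing : pairing sym_theta killing = 0.
Proof.
rewrite (pairing_sym_theta killing_sym).
pose X := \sum_j \sum_m \sum_r \sum_l c j m l * ad_theta l r * c j r m.
pose Z := \sum_j \sum_m \sum_r \sum_l ad_theta m l * c j l r * c j r m.
have XZ : X = Z.
  apply: eq_bigr => j _; rewrite [LHS]sum_swap23 [LHS]exchange_big /=.
  by apply: eq_sum2 => m r; apply: eq_bigr => l _; ring.
have XE : X = pairing ad_theta killing + Z.
  transitivity (\sum_j \sum_m \sum_r
      \sum_l (ad_theta j l * c l m r + ad_theta m l * c j l r) * c j r m).
    by apply: eq_sum2 => j m; apply: eq_bigr => r _;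
       rewrite -!mulr_suml ad_theta_derivation.
  transitivity (\sum_j \sum_m \sum_r \sum_l ad_theta j l * (c l m r * c j r m) + Z).
    rewrite sum2D; apply: eq_sum2 => j m; rewrite sum2D; apply: eq_sum2 => r l.
    by ring.
  congr (_ + _); rewrite sum_swap34 sum_swap23; apply: eq_sum2 => j l.
  by rewrite killing_sym sum2Z.
by apply/eqP; rewrite -(subrr Z) -{1}XZ XE addrK eqxx.
Qed.

Definition theta2 i j := theta i * theta j.

Lemma sum_quad (A B : I -> I -> I -> R) (x : I -> R) :
  \sum_j \sum_k (\sum_i \sum_m A j i m * B k i m) * (x j * x k) =
  \sum_i \sum_m (\sum_j x j * A j i m) * (\sum_k x k * B k i m).
Proof.
transitivity (\sum_j \sum_k \sum_i \sum_m x j * A j i m * (x k * B k i m)).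
  apply: eq_sum2 => j k; rewrite mulrC sum2Z; apply: eq_sum2 => i m; ring.
by rewrite sum4_rot; apply: eq_sum2 => i m; rewrite big_distrlr.
Qed.

(** Only the first half of [moment] contributes: the second contracts theta with a bracket. *)
Lemma moment_theta :
  pairing moment theta2 = - 2^-1 * pairing ad_theta ad_theta.
Proof.
have E0 : \sum_j \sum_k (\sum_i \sum_m c i m j * c i m k) * theta2 j k = 0.
  rewrite (sum_quad (fun j i m => c i m j) (fun j i m => c i m j)).
  rewrite big1 // => i _; rewrite big1 // => m _.
  rewrite (eq_bigr (fun j => c i m j * theta j)) ?theta_bracket ?mul0r //.
  by move=> j _; rewrite mulrC.
have E1 : pairing ad_theta ad_theta =
    \sum_j \sum_k (\sum_i \sum_m c j i m * c k i m) * theta2 j k.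
  exact/esym/(sum_quad c c).
transitivity (- 2^-1 * pairing ad_theta ad_theta + 4^-1 *
    \sum_j \sum_k (\sum_i \sum_m c i m j * c i m k) * theta2 j k);
  last by rewrite E0 mulr0 addr0.
rewrite E1 /pairing !sum2Z sum2D.
by apply: eq_sum2 => j k; rewrite /moment /theta2; ring.
Qed.

Lemma killing_theta :
  pairing killing theta2 =
  pairing ad_theta (fun i j => ad_theta j i).
Proof. exact: (sum_quad c (fun j i m => c j m i)). Qed.

(** If S is the symmetric part of D = ad_theta, then |S|^2 is half of |D|^2 + tr D^2. The two
    previous lemmas express both terms through theta. *)
Lemma sym_theta_norm :
  pairing sym_theta sym_theta =
  - pairing moment theta2 + 2^-1 * pairing killing theta2.
Proof.
rewrite moment_theta killing_theta /pairing -mulNr opprK !sum2Z sum2D.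
by apply: sum2_sym => i j; rewrite /sym_theta; field.
Qed.

(** This is g([Z, Z], Z) = 0 for Z dual to theta. *)
Lemma sym_theta_theta : pairing sym_theta theta2 = 0.
Proof.
rewrite pairing_sym_theta; last by move=> i j; rewrite /theta2 mulrC.
transitivity (\sum_i \sum_j \sum_k theta i * theta j * theta k * c i j k).
  rewrite /pairing [RHS]exchange_big; apply: eq_bigr => j _ /=.
  rewrite [RHS]exchange_big; apply: eq_bigr => k _ /=.
  rewrite /ad_theta /theta2 mulr_suml; apply: eq_bigr => i _; ring.
rewrite (sum2_sym (G := fun=> fun=> 0)); first by rewrite big1 // => i _; rewrite big1.
move=> i j; rewrite addr0 -big_split big1 //= => k _.
by rewrite (calt j i); ring.
Qed.

(** * Invariant 3-forms: codifferential, closedness and the identity for Phi' *)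

Section ThreeForm.
Variable H : I -> I -> I -> R.

Definition alternating3 := forall i j k, H i j k = - H j i k /\ H i j k = - H i k j.

Definition Hsq_frame i j := \sum_k \sum_r H i k r * H j k r.
Definition cod_frame i j :=
  \sum_k \sum_r (levi k k r * H r i j + levi k i r * H k r j
                 + levi k j r * H k i r).
Definition contr_theta i j := \sum_m theta m * H m i j.
Definition cod_unimod i j :=
  - 2^-1 * \sum_k \sum_r (c k r i * H k r j - c k r j * H k r i).
Definition ext2_const (b : I -> I -> R) i j k :=
  - \sum_m c i j m * b m k + \sum_m c i k m * b m j - \sum_m c j k m * b m i.
Definition closed3_const := forall i j k l,
  - \sum_m c i j m * H m k l + \sum_m c i k m * H m j l - \sum_m c i l m * H m j k
  - \sum_m c j k m * H m i l + \sum_m c j l m * H m i k - \sum_m c k l m * H m i j = 0.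

Hypothesis Halt : alternating3.

Lemma alternating3_ex : exists a, forall i j k,
  H i j k = a i j k - a j i k + a j k i - a k j i + a k i j - a i k j.
Proof.
exists (fun i j k => 6^-1 * H i j k) => i j k.
have [h1 h2] := Halt i j k; have [h3 h4] := Halt j k i; have [h5 h6] := Halt k i j.
rewrite (_ : H j i k = - H i j k); last by rewrite h1 opprK.
rewrite (_ : H i k j = - H i j k); last by rewrite h2 opprK.
rewrite (_ : H k j i = - H j k i); last by rewrite h3 opprK.
rewrite (_ : H j k i = H i j k); last by rewrite h4 h1.
rewrite (_ : H k i j = H i j k); first by field.
by rewrite h5 h2.
Qed.

Lemma cod_frameE i j : cod_frame i j = contr_theta i j + cod_unimod i j.
Proof.
rewrite /contr_theta /cod_unimod /theta.
under eq_bigr do rewrite mulr_suml.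
rewrite exchange_big sum2Z sum2D.
have [a ca] := alternating2_ex; have [a' Ha] := alternating3_ex.
by apply: sum2_sym => k r; rewrite /levi !ca !Ha; field.
Qed.

Definition form_bracket_sum (b : I -> I -> R) :=
  \sum_k \sum_r \sum_j \sum_p H k r j * (c k r p * b p j).

Lemma pairing_cod_unimod (b : I -> I -> R) : (forall i j, b i j = - b j i) ->
  pairing b cod_unimod = - form_bracket_sum b.
Proof.
move=> bA; transitivity (\sum_i \sum_j \sum_k \sum_r - (b i j * (c k r i * H k r j))).
  rewrite /pairing.
  rewrite (eq_sum2 (G := fun i j => \sum_k \sum_r - 2^-1 *
      (b i j * (c k r i * H k r j - c k r j * H k r i)))); last first.
    by move=> i j; rewrite /cod_unimod !sum2Z; apply: eq_sum2 => k r; ring.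
  apply: sum2_sym => i j; rewrite !sum2D; apply: eq_sum2 => k r.
  by rewrite (bA j i); field.
rewrite sum4_rot sum_swap34 -mulN1r sum2Z; apply: eq_sum2 => k r.
by rewrite sum2Z; apply: eq_sum2 => j p; rewrite (bA p j); ring.
Qed.

Lemma sum_rot (F : I -> I -> I -> R) :
  \sum_i \sum_j \sum_k F i j k = \sum_k \sum_i \sum_j F i j k.
Proof. by rewrite sum_swap23 exchange_big. Qed.

Lemma sum3D (F G : I -> I -> I -> R) :
  \sum_i \sum_j \sum_k F i j k + \sum_i \sum_j \sum_k G i j k =
  \sum_i \sum_j \sum_k (F i j k + G i j k).
Proof. by rewrite sum2D; apply: eq_sum2 => i j; rewrite big_split. Qed.

(** The three terms of db contribute equally because H is alternating, whence the factor 3. Compared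
    with [pairing_cod_unimod], this is the adjointness of d and [cod_unimod]; the 3 is the ratio of
    the normalisations 1/2 and 1/6 of the norms of 2-forms and 3-forms. *)
Lemma pairing_ext2 (b : I -> I -> R) :
  \sum_i \sum_j \sum_k H i j k * ext2_const b i j k = - 3 * form_bracket_sum b.
Proof.
pose U i j k := \sum_m H i j k * (c i j m * b m k).
have UE : form_bracket_sum b = \sum_i \sum_j \sum_k U i j k by [].
have U1 : \sum_i \sum_j \sum_k - U i k j = - form_bracket_sum b.
  rewrite sum_swap23 -mulN1r UE sum2Z; apply: eq_sum2 => i j.
  by rewrite mulr_sumr; apply: eq_bigr => k _; rewrite mulN1r.
have U2 : \sum_i \sum_j \sum_k - U j k i = - form_bracket_sum b.
  rewrite -sum_rot -mulN1r UE sum2Z; apply: eq_sum2 => i j.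
  by rewrite mulr_sumr; apply: eq_bigr => k _; rewrite mulN1r.
have U0 : \sum_i \sum_j \sum_k - U i j k = - form_bracket_sum b.
  rewrite -mulN1r UE sum2Z; apply: eq_sum2 => i j.
  by rewrite mulr_sumr; apply: eq_bigr => k _; rewrite mulN1r.
transitivity (\sum_i \sum_j \sum_k - U i j k + \sum_i \sum_j \sum_k - U i k j
  + \sum_i \sum_j \sum_k - U j k i); last by rewrite U0 U1 U2; ring.
rewrite !sum3D; apply: eq_sum2 => i j; apply: eq_bigr => k _.
rewrite /ext2_const /U -!mulr_sumr.
have [a' Ha] := alternating3_ex.
by rewrite !Ha; ring.
Qed.

Hypothesis Hclosed : closed3_const.

Lemma contr_theta_anti i j : contr_theta i j = - contr_theta j i.
Proof.
rewrite /contr_theta -sumrN; apply: eq_bigr => m _.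
by rewrite (Halt m i j).2 mulrN.
Qed.

(** Cartan's formula for a closed H and the vector Z dual to theta: the terms in [ad_theta] form the
    Lie derivative of H along Z, those in [contr_theta] the differential of the contraction of H
    with Z. *)
Lemma contr_theta_closed k r j :
  \sum_p (- ad_theta k p * H p r j + ad_theta r p * H p k j
          - ad_theta j p * H p k r + c k r p * contr_theta p j
          - c k j p * contr_theta p r + c r j p * contr_theta p k) = 0.
Proof.
transitivity (\sum_m theta m *
  (- \sum_p c m k p * H p r j + \sum_p c m r p * H p k j - \sum_p c m j p * H p k r
  - \sum_p c k r p * H p m j + \sum_p c k j p * H p m r - \sum_p c r j p * H p m k)).
  rewrite [RHS](eq_bigr (fun m => \sum_p theta m *
    (- (c m k p * H p r j) + c m r p * H p k j - c m j p * H p k r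
     - c k r p * H p m j + c k j p * H p m r - c r j p * H p m k))); last first.
    by move=> m _; rewrite -mulr_sumr !big_split /= !sumrN.
  rewrite [RHS]exchange_big; apply: eq_bigr => p _ /=.
  rewrite /ad_theta /contr_theta !mulNr !mulr_suml !mulr_sumr.
  rewrite -!sumrN -!big_split /=; apply: eq_bigr => m _.
  rewrite (Halt m p j).1 (Halt m p r).1 (Halt m p k).1.
  by ring.
by rewrite big1 // => m _; rewrite Hclosed mulr0.
Qed.

Lemma Hsq_sym i j : Hsq_frame i j = Hsq_frame j i.
Proof. by apply: eq_sum2 => k r; rewrite mulrC. Qed.

(** Cartan's formula paired with H. Each of its two groups consists of three terms that contribute
    equally; the Lie derivative yields H^2 against [ad_theta], and the differential becomes
    [cod_unimod] by adjointness. *)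
Lemma pairing_theta_Hsq :
  pairing sym_theta Hsq_frame = - pairing contr_theta cod_unimod.
Proof.
rewrite (pairing_sym_theta Hsq_sym) (pairing_cod_unimod contr_theta_anti) opprK.
pose U k r j := \sum_p H k r j * (ad_theta k p * H p r j).
pose V k r j := \sum_p H k r j * (c k r p * contr_theta p j).
have UE : pairing ad_theta Hsq_frame = \sum_k \sum_r \sum_j U k r j.
  rewrite /U [RHS]sum_swap34 sum_swap23; apply: eq_sum2 => k p.
  by rewrite /Hsq_frame sum2Z; apply: eq_sum2 => r j; ring.
have E : \sum_k \sum_r \sum_j (- U k r j - U r k j - U j k r
                               + (V k r j + V k j r + V r j k)) = 0.
  rewrite big1 // => k _; rewrite big1 // => r _; rewrite big1 // => j _.
  rewrite -[RHS](mulr0 (H k r j)) -(contr_theta_closed k r j) mulr_sumr.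
  rewrite /U /V -!sumrN -!big_split /=; apply: eq_bigr => p _.
  have [a' Ha] := alternating3_ex.
  by rewrite !Ha; ring.
have UU : \sum_k \sum_r \sum_j (U k r j + U r k j + U j k r) = 3 * pairing ad_theta Hsq_frame.
  rewrite UE -!sum3D [X in _ + X + _]exchange_big /=.
  by rewrite [X in _ + _ + X]sum_rot; ring.
have VV : \sum_k \sum_r \sum_j (V k r j + V k j r + V r j k) = 3 * form_bracket_sum contr_theta.
  rewrite -!sum3D [X in _ + X + _]sum_swap23 -[X in _ + _ + X]sum_rot.
  by rewrite /form_bracket_sum /V; ring.
apply/eqP; rewrite -subr_eq0; apply/eqP.
apply: (@mulfI R (- 3)); first by rewrite oppr_eq0 pnatr_eq0.
rewrite mulr0 -[RHS]E mulrBr mulNr -UU mulNr opprK -VV.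
rewrite -mulN1r sum2Z sum2D; apply: eq_sum2 => k r.
rewrite mulr_sumr -big_split; apply: eq_bigr => j _ /=.
by ring.
Qed.

Lemma contr_theta_norm : pairing contr_theta contr_theta = pairing Hsq_frame theta2.
Proof. exact/esym/(sum_quad H H). Qed.

Definition flow_g i j := - 2 * ric_frame i j + 2^-1 * Hsq_frame i j.
Definition flow_b i j := - cod_frame i j.

(* Only the terms coming from theta, that is from a non-unimodular bracket, are
   not manifestly a gradient; they cancel because ad_theta is a derivation and H
   is closed. *)
Lemma lyapunov_frame :
  pairing (fun i j => - moment i j + 2^-1 * killing i j + 4^-1 * Hsq_frame i j) flow_g
  + pairing flow_g theta2
  - 6^-1 * (\sum_i \sum_j \sum_k H i j k * ext2_const flow_b i j k)
  = 2^-1 * (pairing flow_g flow_g + pairing flow_b flow_b).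
Proof.
have bA i j : flow_b i j = - flow_b j i.
  rewrite /flow_b /cod_frame; congr (- _); rewrite -mulN1r sum2Z.
  by apply: eq_sum2 => k r; rewrite (Halt r i j).2 (Halt k r j).2 (Halt k i r).2; ring.
rewrite pairing_ext2 -[form_bracket_sum _]opprK -(pairing_cod_unimod bA).
have gE i j : flow_g i j = - 2 * moment i j + killing i j + 2 * sym_theta i j
                           + 2^-1 * Hsq_frame i j.
  by rewrite /flow_g ric_frameE; field.
have bE i j : flow_b i j = - contr_theta i j - cod_unimod i j.
  by rewrite /flow_b cod_frameE opprD.
have X1 := pairing_theta_moment; have X2 := pairing_theta_killing.
have X3 := sym_theta_norm; have X4 := sym_theta_theta.
have X5 := pairing_theta_Hsq; have X6 := contr_theta_norm.
(* [flow_g] is twice the left argument here plus [2 * sym_theta], and [flow_b] is minus [cod_unimod]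
   minus [contr_theta]. S1 and S2 split off the squares; what remains are pairings with theta terms,
   which X1 to X6 cancel. *)
have S1 : pairing (fun i j => - moment i j + 2^-1 * killing i j + 4^-1 * Hsq_frame i j) flow_g
   = 2^-1 * pairing flow_g flow_g + - 1 * pairing sym_theta flow_g.
  rewrite /pairing !sum2Z sum2D; apply: eq_sum2 => i j.
  by rewrite gE; field.
have S2 : pairing flow_b cod_unimod = - 1 * pairing flow_b flow_b + - 1 * pairing flow_b contr_theta.
  rewrite /pairing !sum2Z sum2D; apply: eq_sum2 => i j.
  by rewrite !bE; ring.
have S3 : pairing flow_b contr_theta = - 1 * pairing contr_theta contr_theta
   + - 1 * pairing contr_theta cod_unimod.
  rewrite /pairing !sum2Z sum2D; apply: eq_sum2 => i j.
  by rewrite !bE; ring.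
have S4 : pairing sym_theta flow_g = - 2 * pairing sym_theta moment
   + pairing sym_theta killing + 2 * pairing sym_theta sym_theta
   + 2^-1 * pairing sym_theta Hsq_frame.
  rewrite /pairing !sum2Z !sum2D; apply: eq_sum2 => i j.
  by rewrite !gE; ring.
have S5 : pairing flow_g theta2 = - 2 * pairing moment theta2
   + pairing killing theta2 + 2 * pairing sym_theta theta2
   + 2^-1 * pairing Hsq_frame theta2.
  rewrite /pairing !sum2Z !sum2D; apply: eq_sum2 => i j.
  by rewrite !gE; ring.
rewrite S1 S2 S3 S4 S5 X1 X2 X3 X4 X5 -X6.
by field.
Qed.

End ThreeForm.
End Bracket.
End OrthonormalFrame.

(* [lev i] is the step of the derived series at which the i-th basis vector
   lives. *)
Section ScalarSign.
Context (R : realFieldType) (I : finType) (c : I -> I -> I -> R) (lev : I -> nat).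
Hypothesis calt : alternating2 c.
Hypothesis clev : forall i j k, c i j k != 0 ->
  [/\ (lev i <= lev k)%N, (lev j <= lev k)%N & lev i = lev j -> (lev i < lev k)%N].

Lemma killing_trace_ge :
  0 <= 4^-1 * (\sum_i \sum_j \sum_k c i j k ^+ 2) + 2^-1 * \sum_j killing c j j.
Proof.
(* The weight orients each pair of indices towards the higher level. By antisymmetry the weighted
   squares W make up at most half of |c|^2, while in a nonzero product c_ijk c_ikj both squares
   carry weight 1, so that the square of c_ijk + c_ikj can be completed. *)
pose lt i j : R := (lev i < lev j)%N%:R.
have lt01 i j : 0 <= lt i j <= 1 by rewrite /lt; case: (_ < _)%N; rewrite lexx ler01.
have ltA i j : lt i j + lt j i <= 1.
  by rewrite /lt; case: ltngtP => _; rewrite ?addr0 ?add0r ?lexx ?ler01.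
pose W := \sum_i \sum_j \sum_k lt i j * c i j k ^+ 2.
have W2 : 2 * W <= \sum_i \sum_j \sum_k c i j k ^+ 2.
  have -> : 2 * W = \sum_i \sum_j \sum_k (lt i j + lt j i) * c i j k ^+ 2.
    have -> : 2 * W = W + \sum_i \sum_j \sum_k lt j i * c j i k ^+ 2.
      by rewrite mulr_natl mulr2n; congr (W + _); rewrite [RHS]exchange_big.
    rewrite sum3D; apply: eq_sum2 => i j; apply: eq_bigr => k _.
    by rewrite (calt j i); ring.
  apply: ler_sum => i _; apply: ler_sum => j _; apply: ler_sum => k _.
  by rewrite ler_piMl ?sqr_ge0.
have S : 0 <= W + \sum_i \sum_j \sum_k c i j k * c i k j.
  have -> : W + \sum_i \sum_j \sum_k c i j k * c i k j = 2^-1 *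
    \sum_i \sum_j \sum_k (lt i j * c i j k ^+ 2 + lt i k * c i k j ^+ 2 + 2 * c i j k * c i k j).
    have -> : \sum_i \sum_j \sum_k (lt i j * c i j k ^+ 2 + lt i k * c i k j ^+ 2
        + 2 * c i j k * c i k j) = W + W + (\sum_i \sum_j \sum_k c i j k * c i k j
        + \sum_i \sum_j \sum_k c i j k * c i k j).
      have W' : W = \sum_i \sum_j \sum_k lt i k * c i k j ^+ 2 by rewrite /W sum_swap23.
      rewrite [in X in _ = _ + X + _]W' /W !sum3D.
      by apply: eq_sum2 => i j; apply: eq_bigr => k _; ring.
    by field.
  rewrite mulr_ge0 ?invr_ge0 ?ler0n // sumr_ge0 // => i _.
  apply: sumr_ge0 => j _; apply: sumr_ge0 => k _.
  have p1 : 0 <= lt i j * c i j k ^+ 2 by rewrite mulr_ge0 ?sqr_ge0 //; case/andP: (lt01 i j).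
  have p2 : 0 <= lt i k * c i k j ^+ 2 by rewrite mulr_ge0 ?sqr_ge0 //; case/andP: (lt01 i k).
  have [e|c1] := eqVneq (c i j k) 0.
    by rewrite [2 * _ * _](_ : _ = 0) ?addr0 ?addr_ge0 // e mulr0 mul0r.
  have [e|c2] := eqVneq (c i k j) 0.
    by rewrite [2 * _ * _](_ : _ = 0) ?addr0 ?addr_ge0 // e mulr0.
  have [a1 a2 a3] := clev c1; have [b1 b2 b3] := clev c2.
  have ejk : lev j = lev k by apply/eqP; rewrite eqn_leq a2 b2.
  have lij : (lev i < lev j)%N.
    rewrite ltn_neqAle b1 andbT; apply/eqP => eij.
    by have := a3 eij; rewrite -ejk eij ltnn.
  rewrite /lt -ejk lij !mul1r.
  by have -> : c i j k ^+ 2 + c i k j ^+ 2 + 2 * c i j k * c i k j =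
    (c i j k + c i k j) ^+ 2; [ring | exact: sqr_ge0].
have -> : \sum_j killing c j j = \sum_i \sum_j \sum_k c i j k * c i k j by [].
by lra.
Qed.

End ScalarSign.

(** * Change of frame *)

Section Multilinear.
Context (R : realFieldType) (n : nat).
Implicit Types (x y z u v : 'rV[R]_n) (A : 'I_n -> 'I_n -> 'I_n -> R).

(** Stated for arbitrary finite combinations so that expanding a vector in a frame of any size is a
    single rewrite. *)
Definition lin (f : 'rV[R]_n -> R) := forall p (s : 'I_p -> R) (e : 'I_p -> 'rV[R]_n),
  f (\sum_a s a *: e a) = \sum_a s a * f (e a).

Definition bilin (F : 'rV[R]_n -> 'rV[R]_n -> R) :=
  (forall y, lin (F^~ y)) /\ (forall x, lin (F x)).

Definition bil A x y : 'rV[R]_n := \row_k \sum_i \sum_j x 0 i * y 0 j * A i j k.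
Definition tri A x y z : R := \sum_k bil A x y 0 k * z 0 k.
Definition mform (M : 'M[R]_n) x y : R := \sum_i \sum_j M i j * (x 0 i * y 0 j).

Lemma lin_coord k : lin (fun x => x 0 k).
Proof. by move=> p s e; rewrite summxE; apply: eq_bigr => a _; rewrite mxE. Qed.

Lemma bilin_mul f h : lin f -> lin h -> bilin (fun x y => f x * h y).
Proof.
move=> lf lh; split => [y|x] p s e; first by rewrite lf mulr_suml; apply: eq_bigr => a _; rewrite mulrA.
by rewrite lh mulr_sumr; apply: eq_bigr => a _; rewrite mulrCA.
Qed.

Lemma bilin_sum (J : finType) (w : J -> R) (F : J -> 'rV[R]_n -> 'rV[R]_n -> R) :
  (forall j, bilin (F j)) -> bilin (fun x y => \sum_j w j * F j x y).
Proof.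
move=> hF; split => [y|x] p s e.
  rewrite (eq_bigr (fun j => \sum_a s a * (w j * F j (e a) y))); last first.
    by move=> j _; rewrite (hF j).1 mulr_sumr; apply: eq_bigr => a _; rewrite mulrCA.
  by rewrite exchange_big; apply: eq_bigr => a _; rewrite mulr_sumr.
rewrite (eq_bigr (fun j => \sum_a s a * (w j * F j x (e a)))); last first.
  by move=> j _; rewrite (hF j).2 mulr_sumr; apply: eq_bigr => a _; rewrite mulrCA.
by rewrite exchange_big; apply: eq_bigr => a _; rewrite mulr_sumr.
Qed.

Lemma bilin_sum2 (w : 'I_n -> 'I_n -> R) F :
  (forall i j, bilin (F i j)) -> bilin (fun x y => \sum_i \sum_j w i j * F i j x y).
Proof.
move=> hF; have := @bilin_sum ('I_n * 'I_n)%type (fun p => w p.1 p.2)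
  (fun p => F p.1 p.2) (fun p => hF p.1 p.2).
have E x y : \sum_j w j.1 j.2 * F j.1 j.2 x y = \sum_i \sum_j w i j * F i j x y.
  by rewrite pair_bigA.
by move=> [h1 h2]; split => [y|x] p s e; [have := h1 y p s e | have := h2 x p s e];
   rewrite !E => ->; apply: eq_bigr => a _; rewrite E.
Qed.

Lemma bil_suml A (p : nat) (s : 'I_p -> R) (e : 'I_p -> 'rV[R]_n) y :
  bil A (\sum_a s a *: e a) y = \sum_a s a *: bil A (e a) y.
Proof.
apply/rowP => k; rewrite summxE mxE.
under [RHS]eq_bigr do rewrite !mxE mulr_sumr.
rewrite [RHS]exchange_big; apply: eq_bigr => i _ /=.
under [RHS]eq_bigr do rewrite mulr_sumr.
rewrite exchange_big; apply: eq_bigr => j _.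
rewrite summxE !mulr_suml; apply: eq_bigr => a _.
by rewrite !mxE !mulrA.
Qed.

Lemma bil_sumr A (p : nat) (s : 'I_p -> R) (e : 'I_p -> 'rV[R]_n) x :
  bil A x (\sum_a s a *: e a) = \sum_a s a *: bil A x (e a).
Proof.
apply/rowP => k; rewrite summxE mxE.
under [RHS]eq_bigr do rewrite !mxE mulr_sumr.
rewrite [RHS]exchange_big; apply: eq_bigr => i _ /=.
under [RHS]eq_bigr do rewrite mulr_sumr.
rewrite exchange_big; apply: eq_bigr => j _.
rewrite summxE mulr_sumr mulr_suml; apply: eq_bigr => a _.
by rewrite !mxE; ring.
Qed.

Lemma triE A x y z :
  tri A x y z = \sum_i \sum_j \sum_k x 0 i * y 0 j * z 0 k * A i j k.
Proof.
rewrite /tri; under eq_bigr do rewrite mxE mulr_suml.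
rewrite exchange_big; apply: eq_bigr => i _ /=.
under eq_bigr do rewrite mulr_suml.
rewrite exchange_big; apply: eq_bigr => j _ /=.
by apply: eq_bigr => k _; ring.
Qed.

Lemma tri_perm213 A x y z : tri A x y z = tri (fun i j k => A j i k) y x z.
Proof.
rewrite !triE exchange_big; apply: eq_sum2 => i j; apply: eq_bigr => k _; ring.
Qed.

Lemma tri_perm132 A x y z : tri A x y z = tri (fun i j k => A i k j) x z y.
Proof.
rewrite !triE sum_swap23; apply: eq_sum2 => i j; apply: eq_bigr => k _; ring.
Qed.

Lemma tri_lin1 A y z : lin (fun x => tri A x y z).
Proof.
move=> p s e; rewrite /tri bil_suml.
under [RHS]eq_bigr do rewrite mulr_sumr.
rewrite exchange_big; apply: eq_bigr => k _.
rewrite summxE mulr_suml; apply: eq_bigr => a _; by rewrite mxE mulrA.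
Qed.

Lemma tri_lin2 A x z : lin (fun y => tri A x y z).
Proof.
move=> p s e; rewrite tri_perm213 tri_lin1; apply: eq_bigr => a _.
by rewrite [in RHS]tri_perm213.
Qed.

Lemma tri_lin3 A x y : lin (fun z => tri A x y z).
Proof.
move=> p s e; rewrite tri_perm132 tri_lin2; apply: eq_bigr => a _.
by rewrite [in RHS]tri_perm132.
Qed.

Lemma bil_deltal A i y k : bil A (delta_mx 0 i) y 0 k = \sum_m y 0 m * A i m k.
Proof.
rewrite mxE (bigD1 i) //= [X in _ + X]big1 ?addr0 => [|l /negPf li].
  by apply: eq_bigr => m _; rewrite mxE !eqxx mul1r.
by rewrite big1 // => m _; rewrite mxE li andbF !mul0r.
Qed.

Lemma bil_deltar A x j k : bil A x (delta_mx 0 j) 0 k = \sum_m x 0 m * A m j k.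
Proof.
rewrite mxE; apply: eq_bigr => m _; rewrite (bigD1 j) //= big1 ?addr0 => [|l /negPf lj].
  by rewrite mxE !eqxx mulr1.
by rewrite mxE lj andbF mulr0 mul0r.
Qed.

Lemma sum_delta (F : 'I_n -> R) i : \sum_m (delta_mx 0 i : 'rV[R]_n) 0 m * F m = F i.
Proof.
rewrite (bigD1 i) //= big1 ?addr0 => [|l /negPf li]; first by rewrite mxE !eqxx mul1r.
by rewrite mxE li andbF mul0r.
Qed.

Lemma bil_delta A i j k : bil A (delta_mx 0 i) (delta_mx 0 j) 0 k = A i j k.
Proof. by rewrite bil_deltal sum_delta. Qed.

Lemma tri_delta A i j k :
  tri A (delta_mx 0 i) (delta_mx 0 j) (delta_mx 0 k) = A i j k.
Proof.
rewrite /tri -[RHS](sum_delta (A i j)); apply: eq_bigr => m _.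
by rewrite bil_delta mulrC.
Qed.

Lemma bil_mulmx A x y (M : 'M[R]_n) :
  bil A x y *m M = bil (fun i j k => \sum_m A i j m * M m k) x y.
Proof.
apply/rowP => k; rewrite !mxE.
under eq_bigr do rewrite mxE mulr_suml.
rewrite exchange_big; apply: eq_bigr => i _ /=.
under eq_bigr do rewrite mulr_suml.
rewrite exchange_big; apply: eq_bigr => j _ /=.
by rewrite mulr_sumr; apply: eq_bigr => m _; rewrite mulrA.
Qed.

Lemma mformE M x y : mform M x y = (x *m M *m y^T) 0 0.
Proof.
rewrite mxE /mform exchange_big; apply: eq_bigr => j _ /=.
rewrite !mxE mulr_suml; apply: eq_bigr => i _; ring.
Qed.

Lemma mform_bilin M : bilin (mform M).
Proof. by apply: bilin_sum2 => i j; apply: bilin_mul; exact: lin_coord. Qed.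

Lemma mform_delta (M : 'M[R]_n) i j : mform M (delta_mx 0 i) (delta_mx 0 j) = M i j.
Proof.
rewrite mformE -rowE mxE -[RHS](sum_delta (M i)); apply: eq_bigr => k _.
by rewrite !mxE mulrC.
Qed.

End Multilinear.

Lemma mform_mul (R : realFieldType) (n m : nat) (A : 'M[R]_(n, m)) (N : 'M[R]_m) x y :
  mform (A *m N *m A^T) x y = mform N (x *m A) (y *m A).
Proof. by rewrite !mformE trmx_mul !mulmxA. Qed.

Section MultilinearExtension.
Context (R : realFieldType) (n : nat).
Implicit Types (x y z : 'rV[R]_n) (A : 'I_n -> 'I_n -> 'I_n -> R).

Definition lin_vec (f : 'rV[R]_n -> 'rV[R]_n) :=
  forall p (s : 'I_p -> R) (e : 'I_p -> 'rV[R]_n),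
  f (\sum_a s a *: e a) = \sum_a s a *: f (e a).

Lemma lin_comp f h : lin f -> lin_vec h -> lin (fun x => f (h x)).
Proof. by move=> lf lh p s e; rewrite lh lf. Qed.

Lemma lin_vec_comp f h : lin_vec f -> lin_vec h -> lin_vec (fun x => f (h x)).
Proof. by move=> lf lh p s e; rewrite lh lf. Qed.

Lemma linD f h : lin f -> lin h -> lin (fun x => f x + h x : R).
Proof.
move=> lf lh p s e; rewrite lf lh -big_split.
by apply: eq_bigr => a _; rewrite mulrDr.
Qed.

Lemma linN f : lin f -> lin (fun x => - f x : R).
Proof.
by move=> lf p s e; rewrite lf -sumrN; apply: eq_bigr => a _; rewrite mulrN.
Qed.

Lemma bilin_eq F G : bilin F -> (forall x y, F x y = G x y :> R) -> bilin G.
Proof.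
move=> [f1 f2] FG; split => [y|x] p s e; rewrite -FG.
  by rewrite f1; apply: eq_bigr => a _; rewrite FG.
by rewrite f2; apply: eq_bigr => a _; rewrite FG.
Qed.

Lemma bilin_bigsum (J : finType) F : (forall j : J, bilin (F j)) ->
  bilin (fun x y => \sum_j F j x y : R).
Proof.
move=> hF; apply: bilin_eq (bilin_sum (fun=> 1) hF) _ => x y.
by apply: eq_bigr => j _; rewrite mul1r.
Qed.

Lemma mform_ext F x y : bilin F ->
  mform (\matrix_(i, j) F (delta_mx 0 i) (delta_mx 0 j)) x y = F x y :> R.
Proof.
move=> [f1 f2]; rewrite [in RHS](row_sum_delta x) f1; apply: eq_bigr => i _.
rewrite [in RHS](row_sum_delta y) f2 mulr_sumr; apply: eq_bigr => j _.
by rewrite mxE; ring.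
Qed.

Lemma eq_tri A A' x y z : (forall i j k, A i j k = A' i j k) ->
  tri A x y z = tri A' x y z.
Proof.
move=> AA; rewrite !triE; apply: eq_sum2 => i j; apply: eq_bigr => k _.
by rewrite AA.
Qed.

Lemma tri_ext (T : 'rV[R]_n -> 'rV[R]_n -> 'rV[R]_n -> R) x y z :
  (forall y z, lin (fun x => T x y z)) -> (forall x z, lin (fun y => T x y z)) ->
  (forall x y, lin (T x y)) ->
  tri (fun i j k => T (delta_mx 0 i) (delta_mx 0 j) (delta_mx 0 k)) x y z = T x y z.
Proof.
move=> t1 t2 t3; rewrite triE [in RHS](row_sum_delta x) t1; apply: eq_bigr => i _.
rewrite [in RHS](row_sum_delta y) t2 mulr_sumr; apply: eq_bigr => j _.
rewrite [in RHS](row_sum_delta z) t3 !mulr_sumr; apply: eq_bigr => k _.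
by ring.
Qed.

Lemma tri0_ext (T : 'rV[R]_n -> 'rV[R]_n -> 'rV[R]_n -> R) x y z :
  (forall y z, lin (fun x => T x y z)) -> (forall x z, lin (fun y => T x y z)) ->
  (forall x y, lin (T x y)) ->
  (forall i j k, T (delta_mx 0 i) (delta_mx 0 j) (delta_mx 0 k) = 0) ->
  T x y z = 0.
Proof.
move=> t1 t2 t3 T0; rewrite -(tri_ext _ _ _ t1 t2 t3) triE.
by do 3![apply: big1 => ? _]; rewrite T0 mulr0.
Qed.

Lemma bil_linl A y : lin_vec (fun x => bil A x y).
Proof. by move=> p s e; exact: bil_suml. Qed.

Lemma bil_linr A x : lin_vec (bil A x).
Proof. by move=> p s e; exact: bil_sumr. Qed.

Lemma tri_permE A x y z : tri (fun i j k => A j k i) x y z = tri A y z x.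
Proof. by rewrite tri_perm213 tri_perm132. Qed.

Lemma triD A A' x y z :
  tri (fun i j k => A i j k + A' i j k) x y z = tri A x y z + tri A' x y z.
Proof.
rewrite !triE sum3D; apply: eq_sum2 => i j; apply: eq_bigr => k _; ring.
Qed.

Lemma triN A x y z : tri (fun i j k => - A i j k) x y z = - tri A x y z.
Proof.
rewrite !triE -mulN1r sum2Z; apply: eq_sum2 => i j.
by rewrite mulr_sumr; apply: eq_bigr => k _; ring.
Qed.

End MultilinearExtension.

(* The tensors of the flow equations when all components are constant; [ga]
   stands for the inverse of [g]. *)
Section ConstantCoefficients.
Context (R : realFieldType) (n : nat) (c : 'I_n -> 'I_n -> 'I_n -> R).
Implicit Types (g ga : 'M[R]_n) (H : 'I_n -> 'I_n -> 'I_n -> R).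

Definition koszul_const g i j k :=
  \sum_m c i j m * g m k - \sum_m c i k m * g m j - \sum_m c j k m * g m i.
Definition chr_const g ga i j k := 2^-1 * \sum_l ga k l * koszul_const g i j l.
Definition ric_const g ga j k :=
  \sum_i \sum_m (chr_const g ga j k m * chr_const g ga i m i
                 - chr_const g ga i k m * chr_const g ga j m i
                 - c i j m * chr_const g ga m k i).
Definition Hsq_const ga H i j :=
  \sum_k \sum_l \sum_r \sum_s ga k l * ga r s * H i k r * H j l s.
Definition cod_const g ga H i j :=
  - \sum_k \sum_l ga k l * - \sum_r (chr_const g ga k l r * H r i j
      + chr_const g ga k i r * H l r j + chr_const g ga k j r * H l i r).

Definition curv g ga x y z : 'rV[R]_n :=
  let nab := bil (chr_const g ga) in
  nab x (nab y z) - nab y (nab x z) - nab (bil c x y) z.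

Lemma curv_delta g ga i j k :
  curv g ga (delta_mx 0 i) (delta_mx 0 j) (delta_mx 0 k) 0 i =
  \sum_m (chr_const g ga j k m * chr_const g ga i m i
          - chr_const g ga i k m * chr_const g ga j m i
          - c i j m * chr_const g ga m k i).
Proof.
have mxB (u v : 'rV[R]_n) : (u - v) 0 i = u 0 i - v 0 i by rewrite !mxE.
rewrite /curv !mxB !bil_deltal bil_deltar.
rewrite -!sumrB; apply: eq_bigr => m _.
by rewrite !bil_delta.
Qed.

Lemma curv_lin1 g ga y z : lin_vec (fun x => curv g ga x y z).
Proof.
move=> p s e; rewrite /curv !(bil_suml, bil_sumr) -!sumrB.
by apply: eq_bigr => a _; rewrite !scalerBr.
Qed.

Lemma curv_lin2 g ga x z : lin_vec (fun y => curv g ga x y z).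
Proof.
move=> p s e; rewrite /curv !(bil_suml, bil_sumr) -!sumrB.
by apply: eq_bigr => a _; rewrite !scalerBr.
Qed.

Lemma curv_lin3 g ga x y : lin_vec (fun z => curv g ga x y z).
Proof.
move=> p s e; rewrite /curv !(bil_suml, bil_sumr) -!sumrB.
by apply: eq_bigr => a _; rewrite !scalerBr.
Qed.

(** The rows of P are a g-orthonormal frame; together with [on_invr], the field [on_inv] says that
    they span. Their number m is kept apart from n because adapted frames are built by adding one
    row at a time. *)
Record orthonormal g ga (m : nat) (P : 'M[R]_(m, n)) : Prop := Orthonormal {
  on_gram : P *m g *m P^T = 1%:M;
  on_inv : ga = P^T *m P;
  on_sym : g^T = g;
  on_invr : g *m ga = 1%:M }.

(** * Transport of the tensors to an orthonormal frame *)

Section Frame.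
Variables (g ga : 'M[R]_n) (m : nat) (P : 'M[R]_(m, n)).
Hypothesis onP : orthonormal g ga P.

Let e a := row a P.
Let Q := g *m P^T.

(** The coordinates of a vector x in the frame are its inner products with the rows, that is, the
    entries of [x *m (g *m P^T)]. *)
Definition frame_bracket a b d := (bil c (row a P) (row b P) *m (g *m P^T)) 0 d.
Definition frame_form3 H a b d := tri H (row a P) (row b P) (row d P).
Definition frame_form2 (M : 'M[R]_n) a b := mform M (row a P) (row b P).

Let fc := frame_bracket.

Lemma frame_QP : Q *m P = 1%:M.
Proof. by rewrite /Q -mulmxA -(on_inv onP) (on_invr onP). Qed.

Lemma frame_gaQ : ga *m Q = P^T.
Proof. by rewrite /Q mulmxA (mulmx1C (on_invr onP)) mul1mx. Qed.

Lemma frame_gaT : ga^T = ga.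
Proof. by rewrite (on_inv onP) trmx_mul trmxK. Qed.

Lemma frame_expand x : x = \sum_a (x *m Q) 0 a *: e a.
Proof. by rewrite -mulmx_sum_row -mulmxA frame_QP mulmx1. Qed.

Lemma lin_frame f : lin f -> forall x, f x = \sum_a (x *m Q) 0 a * f (e a).
Proof. by move=> lf x; rewrite {1}(frame_expand x) lf. Qed.

Lemma row_delta_sum a : e a = \sum_k P a k *: delta_mx 0 k.
Proof. by rewrite [LHS]row_sum_delta; apply: eq_bigr => k _; rewrite mxE. Qed.

(** N is arbitrary, and not just the identity that represents the inverse metric, because the
    derivative of the inverse metric is also of the form P^T N P, with N = - P h P^T. *)
Lemma contract_frame (N : 'M[R]_m) F : bilin F ->
  \sum_k \sum_l (P^T *m N *m P) k l * F (delta_mx 0 k) (delta_mx 0 l) =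
  \sum_a \sum_b N a b * F (e a) (e b).
Proof.
move=> bF.
transitivity (\sum_a \sum_b \sum_k \sum_l
    N a b * P a k * P b l * F (delta_mx 0 k) (delta_mx 0 l)); last first.
  apply: eq_sum2 => a b; rewrite [e a]row_delta_sum bF.1 mulr_sumr.
  apply: eq_bigr => k _; rewrite [e b]row_delta_sum bF.2 !mulr_sumr.
  by apply: eq_bigr => l _; ring.
transitivity (\sum_k \sum_l \sum_a \sum_b
    N a b * P a k * P b l * F (delta_mx 0 k) (delta_mx 0 l)).
  apply: eq_sum2 => k l; rewrite mxE mulr_suml exchange_big /=.
  apply: eq_bigr => b _; rewrite mxE !mulr_suml; apply: eq_bigr => a _.
  by rewrite mxE; ring.
rewrite (eq_bigr (fun k => \sum_a \sum_l \sum_b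
  N a b * P a k * P b l * F (delta_mx 0 k) (delta_mx 0 l))); last first.
  by move=> k _; rewrite exchange_big.
rewrite exchange_big; apply: eq_bigr => a _ /=.
rewrite [RHS]exchange_big; apply: eq_bigr => k _ /=.
by rewrite exchange_big.
Qed.

Lemma contract_frame1 F : bilin F ->
  \sum_k \sum_l ga k l * F (delta_mx 0 k) (delta_mx 0 l) = \sum_a F (e a) (e a).
Proof.
move=> bF; rewrite (on_inv onP) -[P^T]mulmx1 (contract_frame _ bF).
apply: eq_bigr => a _; rewrite (bigD1 a) //= big1 ?addr0 => [|b /negPf ba].
  by rewrite mxE eqxx mul1r.
by rewrite mxE eq_sym ba mul0r.
Qed.

Definition lowered i j k := \sum_l c i j l * g l k.

Lemma tri_lowered x y a : tri lowered x y (e a) = (bil c x y *m Q) 0 a.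
Proof.
rewrite /Q mulmxA bil_mulmx mxE; apply: eq_bigr => k _.
by rewrite [e a]/(row a P) !mxE.
Qed.

Lemma frame_levi a b d :
  (bil (chr_const g ga) (e a) (e b) *m Q) 0 d = levi fc a b d.
Proof.
have -> : bil (chr_const g ga) (e a) (e b) =
    bil (koszul_const g) (e a) (e b) *m (2^-1 *: ga).
  apply/rowP => k; rewrite bil_mulmx !mxE; apply: eq_sum2 => i j; congr (_ * _).
  rewrite /chr_const mulr_sumr; apply: eq_bigr => l _.
  by rewrite mxE -[in RHS]frame_gaT mxE; ring.
rewrite -scalemxAr -scalemxAl -mulmxA frame_gaQ mxE /levi; congr (_ * _).
have -> : (bil (koszul_const g) (e a) (e b) *m P^T) 0 d
          = tri (koszul_const g) (e a) (e b) (e d).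
  by rewrite mxE; apply: eq_bigr => k _; rewrite !mxE.
rewrite (eq_tri (A' := fun i j k => lowered i j k + - lowered i k j + - lowered j k i)) //.
by rewrite !triD !triN (tri_permE lowered) -(tri_perm132 lowered) !tri_lowered.
Qed.

Lemma frame_bil_r A x y d :
  (bil A x y *m Q) 0 d = \sum_f (y *m Q) 0 f * (bil A x (e f) *m Q) 0 d.
Proof.
rewrite {1}(frame_expand y) bil_sumr mulmx_suml summxE.
by apply: eq_bigr => f _; rewrite -scalemxAl mxE.
Qed.

Lemma frame_bil_l A x y d :
  (bil A x y *m Q) 0 d = \sum_f (x *m Q) 0 f * (bil A (e f) y *m Q) 0 d.
Proof.
rewrite {1}(frame_expand x) bil_suml mulmx_suml summxE.
by apply: eq_bigr => f _; rewrite -scalemxAl mxE.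
Qed.

Lemma bilin_curv_trace :
  bilin (fun y z => \sum_i curv g ga (delta_mx 0 i) y z 0 i).
Proof.
apply: bilin_bigsum => i; split => [z|y].
  exact: (lin_comp (lin_coord i) (curv_lin2 g ga (delta_mx 0 i) z)).
exact: (lin_comp (lin_coord i) (curv_lin3 g ga (delta_mx 0 i) y)).
Qed.

(** A trace may be taken in any basis: the columns of Q are the coframe dual to the rows of P. *)
Lemma trace_frame f : lin_vec f ->
  \sum_i f (delta_mx 0 i) 0 i = \sum_a (f (e a) *m Q) 0 a.
Proof.
move=> lf; transitivity (\sum_i \sum_a Q i a * f (e a) 0 i).
  apply: eq_bigr => i _; rewrite {1}(frame_expand (delta_mx 0 i)) lf summxE.
  by apply: eq_bigr => a _; rewrite -rowE !mxE.
rewrite exchange_big; apply: eq_bigr => a _ /=.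
by rewrite [RHS]mxE; apply: eq_bigr => i _; rewrite mulrC.
Qed.

Lemma frame_ric b d :
  mform (\matrix_(j, k) ric_const g ga j k) (e b) (e d) = ric_frame fc b d.
Proof.
rewrite -[RHS](_ : \sum_i curv g ga (delta_mx 0 i) (e b) (e d) 0 i = _).
  rewrite -(mform_ext _ _ bilin_curv_trace); congr mform.
  by apply/matrixP => j k; rewrite !mxE; apply: eq_bigr => i _; rewrite curv_delta.
rewrite (trace_frame (@curv_lin1 g ga (e b) (e d))); apply: eq_bigr => a _.
have mxB (u v : 'rV[R]_m) : (u - v) 0 a = u 0 a - v 0 a by rewrite !mxE.
rewrite /curv !mulmxBl !mxB !(frame_bil_r _ _ (bil _ _ _)).
rewrite [X in _ - X](frame_bil_l _ (bil _ _ _)) -!sumrB.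
by apply: eq_bigr => f _; rewrite !frame_levi.
Qed.

Lemma bilin_mulD (J : finType) (al be : J -> 'rV[R]_n -> R) :
  (forall j, lin (al j)) -> (forall j, lin (be j)) ->
  bilin (fun x y => \sum_j al j x * be j y).
Proof. by move=> la lb; apply: bilin_bigsum => j; exact: bilin_mul. Qed.

Lemma Hsq_const_frame H i j :
  Hsq_const ga H i j = \sum_d \sum_f
    tri H (delta_mx 0 i) (e d) (e f) * tri H (delta_mx 0 j) (e d) (e f).
Proof.
pose F (x y : 'rV[R]_n) := \sum_r \sum_s ga r s *
  (tri H (delta_mx 0 i) x (delta_mx 0 r) * tri H (delta_mx 0 j) y (delta_mx 0 s)).
have bF : bilin F.
  by apply: bilin_sum2 => r s; apply: bilin_mul; apply: tri_lin2.
transitivity (\sum_k \sum_l ga k l * F (delta_mx 0 k) (delta_mx 0 l)).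
  apply: eq_sum2 => k l; rewrite sum2Z; apply: eq_sum2 => r s.
  by rewrite !tri_delta; ring.
rewrite (contract_frame1 bF); apply: eq_bigr => d _.
rewrite -(contract_frame1 (F := fun u v => tri H (delta_mx 0 i) (e d) u
  * tri H (delta_mx 0 j) (e d) v)) //.
by apply: bilin_mul; apply: tri_lin3.
Qed.

Lemma frame_Hsq H a b :
  mform (\matrix_(i, j) Hsq_const ga H i j) (e a) (e b) =
  Hsq_frame (frame_form3 H) a b.
Proof.
pose F x y := \sum_d \sum_f tri H x (e d) (e f) * tri H y (e d) (e f).
have bF : bilin F.
  by apply: bilin_bigsum => d; apply: bilin_mulD => f; exact: tri_lin1.
rewrite -[RHS]/(F (e a) (e b)) -(mform_ext _ _ bF); congr mform.
by apply/matrixP => i j; rewrite !mxE Hsq_const_frame.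
Qed.

Let nab := bil (chr_const g ga).
Let nablaH H u v x y :=
  tri H (nab u v) x y + tri H v (nab u x) y + tri H v x (nab u y).

Lemma cod_const_frame H i j :
  cod_const g ga H i j = \sum_d nablaH H (e d) (e d) (delta_mx 0 i) (delta_mx 0 j).
Proof.
rewrite -(contract_frame1 (F := fun u v => nablaH H u v (delta_mx 0 i) (delta_mx 0 j))).
  rewrite /cod_const -mulN1r sum2Z; apply: eq_sum2 => k l.
  rewrite mulrN mulN1r opprK; congr (_ * _); rewrite !big_split /=.
  rewrite /nablaH; congr (_ + _ + _).
  - rewrite [RHS](_ : _ = \sum_r nab (delta_mx 0 k) (delta_mx 0 l) 0 r *
      tri H (delta_mx 0 r) (delta_mx 0 i) (delta_mx 0 j)).
      by apply: eq_bigr => r _; rewrite tri_delta bil_delta.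
    by rewrite {1}[nab _ _]row_sum_delta tri_lin1.
  - rewrite [RHS](_ : _ = \sum_r nab (delta_mx 0 k) (delta_mx 0 i) 0 r *
      tri H (delta_mx 0 l) (delta_mx 0 r) (delta_mx 0 j)).
      by apply: eq_bigr => r _; rewrite tri_delta bil_delta.
    by rewrite {1}[nab _ _]row_sum_delta tri_lin2.
  - rewrite [RHS](_ : _ = \sum_r nab (delta_mx 0 k) (delta_mx 0 j) 0 r *
      tri H (delta_mx 0 l) (delta_mx 0 i) (delta_mx 0 r)).
      by apply: eq_bigr => r _; rewrite tri_delta bil_delta.
    by rewrite {1}[nab _ _]row_sum_delta tri_lin3.
split => [v|u]; apply: linD; try (apply: linD).
- exact: (lin_comp (@tri_lin1 _ _ H _ _) (@bil_linl _ _ _ v)).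
- exact: (lin_comp (@tri_lin2 _ _ H v _) (@bil_linl _ _ _ _)).
- exact: (lin_comp (@tri_lin3 _ _ H v _) (@bil_linl _ _ _ _)).
- exact: (lin_comp (@tri_lin1 _ _ H _ _) (@bil_linr _ _ _ u)).
- exact: tri_lin1.
- exact: tri_lin1.
Qed.

Lemma frame_cod H a b :
  mform (\matrix_(i, j) cod_const g ga H i j) (e a) (e b) =
  cod_frame fc (frame_form3 H) a b.
Proof.
pose F x y := \sum_d nablaH H (e d) (e d) x y.
have bF : bilin F.
  apply: bilin_bigsum => d; split => [y|x]; apply: linD; try (apply: linD).
  - exact: tri_lin2.
  - exact: (lin_comp (@tri_lin2 _ _ H _ _) (@bil_linr _ _ _ _)).
  - exact: tri_lin2.
  - exact: tri_lin3.
  - exact: tri_lin3.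
  - exact: (lin_comp (@tri_lin3 _ _ H _ _) (@bil_linr _ _ _ _)).
transitivity (F (e a) (e b)).
  rewrite -(mform_ext _ _ bF); congr mform.
  by apply/matrixP => i j; rewrite !mxE cod_const_frame.
apply: eq_bigr => d _; rewrite /nablaH !big_split /=; congr (_ + _ + _).
- rewrite (lin_frame (@tri_lin1 _ _ H _ _)); apply: eq_bigr => f _.
  by rewrite frame_levi.
- rewrite (lin_frame (@tri_lin2 _ _ H _ _)); apply: eq_bigr => f _.
  by rewrite frame_levi.
- rewrite (lin_frame (@tri_lin3 _ _ H _ _)); apply: eq_bigr => f _.
  by rewrite frame_levi.
Qed.

Hypothesis calt : alternating2 c.
Hypothesis cjac : jacobi c.

Lemma bil_anti x y : bil c x y = - bil c y x.
Proof.
apply/rowP => k; rewrite !mxE exchange_big -sumrN; apply: eq_bigr => i _.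
by rewrite -sumrN; apply: eq_bigr => j _; rewrite (calt j i); ring.
Qed.

Lemma frame_alternating2 : alternating2 fc.
Proof. by move=> a b d; rewrite /fc /frame_bracket bil_anti mulNmx mxE. Qed.

Lemma bil_jacobi x y z :
  bil c (bil c x y) z + bil c (bil c y z) x + bil c (bil c z x) y = 0.
Proof.
apply/rowP => k; pose T x y z := bil c (bil c x y) z 0 k.
have lT1 y' z' : lin (fun x => T x y' z').
  exact: (lin_comp (lin_coord k) (lin_vec_comp (@bil_linl _ _ c z') (@bil_linl _ _ c y'))).
have lT2 x' z' : lin (fun y => T x' y z').
  exact: (lin_comp (lin_coord k) (lin_vec_comp (@bil_linl _ _ c z') (@bil_linr _ _ c x'))).
have lT3 x' y' : lin (T x' y').
  exact: (lin_comp (lin_coord k) (@bil_linr _ _ c _)).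
have mxD (u v : 'rV[R]_n) : (u + v) 0 k = u 0 k + v 0 k by rewrite mxE.
rewrite !mxD [RHS]mxE.
apply: (@tri0_ext R n (fun x y z => T x y z + T y z x + T z x y) x y z).
- by move=> y' z'; apply: linD; [apply: linD|].
- by move=> y' z'; apply: linD; [apply: linD|].
- by move=> y' z'; apply: linD; [apply: linD|].
move=> i j l; rewrite /T !bil_deltar -!big_split /= -[RHS](cjac i j l k).
by apply: eq_bigr => p _; rewrite !bil_delta.
Qed.

Lemma frame_jacobi : jacobi fc.
Proof.
move=> a b d f.
have T x y z : \sum_l (bil c x y *m Q) 0 l * fc l d f = (bil c (bil c x y) (e d) *m Q) 0 f.
  by rewrite [RHS]frame_bil_l.
rewrite !big_split /=.
have E x y z : (bil c (bil c x y) z *m Q) 0 f =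
    \sum_l (bil c x y *m Q) 0 l * (bil c (e l) z *m Q) 0 f by exact: frame_bil_l.
rewrite -(E (e a) (e b) (e d)) -(E (e b) (e d) (e a)) -(E (e d) (e a) (e b)).
transitivity (((bil c (bil c (e a) (e b)) (e d) + bil c (bil c (e b) (e d)) (e a)
  + bil c (bil c (e d) (e a)) (e b)) *m Q) 0 f); first by rewrite !mulmxDl !mxE.
by rewrite bil_jacobi mul0mx mxE.
Qed.

Lemma frame_alternating3 H : alternating3 H -> alternating3 (frame_form3 H).
Proof.
move=> Ha a b d; split; rewrite /frame_form3.
  rewrite tri_perm213 -triN; apply: eq_tri => i j k; exact: (Ha j i k).1.
rewrite tri_perm132 -triN; apply: eq_tri => i j k; exact: (Ha i k j).2.
Qed.

Lemma tri_bracket H x y z w :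
  tri H (bil c x y) z w = \sum_f (bil c x y *m Q) 0 f * tri H (e f) z w.
Proof. exact: (lin_frame (@tri_lin1 _ _ H z w)). Qed.

Lemma tri_bracket_delta H i j k l :
  tri H (bil c (delta_mx 0 i) (delta_mx 0 j)) (delta_mx 0 k) (delta_mx 0 l) =
  \sum_f c i j f * H f k l.
Proof.
rewrite [bil _ _ _]row_sum_delta tri_lin1; apply: eq_bigr => f _.
by rewrite tri_delta bil_delta.
Qed.

Lemma frame_closed3 H : closed3_const c H -> closed3_const fc (frame_form3 H).
Proof.
move=> Hc a b d f; pose B x y z w := tri H (bil c x y) z w.
pose T x y z w := - B x y z w + B x z y w - B x w y z - B y z x w + B y w x z - B z w x y.
have B1 y z w : lin (fun x => B x y z w).
  exact: (lin_comp (@tri_lin1 _ _ H z w) (@bil_linl _ _ c y)).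
have B2 x z w : lin (fun y => B x y z w).
  exact: (lin_comp (@tri_lin1 _ _ H z w) (@bil_linr _ _ c x)).
have B3 x y w : lin (fun z => B x y z w) by exact: tri_lin2.
have B4 x y z : lin (B x y z) by exact: tri_lin3.
have T4 x y z : lin (T x y z).
  by do 5![apply: linD; last by [|apply: linN]]; apply: linN.
(* The expression is linear in four arguments: the last is expanded directly, the other three are
   handled by [tri0_ext]. *)
have T0 x y z w : T x y z w = 0.
  rewrite (row_sum_delta w) T4 big1 // => l _.
  rewrite (@tri0_ext R n (fun x y z => T x y z (delta_mx 0 l))) ?mulr0 //.
  - by move=> *; do 5![apply: linD; last by [|apply: linN]]; apply: linN.
  - by move=> *; do 5![apply: linD; last by [|apply: linN]]; apply: linN.
  - by move=> *; do 5![apply: linD; last by [|apply: linN]]; apply: linN.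
  by move=> i j k; rewrite /T /B !tri_bracket_delta.
by rewrite -[RHS](T0 (e a) (e b) (e d) (e f)) /T /B !tri_bracket.
Qed.

Lemma frame_ext2 (M : 'M[R]_n) a b d :
  frame_form3 (ext2_const c (fun i j => M i j)) a b d =
  ext2_const fc (frame_form2 M) a b d.
Proof.
pose B x y z := mform M (bil c x y) z.
have B1 y z : lin (fun x => B x y z).
  exact: (lin_comp ((mform_bilin M).1 z) (@bil_linl _ _ c y)).
have B2 x z : lin (fun y => B x y z).
  exact: (lin_comp ((mform_bilin M).1 z) (@bil_linr _ _ c x)).
have B3 x y : lin (B x y) by exact: (mform_bilin M).2.
pose T x y z := - B x y z + B x z y - B y z x.
have BE x y z : B x y z = \sum_f (bil c x y *m Q) 0 f * mform M (e f) z.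
  exact: (lin_frame ((mform_bilin M).1 z)).
transitivity (T (e a) (e b) (e d)); last by rewrite /T !BE.
rewrite /frame_form3 -[RHS]tri_ext.
- apply: eq_tri => i j k; rewrite /T /B /ext2_const.
  have D p q r : mform M (bil c (delta_mx 0 p) (delta_mx 0 q)) (delta_mx 0 r)
      = \sum_l c p q l * M l r.
    rewrite [bil _ _ _]row_sum_delta (mform_bilin M).1; apply: eq_bigr => l _.
    by rewrite mform_delta bil_delta.
  by rewrite !D.
- by move=> *; do 2![apply: linD; last by [|apply: linN]]; apply: linN.
- by move=> *; do 2![apply: linD; last by [|apply: linN]]; apply: linN.
- by move=> *; do 2![apply: linD; last by [|apply: linN]]; apply: linN.
Qed.

Lemma frame_theta a : theta fc a = \sum_i P a i * theta c i.
Proof.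
pose T x := \sum_j bil c x (delta_mx 0 j) 0 j.
have lT : lin T.
  move=> p s v; rewrite /T; under [RHS]eq_bigr do rewrite mulr_sumr.
  rewrite exchange_big; apply: eq_bigr => j _.
  by rewrite bil_suml summxE; apply: eq_bigr => q _; rewrite mxE.
transitivity (T (e a)).
  by rewrite /T (trace_frame (@bil_linr _ _ c (e a))).
rewrite (row_delta_sum a) lT; apply: eq_bigr => i _; congr (_ * _).
by apply: eq_bigr => j _; rewrite bil_delta.
Qed.

Let kil x y := \sum_i bil c y (bil c x (delta_mx 0 i)) 0 i.

Lemma bilin_kil : bilin kil.
Proof.
apply: bilin_bigsum => i; split => [y|x].
  exact: (lin_comp (lin_coord i) (lin_vec_comp (@bil_linr _ _ c y) (@bil_linl _ _ c _))).
exact: (lin_comp (lin_coord i) (@bil_linl _ _ c _)).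
Qed.

Lemma kil_delta i j : kil (delta_mx 0 i) (delta_mx 0 j) = killing c i j.
Proof.
apply: eq_bigr => k _; rewrite bil_deltal; apply: eq_bigr => l _.
by rewrite bil_delta.
Qed.

Lemma kil_frame a b : kil (e a) (e b) = killing fc a b.
Proof.
rewrite /kil (trace_frame (lin_vec_comp (@bil_linr _ _ c (e b)) (@bil_linr _ _ c (e a)))).
by apply: eq_bigr => f _; rewrite frame_bil_r.
Qed.

End Frame.

Definition contract2 ga (F : 'I_n -> 'I_n -> R) := \sum_i \sum_p ga i p * F i p.

(** One matrix per slot, so that the product rule produces the same expression with one slot
    replaced by a derivative. *)
Definition bracket_norm (ga1 ga2 g : 'M[R]_n) :=
  contract2 ga1 (fun i p => contract2 ga2 (fun j q =>
    contract2 g (fun k l => c i j k * c p q l))).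

Definition form3_dot (ga1 ga2 ga3 : 'M[R]_n) H H' :=
  contract2 ga1 (fun i p => contract2 ga2 (fun j q =>
    contract2 ga3 (fun k l => H i j k * H' p q l))).

(* The scalar curvature minus |H|^2 / 12; see [gen_scal_frame]. *)
Definition gen_scal g ga H :=
  - 4^-1 * bracket_norm ga ga g - 2^-1 * contract2 ga (killing c)
  - contract2 ga (theta2 c) - 12^-1 * form3_dot ga ga ga H H.

(** The product rule applied to [gen_scal], with h, dga and dH in place of the derivatives of g, ga
    and H. It is kept algebraic so that it can be evaluated in a frame; [dv_gen_scal] identifies it
    as a derivative. *)
Definition gen_scal_diff g ga H h dga dH :=
  - 4^-1 * (bracket_norm dga ga g + bracket_norm ga dga g + bracket_norm ga ga h)
  - 2^-1 * contract2 dga (killing c) - contract2 dga (theta2 c)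
  - 12^-1 * (form3_dot dga ga ga H H + form3_dot ga dga ga H H
             + form3_dot ga ga dga H H + form3_dot ga ga ga dH H
             + form3_dot ga ga ga H dH).

(** * Phi and its variation in an orthonormal frame *)

Section FrameNorm.
Variables (g ga : 'M[R]_n) (m : nat) (P : 'M[R]_(m, n)).
Hypothesis onP : orthonormal g ga P.
Let e a := row a P.
Let Q := g *m P^T.
Let fc := frame_bracket g P.

Lemma contract2_frame (N : 'M[R]_m) F : bilin F ->
  contract2 (P^T *m N *m P) (fun i p => F (delta_mx 0 i) (delta_mx 0 p)) =
  \sum_a \sum_b N a b * F (e a) (e b).
Proof. exact: contract_frame. Qed.

Lemma eq_contract2 (M : 'M[R]_n) F F' : (forall i j, F i j = F' i j) ->
  contract2 M F = contract2 M F'.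
Proof. by move=> FF; apply: eq_sum2 => i j; rewrite FF. Qed.

Lemma bilin_contract2 (M : 'M[R]_n) (F : 'I_n -> 'I_n -> 'rV[R]_n -> 'rV[R]_n -> R) :
  (forall i j, bilin (F i j)) -> bilin (fun x y => contract2 M (fun i j => F i j x y)).
Proof. exact: bilin_sum2. Qed.

Lemma bracket_norm_frame (N1 N2 N3 : 'M[R]_m) :
  bracket_norm (P^T *m N1 *m P) (P^T *m N2 *m P) (Q *m N3 *m Q^T) =
  \sum_a \sum_a' N1 a a' * \sum_b \sum_b' N2 b b' *
    \sum_d \sum_d' N3 d d' * (fc a b d * fc a' b' d').
Proof.
set M := Q *m N3 *m Q^T.
pose F2 x x' y y' := mform M (bil c x y) (bil c x' y').
pose F1 x x' := contract2 (P^T *m N2 *m P) (fun j q =>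
  F2 x x' (delta_mx 0 j) (delta_mx 0 q)).
have bF2 x x' : bilin (F2 x x').
  split => [y|y].
    exact: (lin_comp ((mform_bilin M).1 _) (@bil_linr _ _ c x)).
  exact: (lin_comp ((mform_bilin M).2 _) (@bil_linr _ _ c x')).
have bF1 : bilin F1.
  apply: bilin_contract2 => j q; split => [y|y].
    exact: (lin_comp ((mform_bilin M).1 _) (@bil_linl _ _ c _)).
  exact: (lin_comp ((mform_bilin M).2 _) (@bil_linl _ _ c _)).
transitivity (contract2 (P^T *m N1 *m P) (fun i p => F1 (delta_mx 0 i) (delta_mx 0 p))).
  apply: eq_contract2 => i p; apply: eq_contract2 => j q.
  by apply: eq_sum2 => k l; rewrite !bil_delta.
rewrite (contract2_frame _ bF1); apply: eq_sum2 => a a'; congr (_ * _).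
rewrite /F1 (contract2_frame _ (bF2 _ _)); apply: eq_sum2 => b b'; congr (_ * _).
by rewrite /F2 mform_mul.
Qed.

Lemma form3_dot_frame H H' (N1 N2 N3 : 'M[R]_m) :
  form3_dot (P^T *m N1 *m P) (P^T *m N2 *m P) (P^T *m N3 *m P) H H' =
  \sum_a \sum_a' N1 a a' * \sum_b \sum_b' N2 b b' *
    \sum_d \sum_d' N3 d d' * (frame_form3 P H a b d * frame_form3 P H' a' b' d').
Proof.
pose F3 x x' y y' z z' := tri H x y z * tri H' x' y' z'.
pose F2 x x' y y' := contract2 (P^T *m N3 *m P) (fun k l =>
  F3 x x' y y' (delta_mx 0 k) (delta_mx 0 l)).
pose F1 x x' := contract2 (P^T *m N2 *m P) (fun j q =>
  F2 x x' (delta_mx 0 j) (delta_mx 0 q)).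
have bF1 : bilin F1.
  do 2![apply: bilin_contract2 => ? ?].
  by apply: bilin_mul; exact: tri_lin1.
have bF2 x x' : bilin (F2 x x').
  apply: bilin_contract2 => ? ?.
  by apply: bilin_mul; exact: tri_lin2.
have bF3 x x' y y' : bilin (F3 x x' y y').
  by apply: bilin_mul; exact: tri_lin3.
transitivity (contract2 (P^T *m N1 *m P) (fun i p => F1 (delta_mx 0 i) (delta_mx 0 p))).
  apply: eq_contract2 => i p; apply: eq_contract2 => j q.
  by apply: eq_sum2 => k l; rewrite /F3 !tri_delta.
rewrite (contract2_frame _ bF1); apply: eq_sum2 => a a'; congr (_ * _).
rewrite /F1 (contract2_frame _ (bF2 _ _)); apply: eq_sum2 => b b'; congr (_ * _).
by rewrite /F2 (contract2_frame _ (bF3 _ _ _ _)).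
Qed.

Lemma killing_frame (N : 'M[R]_m) :
  contract2 (P^T *m N *m P) (killing c) = \sum_a \sum_b N a b * killing fc a b.
Proof.
rewrite (eq_contract2 _ (F' := fun i j => \sum_k bil c (delta_mx 0 j)
  (bil c (delta_mx 0 i) (delta_mx 0 k)) 0 k)); last first.
  by move=> i j; rewrite -kil_delta.
rewrite (contract2_frame _ bilin_kil); apply: eq_sum2 => a b; congr (_ * _).
exact: (kil_frame onP).
Qed.

Lemma theta2_frame (N : 'M[R]_m) :
  contract2 (P^T *m N *m P) (theta2 c) = \sum_a \sum_b N a b * theta2 fc a b.
Proof.
pose th (x : 'rV[R]_n) := \sum_i x 0 i * theta c i.
have lth : lin th.
  move=> p s v; rewrite /th; under [RHS]eq_bigr do rewrite mulr_sumr.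
  rewrite exchange_big; apply: eq_bigr => j _.
  by rewrite summxE mulr_suml; apply: eq_bigr => q _; rewrite mxE mulrA.
rewrite (eq_contract2 _ (F' := fun i j => th (delta_mx 0 i) * th (delta_mx 0 j))); last first.
  by move=> i j; rewrite /th !sum_delta.
rewrite (contract2_frame _ (bilin_mul lth lth)); apply: eq_sum2 => a b.
rewrite /theta2 !(frame_theta onP); congr (_ * (_ * _));
by apply: eq_bigr => i _; rewrite mxE.
Qed.

Lemma sum_delta2 (F : 'I_m -> 'I_m -> R) :
  \sum_a \sum_b (1%:M : 'M[R]_m) a b * F a b = \sum_a F a a.
Proof.
apply: eq_bigr => a _; rewrite (bigD1 a) //= big1 ?addr0 => [|b /negPf ba].
  by rewrite mxE eqxx mul1r.
by rewrite mxE eq_sym ba mul0r.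
Qed.

Lemma frame_gaE : ga = P^T *m 1%:M *m P.
Proof. by rewrite mulmx1 (on_inv onP). Qed.

Lemma frame_gE : g = Q *m 1%:M *m Q^T.
Proof.
rewrite mulmx1 /Q trmx_mul trmxK (on_sym onP) -mulmxA [P^T *m _]mulmxA -(on_inv onP).
by rewrite (mulmx1C (on_invr onP)) mulmx1.
Qed.

Lemma frame_formE h : h = Q *m (P *m h *m P^T) *m Q^T.
Proof.
have PQ : P^T *m Q^T = 1%:M by rewrite -trmx_mul (frame_QP onP) trmx1.
by rewrite !mulmxA (frame_QP onP) mul1mx -mulmxA PQ mulmx1.
Qed.

Lemma frame_dgaE h : - (ga *m h *m ga) = P^T *m - (P *m h *m P^T) *m P.
Proof. by rewrite (on_inv onP) mulmxN mulNmx !mulmxA. Qed.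

Lemma frame_form2E h a b : (P *m h *m P^T) a b = frame_form2 P h a b.
Proof.
rewrite /frame_form2 mformE -[LHS](_ : (row a (P *m h *m P^T)) 0 b = _); last by rewrite mxE.
rewrite !row_mul [LHS]mxE [RHS]mxE; apply: eq_bigr => k _.
by rewrite !mxE.
Qed.

Lemma gen_scal_frame H :
  gen_scal g ga H = - 4^-1 * (\sum_a \sum_b \sum_d fc a b d ^+ 2)
   - 2^-1 * (\sum_a killing fc a a) - \sum_a theta fc a ^+ 2
   - 12^-1 * (\sum_a \sum_b \sum_d frame_form3 P H a b d ^+ 2).
Proof.
rewrite /gen_scal frame_gaE [X in bracket_norm _ _ X]frame_gE bracket_norm_frame killing_frame.
rewrite theta2_frame form3_dot_frame !sum_delta2.
congr (_ * _ - _ - _ - _ * _).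
by apply: eq_bigr => a _; rewrite sum_delta2; apply: eq_bigr => b _; rewrite sum_delta2.
by apply: eq_bigr => a _; rewrite sum_delta2; apply: eq_bigr => b _; rewrite sum_delta2.
Qed.

Hypothesis calt : alternating2 c.
Hypothesis cjac : jacobi c.

Let K h a b := (P *m h *m P^T) a b.

Lemma sumN_delta2 h (F : 'I_m -> 'I_m -> R) :
  \sum_a \sum_b (- (P *m h *m P^T)) a b * F a b = - pairing (K h) F.
Proof.
by rewrite -[RHS]mulN1r sum2Z; apply: eq_sum2 => a b; rewrite mxE mulNr mulN1r.
Qed.

(** The origin of [moment]. The two lower slots of the bracket contribute the same term X1, by
    antisymmetry, and the upper slot contributes X2 with the opposite sign, as the metric enters
    there instead of its inverse. *)
Lemma bracket_norm_diff h :
  let dga := - (ga *m h *m ga) in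
  - 4^-1 * (bracket_norm dga ga g + bracket_norm ga dga g + bracket_norm ga ga h)
  = - pairing (K h) (moment fc).
Proof.
pose X1 a a' := \sum_b \sum_d fc a b d * fc a' b d.
pose X2 d d' := \sum_a \sum_b fc a b d * fc a b d'.
move=> dga.
have fcalt : alternating2 fc by apply: frame_alternating2.
have E1 : bracket_norm dga ga g = - pairing (K h) X1.
  rewrite /dga frame_dgaE [X in bracket_norm _ X _]frame_gaE [X in bracket_norm _ _ X]frame_gE.
  rewrite bracket_norm_frame -sumN_delta2; apply: eq_sum2 => a a'; congr (_ * _).
  by rewrite sum_delta2; apply: eq_bigr => b _; rewrite sum_delta2.
have E2 : bracket_norm ga dga g = - pairing (K h) X1.
  rewrite /dga frame_dgaE [X in bracket_norm X]frame_gaE [X in bracket_norm _ _ X]frame_gE.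
  rewrite bracket_norm_frame sum_delta2 -sumN_delta2.
  rewrite (eq_bigr (fun a => \sum_b \sum_b' (- (P *m h *m P^T)) b b' *
      \sum_d fc b a d * fc b' a d)); last first.
    move=> a _; apply: eq_sum2 => b b'; congr (_ * _); rewrite sum_delta2.
    by apply: eq_bigr => d _; rewrite (fcalt b a) (fcalt b' a) mulrNN.
  rewrite exchange_big; apply: eq_bigr => b _.
  by rewrite exchange_big; apply: eq_bigr => b' _; rewrite mulr_sumr.
have E3 : bracket_norm ga ga h = pairing (K h) X2.
  rewrite frame_gaE {1}(frame_formE h) bracket_norm_frame sum_delta2.
  under eq_bigr do rewrite sum_delta2.
  rewrite sum4_rot; apply: eq_sum2 => d d'.
  by rewrite /X2 sum2Z.
transitivity (- 4^-1 * (- 1 * pairing (K h) X1 + - 1 * pairing (K h) X1 + pairing (K h) X2)).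
  by rewrite E1 E2 E3; ring.
rewrite -[RHS]mulN1r /pairing !sum2Z !sum2D sum2Z; apply: eq_sum2 => a b.
by rewrite /moment -/(X1 a b) -/(X2 a b); field.
Qed.

Lemma form3_dot_diff H h : alternating3 H ->
  let dga := - (ga *m h *m ga) in
  form3_dot dga ga ga H H + form3_dot ga dga ga H H + form3_dot ga ga dga H H =
  - 3 * pairing (K h) (Hsq_frame (frame_form3 P H)).
Proof.
move=> Ha dga; set fH := frame_form3 P H.
have fHa : alternating3 fH by apply: frame_alternating3.
have E1 : form3_dot dga ga ga H H = - pairing (K h) (Hsq_frame fH).
  rewrite /dga frame_dgaE frame_gaE form3_dot_frame -sumN_delta2.
  apply: eq_sum2 => a a'; congr (_ * _).
  by rewrite sum_delta2; apply: eq_bigr => b _; rewrite sum_delta2.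
have E2 : form3_dot ga dga ga H H = - pairing (K h) (Hsq_frame fH).
  rewrite /dga frame_dgaE frame_gaE form3_dot_frame sum_delta2 -sumN_delta2.
  rewrite (eq_bigr (fun a => \sum_b \sum_b' (- (P *m h *m P^T)) b b' *
      \sum_d fH b a d * fH b' a d)); last first.
    move=> a _; apply: eq_sum2 => b b'; congr (_ * _); rewrite sum_delta2.
    by apply: eq_bigr => d _; rewrite (fHa b a d).1 (fHa b' a d).1 mulrNN.
  rewrite exchange_big; apply: eq_bigr => b _.
  by rewrite exchange_big; apply: eq_bigr => b' _; rewrite mulr_sumr.
have E3 : form3_dot ga ga dga H H = - pairing (K h) (Hsq_frame fH).
  rewrite /dga frame_dgaE frame_gaE form3_dot_frame sum_delta2 -sumN_delta2.
  under eq_bigr do rewrite sum_delta2.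
  rewrite sum4_rot; apply: eq_sum2 => d d'.
  rewrite /Hsq_frame sum2Z; apply: eq_sum2 => a b; congr (_ * _).
  by rewrite (fHa d a b).1 (fHa d' a b).1 (fHa a d b).2 (fHa a d' b).2 !mulrNN.
by rewrite E1 E2 E3; ring.
Qed.

Lemma form3_dot_frame1 H H' : form3_dot ga ga ga H H' =
  \sum_a \sum_b \sum_d frame_form3 P H a b d * frame_form3 P H' a b d.
Proof.
rewrite frame_gaE form3_dot_frame sum_delta2; apply: eq_bigr => a _.
by rewrite sum_delta2; apply: eq_bigr => b _; rewrite sum_delta2.
Qed.

Lemma gen_scal_diff_frame H h dH : alternating3 H ->
  gen_scal_diff g ga H h (- (ga *m h *m ga)) dH =
  pairing (fun i j => - moment fc i j + 2^-1 * killing fc i j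
                      + 4^-1 * Hsq_frame (frame_form3 P H) i j) (K h)
  + pairing (K h) (theta2 fc)
  - 6^-1 * (\sum_a \sum_b \sum_d frame_form3 P H a b d * frame_form3 P dH a b d).
Proof.
move=> Ha; rewrite /gen_scal_diff bracket_norm_diff form3_dot_diff // !form3_dot_frame1.
rewrite frame_dgaE killing_frame theta2_frame !sumN_delta2.
have -> : pairing (fun i j => - moment fc i j + 2^-1 * killing fc i j
    + 4^-1 * Hsq_frame (frame_form3 P H) i j) (K h) =
    - 1 * pairing (K h) (moment fc) + 2^-1 * pairing (K h) (killing fc)
    + 4^-1 * pairing (K h) (Hsq_frame (frame_form3 P H)).
  by rewrite /pairing !sum2Z !sum2D; apply: eq_sum2 => i j; ring.
rewrite [X in - 3 * _ + X + _](_ : _ =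
  \sum_a \sum_b \sum_d frame_form3 P H a b d * frame_form3 P dH a b d).
  by field.
by apply: eq_sum2 => a b; apply: eq_bigr => d _; rewrite mulrC.
Qed.

End FrameNorm.
End ConstantCoefficients.

(** * Monotonicity of the generalised scalar curvature *)

Section CauchySchwarz.
Context (R : realFieldType) (I : finType).

Lemma pairing_ge0 (K : I -> I -> R) : 0 <= pairing K K.
Proof. by do 2![apply: sumr_ge0 => ? _]; rewrite -expr2 sqr_ge0. Qed.

(** Cauchy-Schwarz combined with |K| <= (1 + |K|^2) / 2 and the inequality of means, without square
    roots: expand the sum of the squares of K_ab w - u_a v_b, where w is the mean of |u|^2 and
    |v|^2. *)
Lemma quadratic_bound (K : I -> I -> R) (u v : I -> R) :
  `|\sum_a \sum_b K a b * (u a * v b)| <=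
  2^-1 * (1 + pairing K K) * (2^-1 * (\sum_a u a ^+ 2 + \sum_a v a ^+ 2)).
Proof.
set U := \sum_a u a ^+ 2; set V := \sum_a v a ^+ 2; set w := 2^-1 * (U + V).
have U0 : 0 <= U by apply: sumr_ge0 => a _; rewrite sqr_ge0.
have V0 : 0 <= V by apply: sumr_ge0 => a _; rewrite sqr_ge0.
have w0 : 0 <= w by rewrite mulr_ge0 ?invr_ge0 ?ler0n ?addr_ge0.
have UV : U * V <= w ^+ 2.
  have -> : w ^+ 2 = U * V + (2^-1 * (U - V)) ^+ 2 by rewrite /w; field.
  by rewrite lerDl sqr_ge0.
suff B (L : I -> I -> R) : \sum_a \sum_b L a b * (u a * v b) <=
    2^-1 * (1 + pairing L L) * w.
  rewrite ler_norml B andbT lerNl.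
  have -> : - (\sum_a \sum_b K a b * (u a * v b)) =
      \sum_a \sum_b - K a b * (u a * v b).
    by rewrite -mulN1r sum2Z; apply: eq_sum2 => a b; ring.
  apply: le_trans (B _) _.
  by rewrite (_ : pairing _ _ = pairing K K) //; apply: eq_sum2 => a b; rewrite mulrNN.
have [w_gt0|w_le0] := ltP 0 w; last first.
  have Uz : U = 0 by move: w_le0; rewrite /w; lra.
  have uz a : u a = 0.
    apply/eqP; rewrite -sqrf_eq0; move/eqP: Uz; rewrite psumr_eq0; last first.
      by move=> b _; rewrite sqr_ge0.
    by move=> /allP/(_ a); rewrite mem_index_enum => /(_ isT) /implyP; apply.
  rewrite big1; last by move=> a _; rewrite big1 // => b _; rewrite uz; ring.
  by rewrite !mulr_ge0 ?invr_ge0 ?ler0n // addr_ge0 ?pairing_ge0.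
set x := \sum_a _.
have : 0 <= \sum_a \sum_b (L a b * w - u a * v b) ^+ 2.
  by do 2![apply: sumr_ge0 => ? _]; rewrite sqr_ge0.
have -> : \sum_a \sum_b (L a b * w - u a * v b) ^+ 2 =
    w ^+ 2 * pairing L L + (- 2 * w) * x + U * V.
  rewrite /U /V big_distrlr /= /pairing /x !sum2Z !sum2D.
  by apply: eq_sum2 => a b; ring.
move=> X; rewrite -(ler_pM2l w_gt0).
have : 2 * (w * x) <= w ^+ 2 * pairing L L + w ^+ 2.
  by move: X UV; set WL := w ^+ 2 * _; lra.
have -> : w * (2^-1 * (1 + pairing L L) * w) =
  2^-1 * (w ^+ 2 * pairing L L + w ^+ 2) by field.
by lra.
Qed.

End CauchySchwarz.

Section FlowDirection.
Context (R : realFieldType) (n : nat) (c : 'I_n -> 'I_n -> 'I_n -> R).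
Implicit Types (g ga : 'M[R]_n) (H : 'I_n -> 'I_n -> 'I_n -> R).

Definition rhs_g g ga H i j :=
  - 2 * ric_const c g ga i j + 2^-1 * Hsq_const ga H i j.
Definition rhs_b g ga H i j := - cod_const c g ga H i j.

Definition gen_scal_flow g ga H :=
  let h := \matrix_(i, j) rhs_g g ga H i j in
  gen_scal_diff c g ga H h (- (ga *m h *m ga)) (ext2_const c (rhs_b g ga H)).

Hypothesis calt : alternating2 c.
Hypothesis cjac : jacobi c.

Section Frame.
Variables (g ga : 'M[R]_n) (m : nat) (P : 'M[R]_(m, n)).
Hypothesis onP : orthonormal g ga P.
Let e a := row a P.
Let fc := frame_bracket c g P.

Lemma mform_frame (M : 'M[R]_n) u v : mform M u v =
  \sum_a \sum_b mform M (e a) (e b) * ((u *m (g *m P^T)) 0 a * (v *m (g *m P^T)) 0 b).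
Proof.
rewrite {1}(frame_formE onP M) mform_mul; apply: eq_sum2 => a b.
by rewrite frame_form2E.
Qed.

Lemma mform_gram u :
  mform g u u = \sum_a (u *m (g *m P^T)) 0 a ^+ 2.
Proof.
rewrite {1}(frame_gE onP) mform_mul /mform.
by rewrite (sum_delta2 (fun a b => (u *m (g *m P^T)) 0 a * (u *m (g *m P^T)) 0 b)).
Qed.

Lemma mform_gram_ge0 u : 0 <= mform g u u.
Proof. by rewrite mform_gram sumr_ge0 // => a _; rewrite sqr_ge0. Qed.

Lemma ric_const_sym i j : ric_const c g ga i j = ric_const c g ga j i.
Proof.
pose M := \matrix_(j, k) ric_const c g ga j k.
have E k l : ric_const c g ga k l = mform M (delta_mx 0 k) (delta_mx 0 l).
  by rewrite mform_delta mxE.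
rewrite !E !mform_frame exchange_big; apply: eq_sum2 => a b.
rewrite !(frame_ric c onP) ric_frame_sym; first by rewrite [X in _ * X]mulrC.
- exact: (frame_alternating2 _ _ calt).
- exact: (frame_jacobi onP cjac).
Qed.

Lemma Hsq_const_sym H i j : Hsq_const ga H i j = Hsq_const ga H j i.
Proof.
rewrite !(Hsq_const_frame onP); apply: eq_sum2 => a b; exact: mulrC.
Qed.

Lemma rhs_g_sym H i j : rhs_g g ga H i j = rhs_g g ga H j i.
Proof. by rewrite /rhs_g ric_const_sym Hsq_const_sym. Qed.

Lemma rhs_b_anti H i j : alternating3 H -> rhs_b g ga H i j = - rhs_b g ga H j i.
Proof.
move=> Ha; rewrite /rhs_b /cod_const !opprK -[RHS]mulN1r sum2Z; apply: eq_sum2 => k l.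
rewrite !mulrN mulN1r opprK -mulrN; congr (_ * _).
rewrite -sumrN; apply: eq_bigr => r _.
rewrite (Ha r j i).2 (Ha l r i).2 (Ha l j r).2; ring.
Qed.

Lemma gen_scal_flow_frame H : alternating3 H -> closed3_const c H ->
  gen_scal_flow g ga H =
  2^-1 * (pairing (fun a b => mform (\matrix_(i, j) rhs_g g ga H i j) (e a) (e b))
                  (fun a b => mform (\matrix_(i, j) rhs_g g ga H i j) (e a) (e b))
        + pairing (fun a b => mform (\matrix_(i, j) rhs_b g ga H i j) (e a) (e b))
                  (fun a b => mform (\matrix_(i, j) rhs_b g ga H i j) (e a) (e b))).
Proof.
move=> Ha Hc; set h := \matrix_(i, j) rhs_g g ga H i j.
set be := \matrix_(i, j) rhs_b g ga H i j.
set fH := frame_form3 P H.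
have Kh a b : mform h (e a) (e b) = flow_g fc fH a b.
  rewrite /flow_g -(frame_ric c onP) -(frame_Hsq onP) /mform !sum2Z sum2D.
  by apply: eq_sum2 => i j; rewrite !mxE /rhs_g; ring.
have Kb a b : mform be (e a) (e b) = flow_b fc fH a b.
  rewrite /flow_b -(frame_cod c onP) /mform -[RHS]mulN1r sum2Z.
  by apply: eq_sum2 => i j; rewrite !mxE /rhs_b; ring.
rewrite /gen_scal_flow (gen_scal_diff_frame onP calt) // -/fH -/fc.
have L := lyapunov_frame (frame_alternating2 _ _ calt) (frame_jacobi onP cjac)
  (frame_alternating3 P Ha) (frame_closed3 onP Hc).
have eqp (X X' Y Y' : 'I_m -> 'I_m -> R) : (forall a b, X a b = X' a b) ->
    (forall a b, Y a b = Y' a b) -> pairing X Y = pairing X' Y'.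
  by move=> XX YY; apply: eq_sum2 => a b; rewrite XX YY.
rewrite [in RHS](eqp _ _ _ _ Kh Kh) [in RHS](eqp _ _ _ _ Kb Kb) -L.
have Kh' a b : (P *m h *m P^T) a b = flow_g fc fH a b.
  by rewrite frame_form2E; exact: Kh.
congr (_ + _ - _ * _).
- by apply: eqp.
- by apply: eqp.
apply: eq_sum2 => a b; apply: eq_bigr => d _; congr (_ * _).
transitivity (frame_form3 P (ext2_const c (fun i j => be i j)) a b d).
  apply: eq_tri => i j k; rewrite /ext2_const.
  by congr (- _ + _ - _); apply: eq_bigr => l _; rewrite mxE.
rewrite (frame_ext2 c onP) /ext2_const.
by congr (- _ + _ - _); apply: eq_bigr => l _; rewrite -Kb.
Qed.

(** The frame components K of the right-hand side satisfy |K|^2 / 2 <= Phi', since the part of Phi'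
    due to b is nonnegative; 1/2 is the constant term of [quadratic_bound]. *)
Lemma rhs_g_bound H v : alternating3 H -> closed3_const c H ->
  `|mform (\matrix_(i, j) rhs_g g ga H i j) v v| <=
  (2^-1 + gen_scal_flow g ga H) * mform g v v.
Proof.
move=> Ha Hc; rewrite gen_scal_flow_frame // mform_frame.
apply: le_trans (quadratic_bound _ _ _) _; rewrite -!mform_gram.
rewrite [2^-1 * (mform g v v + _)](_ : _ = mform g v v); last by field.
rewrite ler_wpM2r ?mform_gram_ge0 //.
set X := pairing _ _; set Y := pairing _ _.
have X0 : 0 <= X by exact: pairing_ge0.
have Y0 : 0 <= Y by exact: pairing_ge0.
by lra.
Qed.

Lemma rhs_b_bound H u v : alternating3 H -> closed3_const c H ->
  `|mform (\matrix_(i, j) rhs_b g ga H i j) u v| <=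
  (2^-1 + gen_scal_flow g ga H) * (2^-1 * (mform g u u + mform g v v)).
Proof.
move=> Ha Hc; rewrite gen_scal_flow_frame // mform_frame.
apply: le_trans (quadratic_bound _ _ _) _; rewrite -!mform_gram.
rewrite ler_wpM2r ?mulr_ge0 ?invr_ge0 ?ler0n ?addr_ge0 ?mform_gram_ge0 //.
set X := pairing _ _; set Y := pairing _ _.
have X0 : 0 <= X by exact: pairing_ge0.
have Y0 : 0 <= Y by exact: pairing_ge0.
by lra.
Qed.

Lemma gen_scal_flow_ge0 H : alternating3 H -> closed3_const c H ->
  0 <= gen_scal_flow g ga H.
Proof.
move=> Ha Hc; rewrite gen_scal_flow_frame //.
by rewrite mulr_ge0 ?invr_ge0 ?ler0n // addr_ge0 ?pairing_ge0.
Qed.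

Lemma gen_scal_le0 H (lev : 'I_m -> nat) :
  (forall i j k, fc i j k != 0 -> [/\ (lev i <= lev k)%N, (lev j <= lev k)%N
     & lev i = lev j -> (lev i < lev k)%N]) ->
  gen_scal c g ga H <= 0.
Proof.
move=> clev; have := killing_trace_ge (frame_alternating2 _ _ calt) clev.
rewrite (gen_scal_frame c onP) -/fc.
set X := \sum_a \sum_b _; set Y := \sum_a killing _ _ _.
have : 0 <= \sum_a theta fc a ^+ 2 by apply: sumr_ge0 => a _; rewrite sqr_ge0.
have : 0 <= \sum_a \sum_b \sum_d frame_form3 P H a b d ^+ 2.
  by do 3![apply: sumr_ge0 => ? _]; rewrite sqr_ge0.
by lra.
Qed.

End Frame.
End FlowDirection.

(** * Orthonormal frames adapted to the derived series *)

Section AdaptedFrame.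
Context (R : rcfType) (n : nat).

Definition posdef (g : 'M[R]_n) :=
  g^T = g /\ forall v : 'rV[R]_n, v != 0 -> 0 < mform g v v.

(** The matrices A k stand for their row spaces. Each row of P lies in the step given by its level
    and is orthogonal to the next step. *)
Definition adapted (g : 'M[R]_n) (A : nat -> 'M[R]_n) m (P : 'M[R]_(m, n))
    (lev : 'I_m -> nat) :=
  P *m g *m P^T = 1%:M /\ forall a, (row a P <= A (lev a))%MS /\
    row a P *m g *m (A (lev a).+1)^T = 0.

Variables (g : 'M[R]_n) (A : nat -> 'M[R]_n).
Hypothesis pg : posdef g.
Hypothesis Adecr : forall k, (A k.+1 <= A k)%MS.

(** A Gram-Schmidt step. The new row is orthogonal to all of P, hence to [A k.+1], and so receives
    the level k. *)
Lemma adapted_add k m (P : 'M[R]_(m, n)) lev (v : 'rV[R]_n) :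
  adapted g A P lev -> (A k.+1 <= P)%MS -> (P <= A k)%MS -> (v <= A k)%MS ->
  ~~ (v <= P)%MS ->
  exists (P' : 'M[R]_(m + 1, n)) lev',
    [/\ adapted g A P' lev', (P <= P')%MS & (P' <= A k)%MS].
Proof.
move=> [PgP levP] AP PA vA vP; pose w : 'rV[R]_n := v - v *m g *m P^T *m P.
have w0 : w != 0.
  by apply: contra vP; rewrite subr_eq0 => /eqP ->; exact: submxMl.
have wA : (w <= A k)%MS.
  by rewrite addmx_sub // eqmx_opp (submx_trans (submxMl _ _)).
have wP : w *m g *m P^T = 0.
  by rewrite !mulmxBl -[in X in _ - X]mulmxA -(mulmxA _ P) (mulmxA P) PgP mulmx1 subrr.
have q0 := pg.2 _ w0; set q := mform g w w in q0.
pose s : R := (Num.sqrt q)^-1; pose w' : 'rV[R]_n := s *: w.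
have s2 : s * s * q = 1.
  by rewrite /s -invrM ?unitfE ?sqrtr_eq0 -?ltNge // -expr2 sqr_sqrtr ?ltW // mulVf ?gt_eqF.
have w'P : w' *m g *m P^T = 0 by rewrite -!scalemxAl wP scaler0.
have Pw' : P *m g *m w'^T = 0.
  by apply: trmx_inj; rewrite !trmx_mul trmxK pg.1 mulmxA w'P trmx0.
have w'w' : w' *m g *m w'^T = 1%:M.
  rewrite linearZ /= -!scalemxAl -scalemxAr scalerA.
  by apply/matrixP => i j; rewrite !ord1 mxE -mformE -/q s2 mxE.
exists (col_mx P w'), (fun i => if fintype.split i is inl a then lev a else k); split.
- split.
    rewrite mul_col_mx tr_col_mx mul_col_row PgP w'P Pw' w'w'.
    by rewrite (scalar_mx_block _ 1).
  move=> i; case: fintype.splitP => [a|a] ia.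
    have -> : i = lshift 1 a by exact: val_inj.
    by rewrite rowKu; exact: levP.
  have -> : i = rshift m a by exact: val_inj.
  rewrite rowKd; have -> : row a w' = w' by apply/rowP => j; rewrite mxE !ord1.
  split; first exact: scalemx_sub.
  by have [D ->] := submxP AP; rewrite trmx_mul mulmxA w'P mul0mx.
- by rewrite -addsmxE addsmxSl.
- by rewrite col_mx_sub PA scalemx_sub.
Qed.

Lemma adapted_rank m (P : 'M[R]_(m, n)) lev : adapted g A P lev -> (m <= n)%N.
Proof.
move=> [PgP _]; rewrite -{1}(mxrank1 R m) -PgP -mulmxA.
exact: leq_trans (mxrankM_maxl _ _) (rank_leq_col _).
Qed.

(** Induction on a bound d for the number of rows still missing; at d = 0 a further row would
    contradict [adapted_rank]. *)
Lemma adapted_complete k d m (P : 'M[R]_(m, n)) lev :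
  (n - m <= d)%N ->
  adapted g A P lev -> (A k.+1 <= P)%MS -> (P <= A k)%MS ->
  exists m' (P' : 'M[R]_(m', n)) lev',
    [/\ adapted g A P' lev', (A k <= P')%MS & (P' <= A k)%MS].
Proof.
elim: d m P lev => [|d IH] m P lev nm aP AP PA.
  have [AkP|/row_subPn[i vP]] := boolP (A k <= P)%MS; first by exists m, P, lev.
  have [P' [lev' [aP' _ _]]] := adapted_add aP AP PA (row_sub i _) vP.
  have := adapted_rank aP'; move: nm; rewrite leqn0 subn_eq0 addn1 => nm mn.
  by have := leq_ltn_trans nm mn; rewrite ltnn.
have [AkP|/row_subPn[i vP]] := boolP (A k <= P)%MS; first by exists m, P, lev.
have [P' [lev' [aP' PP' P'A]]] := adapted_add aP AP PA (row_sub i _) vP.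
apply: (IH _ P' lev') => //; last exact: submx_trans PP'.
by rewrite addn1 subnS; move: nm; case: (n - m)%N.
Qed.

(** The flag is filled from its smallest step, the zero space with the empty frame, up to the whole
    space. *)
Lemma adapted_exists k0 : A 0 = 1%:M -> A k0 = 0 ->
  exists m (P : 'M[R]_(m, n)) lev,
    orthonormal g (invmx g) P /\ adapted g A P lev.
Proof.
move=> A0 Ak0.
have key d : (d <= k0)%N -> exists m (P : 'M[R]_(m, n)) lev,
    [/\ adapted g A P lev, (A (k0 - d)%N <= P)%MS & (P <= A (k0 - d)%N)%MS].
  elim: d => [_|d IH dk].
    rewrite subn0; exists 0%N, (0 : 'M[R]_(0, n)), (fun=> 0%N); split.
    - by split=> [|[]//]; apply/matrixP => -[].
    - by rewrite Ak0 sub0mx.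
    - exact: sub0mx.
  have [m [P [lev [aP AP PA]]]] := IH (ltnW dk).
  have E : (k0 - d)%N = (k0 - d.+1).+1 by rewrite subnS prednK // subn_gt0.
  rewrite E in AP PA; apply: (adapted_complete (leqnn _) aP) => //.
  exact: submx_trans PA (Adecr _).
have [m [P [lev [aP AP _]]]] := key k0 (leqnn _).
exists m, P, lev; split => //.
(* The frame spans, so the identity factors through P; orthonormality forces the other factor to be
   g P^T, which exhibits P^T P as the inverse of g. *)
have [X XP] : exists X, 1%:M = X *m P by apply/submxP; rewrite -A0 -(subnn k0).
have XE : X = g *m P^T.
  by rewrite -[X]mulmx1 -aP.1 !mulmxA -XP mul1mx.
have gP : g *m (P^T *m P) = 1%:M by rewrite mulmxA -XE -XP.
have gu : g \in unitmx by have /mulmx1_unit[] := gP.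
have iE : invmx g = P^T *m P by rewrite -[LHS]mulmx1 -gP mulKmx.
by split=> //; [exact: aP.1 | exact: pg.1 | rewrite mulmxV].
Qed.

End AdaptedFrame.

(** * The derived series in coordinates *)

Section DerivedFlag.
Context (R : rcfType) (n : nat) (c : 'I_n -> 'I_n -> 'I_n -> R).
Hypothesis calt : alternating2 c.
Hypothesis cjac : jacobi c.

Definition derived_mx (A : 'M[R]_n) : 'M[R]_n :=
  (\sum_i \sum_j <<bil c (row i A) (row j A)>>)%MS.

Definition ideal_mx (A : 'M[R]_n) := forall x y : 'rV[R]_n,
  (x <= A)%MS -> (bil c x y <= A)%MS.

Lemma bil_derived (A : 'M[R]_n) x y :
  (x <= A)%MS -> (y <= A)%MS -> (bil c x y <= derived_mx A)%MS.
Proof.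
move=> /submxP[u ->] /submxP[v ->]; rewrite !mulmx_sum_row bil_suml.
apply: summx_sub => i _; apply: scalemx_sub; rewrite bil_sumr.
apply: summx_sub => j _; apply: scalemx_sub.
apply: (sumsmx_sup i) => //; apply: (sumsmx_sup j) => //.
by rewrite genmxE.
Qed.

Lemma derived_mx_sub (A : 'M[R]_n) : ideal_mx A -> (derived_mx A <= A)%MS.
Proof.
move=> iA; apply/sumsmx_subP => i _; apply/sumsmx_subP => j _.
by rewrite genmxE iA // row_sub.
Qed.

Lemma derived_mxP (A : 'M[R]_n) (v : 'rV[R]_n) : (v <= derived_mx A)%MS ->
  exists u : 'M[R]_n, v = \sum_i \sum_j u i j *: bil c (row i A) (row j A).
Proof.
move=> /sub_sumsmxP[u ->].
have E i : exists t : 'rV[R]_n, u i *m (\sum_j <<bil c (row i A) (row j A)>>)%MS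
     = \sum_j t 0 j *: bil c (row i A) (row j A).
  have : (u i *m (\sum_j <<bil c (row i A) (row j A)>>)%MS <=
     \sum_j <<bil c (row i A) (row j A)>>)%MS by exact: submxMl.
  move=> /sub_sumsmxP[w ->].
  have F j : exists t : R, w j *m <<bil c (row i A) (row j A)>>%MS
      = t *: bil c (row i A) (row j A).
    have : (w j *m <<bil c (row i A) (row j A)>>%MS <= bil c (row i A) (row j A))%MS.
      by rewrite (submx_trans (submxMl _ _)) // genmxE.
    by move=> /sub_rVP.
  have [t tE] := fin_all_exists F.
  by exists (\row_j t j); apply: eq_bigr => j _; rewrite mxE.
have [t tE] := fin_all_exists E.
exists (\matrix_i t i); apply: eq_bigr => i _; rewrite tE.
by apply: eq_bigr => j _; rewrite mxE.
Qed.

(** By the Jacobi identity, [[a, b], y] is a sum of brackets of a or b with brackets that stay in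
    the ideal A. *)
Lemma ideal_derived (A : 'M[R]_n) : ideal_mx A -> ideal_mx (derived_mx A).
Proof.
move=> iA x y /derived_mxP[u ->].
under eq_bigr => i _ do rewrite -[\sum_(j < n) _]scale1r.
rewrite bil_suml; apply: summx_sub => i _; apply: scalemx_sub; rewrite bil_suml; apply: summx_sub => j _; apply: scalemx_sub.
set a := row i A; set b := row j A.
have aA : (a <= A)%MS by exact: row_sub.
have bA : (b <= A)%MS by exact: row_sub.
have /eqP := bil_jacobi cjac a b y.
rewrite -addrA addr_eq0 => /eqP ->; rewrite eqmx_opp addmx_sub //.
  by apply: bil_derived => //; exact: iA.
apply: bil_derived => //; rewrite (bil_anti calt) eqmx_opp; exact: iA.
Qed.

Definition derived_flag k := iter k derived_mx 1%:M.

Lemma derived_flag_ideal k : ideal_mx (derived_flag k).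
Proof.
elim: k => [|k IH] /=; first by move=> x y _; exact: submx1.
exact: ideal_derived.
Qed.

Lemma derived_flag_decr k : (derived_flag k.+1 <= derived_flag k)%MS.
Proof. exact/derived_mx_sub/derived_flag_ideal. Qed.

Lemma derived_flag_mono k l : (k <= l)%N -> (derived_flag l <= derived_flag k)%MS.
Proof.
elim: l => [|l IH]; first by rewrite leqn0 => /eqP ->.
rewrite leq_eqVlt => /orP[/eqP -> //|/IH]; exact: submx_trans (derived_flag_decr l).
Qed.

(** If the bracket of rows a and b lies in step k but lev d < k, it lies in step lev d + 1, which is
    orthogonal to row d. This applies with k = lev a and k = lev b, as the steps are ideals, and
    with k = lev a + 1 if the levels agree, as the bracket then lies in the next derived step. *)
Lemma adapted_levels g m (P : 'M[R]_(m, n)) lev : g^T = g ->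
  adapted g derived_flag P lev ->
  forall a b d, frame_bracket c g P a b d != 0 ->
   [/\ (lev a <= lev d)%N, (lev b <= lev d)%N & lev a = lev b -> (lev a < lev d)%N].
Proof.
move=> gT [PgP levP] a b d nz; set v := bil c (row a P) (row b P).
have K k : (v <= derived_flag k)%MS -> (k <= lev d)%N.
  move=> vk; rewrite leqNgt; apply/negP => dk; case/eqP: nz.
  have /submxP[D DE] := submx_trans vk (derived_flag_mono dk).
  rewrite /frame_bracket -/v DE.
  have E := (levP d).2; have E' : (row d P *m g *m (derived_flag (lev d).+1)^T)^T = 0.
    by rewrite E trmx0.
  rewrite !trmx_mul trmxK gT mulmxA in E'.
  have -> : (D *m derived_flag (lev d).+1 *m (g *m P^T)) 0 d =
     (D *m (derived_flag (lev d).+1 *m g *m (row d P)^T)) 0 0.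
    rewrite !mulmxA mxE [RHS]mxE; apply: eq_bigr => j _; by rewrite !mxE.
  by rewrite -mulmxA in E' *; rewrite E' mulmx0 mxE.
split.
- by apply: K; apply: derived_flag_ideal; exact: (levP a).1.
- apply: K; rewrite /v (bil_anti calt) eqmx_opp.
  by apply: derived_flag_ideal; exact: (levP b).1.
- move=> ab; apply: (K (lev a).+1); apply: bil_derived; first exact: (levP a).1.
  by rewrite ab; exact: (levP b).1.
Qed.

Definition solvable_const := exists k, derived_flag k = 0.

Lemma solvable_frame g : solvable_const -> posdef g ->
  exists m (P : 'M[R]_(m, n)), orthonormal g (invmx g) P /\
    forall H, gen_scal c g (invmx g) H <= 0.
Proof.
move=> [k fk] pg.
have [m [P [lev [onP aP]]]] := adapted_exists pg derived_flag_decr erefl fk.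
exists m, P; split=> // H.
by apply: (gen_scal_le0 calt onP H); exact: (adapted_levels pg.1 aP).
Qed.

End DerivedFlag.

(** * Differentials of invariant 2-forms *)

Section ExteriorDerivative.
Context (R : realFieldType) (I : finType) (c : I -> I -> I -> R) (b : I -> I -> R).
Hypothesis calt : alternating2 c.
Hypothesis cjac : jacobi c.
Hypothesis banti : forall i j, b i j = - b j i.

Lemma ext2_alternating3 : alternating3 (ext2_const c b).
Proof.
have [a ca] := alternating2_ex calt.
move=> i j k; rewrite /ext2_const -!sumrN -!big_split /= -!sumrN.
by split; apply: eq_bigr => m _; rewrite !ca; ring.
Qed.

(* d (d b) = 0: the terms with one bracket inside another cancel by the Jacobi
   identity, the others by the antisymmetry of b. *)
Lemma ext2_closed3 : closed3_const c (ext2_const c b).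
Proof.
move=> i j k l; pose E m q r p := - (c m q p * b p r) + c m r p * b p q - c q r p * b p m.
have EE m q r : ext2_const c b m q r = \sum_p E m q r p.
  by rewrite /ext2_const -!sumrN -!big_split.
pose J i j k p m := c i j m * c m k p + c j k m * c m i p + c k i m * c m j p.
have JJ i' j' k' r : \sum_m \sum_p J i' j' k' p m * b p r = 0.
  rewrite exchange_big big1 // => p _; rewrite -mulr_suml.
  by rewrite [X in X * _](cjac i' j' k' p) mul0r.
transitivity (\sum_m \sum_p (- (c i j m * E m k l p) + c i k m * E m j l p
   - c i l m * E m j k p - c j k m * E m i l p + c j l m * E m i k p - c k l m * E m i j p)).
  rewrite -!sumrN -!big_split /=; apply: eq_bigr => m _.
  by rewrite !EE !mulr_sumr -!sumrN -!big_split.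
transitivity (\sum_m \sum_p (J i j k p m * b p l + - (J i j l p m * b p k)
   + J i k l p m * b p j + - (J j k l p m * b p i))); last first.
  rewrite -!sum2D JJ JJ add0r addr0.
  have N i' j' k' r : \sum_m \sum_p - (J i' j' k' p m * b p r) = 0.
    transitivity (- (\sum_m \sum_p J i' j' k' p m * b p r)); last by rewrite JJ oppr0.
    by rewrite -sumrN; apply: eq_bigr => m _; rewrite -sumrN.
  by rewrite !N addr0.
have [a ca] := alternating2_ex calt.
have [a' ba] : exists a', forall i j, b i j = a' i j - a' j i.
  by exists (fun i j => 2^-1 * b i j) => i' j'; rewrite (banti j' i'); field.
by apply: sum2_sym => m p; rewrite /J /E !ca !ba; ring.
Qed.

Lemma alternating3D (H H' : I -> I -> I -> R) : alternating3 H -> alternating3 H' ->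
  alternating3 (fun i j k => H i j k + H' i j k).
Proof.
move=> h h' i j k; have [h1 h2] := h i j k; have [h3 h4] := h' i j k.
by split; [rewrite h1 h3 opprD | rewrite h2 h4 opprD].
Qed.

Lemma closed3D (H H' : I -> I -> I -> R) : closed3_const c H -> closed3_const c H' ->
  closed3_const c (fun i j k => H i j k + H' i j k).
Proof.
move=> h h' i j k l; have e := congr2 +%R (h i j k l) (h' i j k l).
rewrite addr0 in e; rewrite -[RHS]e.
rewrite -!sumrN -!big_split /=; apply: eq_bigr => m _; ring.
Qed.

End ExteriorDerivative.

Section Torsion.
Context (R : realFieldType) (n : nat) (c : 'I_n -> 'I_n -> 'I_n -> R).
Variables (H0 : 'I_n -> 'I_n -> 'I_n -> R).

Definition torsion_const (b : 'I_n -> 'I_n -> R) i j k := H0 i j k + ext2_const c b i j k.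

End Torsion.

(** * Ordinary differential equations *)

Section RealDerivatives.
Context (R : realType).
Implicit Types (f g h : R -> R) (t : R).

Local Notation dv f t l := (is_derive (t : R) (1 : R) (f : R -> R) (l : R)).

Lemma dv_cst (a : R) t : dv (fun=> a) t 0.
Proof. exact: is_derive_cst. Qed.

Lemma dvD f g t a b : dv f t a -> dv g t b -> dv (fun s => f s + g s) t (a + b).
Proof. by move=> df dg; exact: is_deriveD. Qed.

Lemma dvN f t a : dv f t a -> dv (fun s => - f s) t (- a).
Proof. by move=> df; exact: is_deriveN. Qed.

Lemma dvB f g t a b : dv f t a -> dv g t b -> dv (fun s => f s - g s) t (a - b).
Proof. by move=> df dg; exact: is_deriveB. Qed.

Lemma dvM f g t a b : dv f t a -> dv g t b ->
  dv (fun s => f s * g s) t (a * g t + f t * b).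
Proof.
move=> df dg; apply: is_derive_eq (is_deriveM df dg) _.
by rewrite /GRing.scale /= addrC mulrC.
Qed.

Lemma dvZ (k : R) f t a : dv f t a -> dv (fun s => k * f s) t (k * a).
Proof. by move=> df; exact: is_deriveZ. Qed.

Lemma dv_sum (J : Type) (r : seq J) (P : pred J) (f : J -> R -> R) (a : J -> R) t :
  (forall j, dv (f j) t (a j)) ->
  dv (fun s => \sum_(j <- r | P j) f j s) t (\sum_(j <- r | P j) a j).
Proof.
move=> df; elim: r => [|j r IH].
  rewrite big_nil (_ : (fun _ => _) = fun=> 0); first exact: dv_cst.
  by apply: funext => s; rewrite big_nil.
rewrite big_cons (_ : (fun _ => _) = fun s =>
  if P j then f j s + \sum_(j <- r | P j) f j s else \sum_(j <- r | P j) f j s).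
  by case: (P j) => //; exact: dvD.
by apply: funext => s; rewrite big_cons.
Qed.

Lemma dv_exp (k t : R) : dv (fun s => expR (k * s)) t (k * expR (k * t)).
Proof.
have := @is_derive1_comp R expR (fun s => k * s) t _ _ (is_derive_expR _) (dvZ k (is_derive_id t 1)).
by rewrite mulr1 mulrC.
Qed.

Lemma dv_comp_exp f t a : dv f t a -> dv (fun s => expR (f s)) t (a * expR (f t)).
Proof.
move=> df; have := @is_derive1_comp R expR f t _ _ (is_derive_expR _) df.
by rewrite mulrC.
Qed.

Lemma dv_continuous f t a : dv f t a -> {for t, continuous f}.
Proof.
by move=> df; apply/differentiable_continuous/derivable1_diffP; exact: ex_derive.
Qed.

Lemma dv_le f g df dg a b : a <= b ->
  (forall t, a <= t <= b -> dv f t (df t)) ->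
  (forall t, a <= t <= b -> dv g t (dg t)) ->
  (forall t, a <= t <= b -> df t <= dg t) -> f b - f a <= g b - g a.
Proof.
rewrite le_eqVlt => /orP[/eqP ->|ab]; first by rewrite !subrr.
move=> hf hg hfg; pose k s := g s - f s.
have hk t : a <= t <= b -> dv k t (dg t - df t).
  by move=> tab; apply: dvB; [exact: hg|exact: hf].
have [||c] := @MVT R k (fun t => dg t - df t) a b ab.
- by move=> x /itvP xab; apply: hk; rewrite !xab.
- apply: derivable_within_continuous => x /itvP xab; apply: ex_derive.
  by apply: hk; rewrite !xab.
move=> /itvP cab kE; rewrite -subr_ge0 [X in 0 <= X](_ : _ = k b - k a); last by rewrite /k; ring.
rewrite kE mulr_ge0 // subr_ge0 ?(ltW ab) //.
by apply: hfg; rewrite !cab.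
Qed.

Lemma dv_abs_le f g df dg a b : a <= b ->
  (forall t, a <= t <= b -> dv f t (df t)) ->
  (forall t, a <= t <= b -> dv g t (dg t)) ->
  (forall t, a <= t <= b -> `|df t| <= dg t) -> `|f b - f a| <= g b - g a.
Proof.
move=> ab hf hg hfg; rewrite ler_norml; apply/andP; split; last first.
  apply: (dv_le ab hf hg) => t /hfg; exact: le_trans (ler_norm _).
rewrite lerNl [X in X <= _](_ : _ = - f b - - f a); last by ring.
apply: (dv_le ab (fun t ht => dvN (hf t ht)) hg) => t /hfg.
by rewrite -normrN; exact: le_trans (ler_norm _).
Qed.

(** The integrating factor exp(-C t) makes the product nonincreasing. *)
Lemma gronwall w dw (C b : R) : 0 <= b ->
  (forall t, 0 <= t <= b -> dv w t (dw t)) ->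
  (forall t, 0 <= t <= b -> dw t <= C * w t) -> w 0 <= 0 -> w b <= 0.
Proof.
move=> b0 hw hC w0.
have h t : 0 <= t <= b -> dv (fun s => expR (- C * s) * w s) t
    (- C * expR (- C * t) * w t + expR (- C * t) * dw t).
  by move=> tb; apply: dvM; [exact: dv_exp|exact: hw].
have := dv_le b0 h (fun t _ => dv_cst 0 t).
rewrite subrr subr_le0 mulr0 expR0 mul1r => H.
have : expR (- C * b) * w b <= 0.
  apply: le_trans (H _) w0 => t tb.
  rewrite [X in X <= _](_ : _ = expR (- C * t) * (dw t - C * w t)); last by ring.
  by rewrite mulr_ge0_le0 ?expR_ge0 // subr_le0 hC.
by rewrite pmulr_rle0 // expR_gt0.
Qed.

Lemma lipschitz_continuous f (K : R) :
  (forall x y, `|f x - f y| <= K * `|x - y|) -> continuous f.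
Proof.
move=> fK x; apply/cvgrPdist_le => e e0.
have K1 : 0 < `|K| + 1 by rewrite ltr_wpDl.
near=> y; apply: le_trans (fK x y) _.
have : `|x - y| <= e / (`|K| + 1).
  by near: y; apply: cvgr_dist_le; [exact: cvg_id|exact: divr_gt0].
rewrite ler_pdivlMr // => xy; apply: le_trans xy; rewrite mulrC ler_wpM2l //.
by rewrite (le_trans (ler_norm K)) // lerDl.
Unshelve. all: by end_near. Qed.

(** The primitive that vanishes at 0. The lower limit -1 keeps 0 in the interior of the domain of
    integration, so that the derivative there is two-sided. *)
Definition prim h (x : R) : R :=
  (\int[lebesgue_measure]_(t in `[-1, x]) h t - \int[lebesgue_measure]_(t in `[-1, 0]) h t)%R.

Lemma prim0 h : prim h 0 = 0.
Proof. by rewrite /prim subrr. Qed.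

Lemma prim_dv h t : continuous h -> -1 < t -> dv (prim h) t (h t).
Proof.
move=> ch t1.
have ih : lebesgue_measure.-integrable `[-1, t + 1] (EFin \o h).
  apply: continuous_compact_integrable; first exact: segment_compact.
  exact: continuous_subspaceT.
have [|d1 d2] := @continuous_FTC1_closed R h (-1) t (t + 1) _ ih t1 (ch t).
  by rewrite ltrDl.
have dF : dv (fun x => \int[lebesgue_measure]_(t in `[-1, x]) h t)%R t (h t).
  by apply: DeriveDef; [exact: d1|rewrite -derive1E; exact: d2].
by have := dvB dF (dv_cst (\int[lebesgue_measure]_(t in `[-1, 0]) h t)%R t); rewrite subr0.
Qed.

(** The intervals from lo k to hi k are nested and the limit is the supremum of their left ends; the
    radius 2 B / 2^k is the sum of the remaining steps. The explicit rate is what the Picard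
    iteration uses. *)
Lemma geometric_limit (a : nat -> R) (B : R) :
  (forall k, `|a k.+1 - a k| <= B * 2^-1 ^+ k) ->
  exists l, forall k, `|l - a k| <= 2 * B * 2^-1 ^+ k.
Proof.
move=> ha; pose lo k := a k - 2 * B * 2^-1 ^+ k; pose hi k := a k + 2 * B * 2^-1 ^+ k.
have B0 : 0 <= B by have := le_trans (normr_ge0 _) (ha 0%N); rewrite expr0 mulr1.
have p0 k : 0 <= B * 2^-1 ^+ k by rewrite mulr_ge0 // exprn_ge0 // invr_ge0 ler0n.
have loS k : lo k <= lo k.+1.
  have := ha k; rewrite /lo ler_norml exprS => /andP[+ _]; lra.
have hiS k : hi k.+1 <= hi k.
  have := ha k; rewrite /hi ler_norml exprS => /andP[_]; lra.
have lom j k : lo j <= lo (j + k)%N.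
  elim: k => [|k IH]; first by rewrite addn0.
  by rewrite addnS (le_trans IH).
have him j k : hi (j + k)%N <= hi j.
  elim: k => [|k IH]; first by rewrite addn0.
  by rewrite addnS (le_trans _ IH).
have lohi j k : lo j <= hi k.
  apply: (le_trans (lom j k)); rewrite addnC; apply: le_trans (him k j).
  by have := p0 (k + j)%N; rewrite /lo /hi; lra.
pose S : set R := [set lo k | k in setT].
have Sne : S !=set0 by exists (lo 0%N), 0%N.
have Sub k : ubound S (hi k) by move=> _ [j _ <-]; exact: lohi.
exists (sup S) => k; rewrite ler_norml; apply/andP; split.
  have : lo k <= sup S by apply: sup_upper_bound; [split => //; exists (hi 0%N)|exists k].
  by rewrite /lo; lra.
have : sup S <= hi k by exact: ge_sup.
by rewrite /hi; lra.
Qed.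

(* The field is only evaluated at nonnegative times, but solutions are defined
   slightly before 0 so that all derivatives are two-sided. *)
Section Picard.
Context (I : Type) (f : (I -> R) -> I -> R) (M L : R) (y0 : I -> R).
Hypothesis L0 : 0 < L.
Hypothesis fM : forall y i, `|f y i| <= M.
Hypothesis fL : forall y z (d : R), (forall i, `|y i - z i| <= d) ->
  forall i, `|f y i - f z i| <= L * d.

Local Notation pos t := (Num.max t (0 : R)).

Let T (v : R -> I -> R) (t : R) i := y0 i + prim (fun s => f (v (pos s)) i) t.
Let v k := iter k T (fun=> y0).

Let M0 (i : I) : 0 <= M. Proof. exact: le_trans (normr_ge0 _) (fM y0 i). Qed.

Let pos_lip s t : `|pos s - pos t| <= `|s - t|.
Proof.
have h1 := ler_norm (s - t); have h2 := ler_norm (t - s); rewrite distrC in h2.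
by rewrite ler_norml; case: (leP s 0) => ?; case: (leP t 0) => ?; lra.
Qed.

Let lip_dv u (w : R -> I -> R) :
  (forall t i, -1 < t -> dv (w^~ i) t (f (u t) i)) ->
  forall s t i, 0 <= s -> 0 <= t -> `|w s i - w t i| <= M * `|s - t|.
Proof.
move=> hw s t i s0 t0; wlog st : s t s0 t0 / s <= t => [H|].
  have [/H|/ltW/H] := leP s t; first exact.
  by rewrite distrC [X in _ <= _ * X]distrC; apply.
rewrite distrC [X in _ <= _ * X]distrC [`|t - s|]ger0_norm ?subr_ge0 // mulrBr.
have hw' x : s <= x <= t -> dv (w^~ i) x (f (u x) i).
  by case/andP=> sx _; apply: hw; rewrite (lt_le_trans _ sx) // (lt_le_trans _ s0) // ltrN10.
apply: (dv_abs_le st hw' (fun x _ => dvZ M (is_derive_id x 1))) => x _.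
by rewrite mulr1.
Qed.

Let lip_pos (w : R -> I -> R) :
  (forall s t i, 0 <= s -> 0 <= t -> `|w s i - w t i| <= M * `|s - t|) ->
  forall i, continuous (fun s => f (w (pos s)) i).
Proof.
move=> hw i; apply: (@lipschitz_continuous _ (L * M)) => s t.
rewrite -mulrA; apply: fL => j; apply: le_trans (hw _ _ _ _ _) _.
- by rewrite le_max lexx orbT.
- by rewrite le_max lexx orbT.
- by rewrite ler_wpM2l ?(M0 i).
Qed.

Let T_dv (w : R -> I -> R) t i :
  (forall s t i, 0 <= s -> 0 <= t -> `|w s i - w t i| <= M * `|s - t|) ->
  -1 < t -> dv (T w ^~ i) t (f (w (pos t)) i).
Proof.
move=> hw t1; have := dvD (dv_cst (y0 i) t) (prim_dv (@lip_pos _ hw i) t1).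
by rewrite add0r.
Qed.

Let v_lip k s t i : 0 <= s -> 0 <= t -> `|v k s i - v k t i| <= M * `|s - t|.
Proof.
elim: k s t i => [|k IH] s t i s0 t0; first by rewrite /v /= subrr normr0 mulr_ge0 ?(M0 i).
by apply: (lip_dv (u := fun s => v k (pos s))) => // x j x1; exact: T_dv.
Qed.

Let v_dv k t i : -1 < t -> dv (v k.+1 ^~ i) t (f (v k (pos t)) i).
Proof. by move=> t1; apply: T_dv => // s x j; exact: v_lip. Qed.

Let v0 k i : v k 0 i = y0 i.
Proof. by case: k => [|k] //; rewrite /v /= /T prim0 addr0. Qed.

Let B := M / (2 * L).
Let E t := expR (2 * L * t).

Let E_dv a t : dv (fun s => a * E s) t (a * (2 * L * E t)).
Proof. by apply: dvZ; exact: dv_exp. Qed.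

(* With the weight exp(2 L t) each Picard step halves the distance, so no
   smallness of the time interval is needed. *)
Let v_diff k t i : 0 <= t -> `|v k.+1 t i - v k t i| <= B * E t * 2^-1 ^+ k.
Proof.
have L2 : 2 * L != 0 by rewrite mulf_neq0 ?pnatr_eq0 // gt_eqF.
have pos_id x : 0 <= x -> pos x = x by move=> x0; apply/max_idPl.
elim: k t i => [|k IH] t i t0.
  rewrite expr0 mulr1 -[v 0 t i]/(y0 i) -(v0 1 i).
  apply: (@le_trans _ _ (B * E t - B * E 0)).
    apply: (dv_abs_le t0 (fun x hx => v_dv 0 i _) (fun x _ => E_dv B x)) => x /andP[x0 _].
      by rewrite (lt_le_trans _ x0) // ltrN10.
    rewrite mulrA (_ : B * (2 * L) = M); last by rewrite /B divfK.
    apply: le_trans (fM _ _) _; rewrite ler_peMr ?(M0 i) // -expR0 ler_expR.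
    by rewrite !mulr_ge0 // ltW.
  by rewrite gerBl mulr_ge0 ?expR_ge0 // divr_ge0 ?(M0 i) // mulr_ge0 // ltW.
have hd x : 0 <= x <= t -> dv (fun s => v k.+2 s i - v k.+1 s i) x
    (f (v k.+1 (pos x)) i - f (v k (pos x)) i).
  by move=> /andP[x0 _]; apply: dvB; apply: v_dv; rewrite (lt_le_trans _ x0) // ltrN10.
have := dv_abs_le t0 hd (fun x _ => E_dv (B * 2^-1 ^+ k.+1) x).
rewrite !v0 subrr subr0 => H; apply: le_trans (H _) _.
  move=> x /andP[x0 _]; rewrite pos_id //.
  rewrite (_ : B * 2^-1 ^+ k.+1 * (2 * L * E x) = L * (B * E x * 2^-1 ^+ k)).
    by apply: fL => j; exact: IH.
  by rewrite exprS; field.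
rewrite mulrAC gerBl !mulr_ge0 ?expR_ge0 ?exprn_ge0 ?invr_ge0 ?(M0 i) //.
by rewrite mulr_ge0 // ltW.
Qed.

Lemma picard : exists w : R -> I -> R, (forall i, w 0 i = y0 i) /\
  forall t i, -1 < t -> dv (w^~ i) t (f (w (pos t)) i).
Proof.
have [u uE] : exists u : R -> I -> R, forall t i k, 0 <= t ->
    `|u t i - v k t i| <= 2 * (B * E t) * 2^-1 ^+ k.
  have H (p : R * I) : exists l, forall k, 0 <= p.1 ->
      `|l - v k p.1 p.2| <= 2 * (B * E p.1) * 2^-1 ^+ k.
    have [p0|p0] := leP 0 p.1; last by exists 0.
    have [l hl] := geometric_limit (fun k => v_diff k p.2 p0).
    by exists l.
  have [l hl] := choice H.
  by exists (fun t i => l (t, i)) => t i k t0; exact: (hl (t, i)).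
have small (x K : R) : 0 <= K -> (forall k, x <= K * 2^-1 ^+ k) -> x <= 0.
  move=> K0 h; apply/ler_addgt0Pr => e e0; rewrite add0r.
  have := @cvg_expr R 2^-1; rewrite ger0_norm ?invr_ge0 ?ler0n // invf_lt1 ?ltr0n // ltr1n.
  move=> /(_ isT)/cvgrPdist_lt.
  have e1 : 0 < e / (K + 1) by rewrite divr_gt0 // ltr_wpDl.
  move=> /(_ _ e1)[k _ /(_ k (leqnn _))] /=.
  rewrite sub0r normrN ger0_norm ?exprn_ge0 ?invr_ge0 ?ler0n // => hk.
  apply: le_trans (h k) _; rewrite (le_trans (y := (K + 1) * 2^-1 ^+ k)) //.
    by rewrite ler_wpM2r ?exprn_ge0 ?invr_ge0 ?ler0n // lerDl.
  by rewrite mulrC -ler_pdivlMr ?ltr_wpDl // ltW.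
(* If the index type is empty, M may be negative, but then there is no component to estimate. *)
have E0 t : 0 <= 2 * (B * E t) \/ forall i : I, False.
  have [i|nI] := pselect (exists i : I, True).
    left; have [i0 _] := i; rewrite !mulr_ge0 ?expR_ge0 ?invr_ge0 ?(M0 i0) //.
    by rewrite mulr_ge0 // ltW.
  by right=> i; apply: nI; exists i.
have u_lip s t i : 0 <= s -> 0 <= t -> `|u s i - u t i| <= M * `|s - t|.
  move=> s0 t0; rewrite -subr_le0.
  have [hs|/(_ i)//] := E0 s; have [ht|/(_ i)//] := E0 t.
  apply: (small _ (2 * (B * E s) + 2 * (B * E t))); first exact: addr_ge0.
  move=> k; have := v_lip k i s0 t0; have := uE s i k s0; have := uE t i k t0.
  rewrite [X in _ -> _ -> _ -> _ <= X]mulrDl.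
  set a := 2 * (B * E s) * _; set b := 2 * (B * E t) * _.
  rewrite (_ : u s i - u t i = (u s i - v k s i) - (u t i - v k t i) + (v k s i - v k t i)).
    move=> h1 h2 h3; have := ler_normD (u s i - v k s i - (u t i - v k t i)) (v k s i - v k t i).
    have := ler_normB (u s i - v k s i) (u t i - v k t i); lra.
  by ring.
have Tu_dv t i : -1 < t -> dv (T u ^~ i) t (f (u (pos t)) i).
  by move=> t1; exact: T_dv.
have Tu0 i : T u 0 i = y0 i by rewrite /T prim0 addr0.
(* The limit u is unspecified at negative times, whereas T u is differentiable by construction. It
   remains to see that T u and u agree at nonnegative times: both are within a multiple of 2^-k of
   the iterate of index k + 1. *)
exists (T u); split=> // t i t1; rewrite (_ : f (T u (pos t)) i = f (u (pos t)) i).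
  exact: Tu_dv.
congr (f _ i); apply: funext => j.
have pt : 0 <= pos t by rewrite le_max lexx orbT.
set s := pos t in pt *.
apply/esym/eqP; rewrite -subr_eq0 -normr_le0; have [hs|/(_ i)//] := E0 s.
apply: (small _ (2 * (2 * (B * E s)))); first exact: mulr_ge0.
move=> k; have pos_id x : 0 <= x -> pos x = x by move=> x0; apply/max_idPl.
have hd x : 0 <= x <= s -> dv (fun r => T u r j - v k.+1 r j) x
    (f (u (pos x)) j - f (v k (pos x)) j).
  by move=> /andP[x0 _]; apply: dvB; [apply: Tu_dv|apply: v_dv];
     rewrite (lt_le_trans _ x0) // ltrN10.
have := dv_abs_le pt hd (fun x _ => E_dv (B * 2^-1 ^+ k) x).
rewrite Tu0 v0 subrr subr0 => H.
have {}H : `|T u s j - v k.+1 s j| <= B * 2^-1 ^+ k * E s - B * 2^-1 ^+ k * E 0.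
  apply: H => x /andP[x0 _]; rewrite pos_id //.
  rewrite (_ : B * 2^-1 ^+ k * (2 * L * E x) = L * (2 * (B * E x) * 2^-1 ^+ k)).
    by apply: fL => l; exact: uE.
  by ring.
have BE : 0 <= B * 2^-1 ^+ k * E 0.
  by rewrite !mulr_ge0 ?expR_ge0 ?exprn_ge0 ?invr_ge0 ?(M0 i) // mulr_ge0 // ltW.
have := uE s j k.+1 pt; rewrite exprS => U.
rewrite (_ : u s j - T u s j = (u s j - v k.+1 s j) - (T u s j - v k.+1 s j)); last by ring.
apply: le_trans (ler_normB _ _) _.
have E1 : 2 * (B * E s) * (2^-1 * 2^-1 ^+ k) = B * 2^-1 ^+ k * E s by field.
have E2 : 2 * (2 * (B * E s)) * 2^-1 ^+ k = 4 * (B * 2^-1 ^+ k * E s) by ring.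
rewrite E2; rewrite E1 in U.
have BE' : 0 <= B * 2^-1 ^+ k * E s.
  by rewrite !mulr_ge0 ?expR_ge0 ?exprn_ge0 ?invr_ge0 ?(M0 i) // mulr_ge0 // ltW.
by lra.
Qed.

End Picard.

End RealDerivatives.

(* Every component of the field is a polynomial in the entries of g, of its
   inverse and of H, so any class of functions closed under ring operations and
   containing these entries contains the field. *)
Section RingClosed.
Context (R : realType) (S : Type).

Record ring_closed (Q : (S -> R) -> Prop) : Prop := RingClosed {
  rc_cst : forall a, Q (fun=> a);
  rc_add : forall f g, Q f -> Q g -> Q (fun s => f s + g s);
  rc_mul : forall f g, Q f -> Q g -> Q (fun s => f s * g s) }.

Variable Q : (S -> R) -> Prop.
Hypothesis rcQ : ring_closed Q.

Lemma rc_opp f : Q f -> Q (fun s => - f s).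
Proof.
move=> Qf; rewrite (_ : (fun _ => _) = fun s => -1 * f s).
  by apply: (rc_mul rcQ) => //; exact: (rc_cst rcQ).
by apply: funext => s; rewrite mulN1r.
Qed.

Lemma rc_sum (J : Type) (r : seq J) (P : pred J) (f : J -> S -> R) :
  (forall j, Q (f j)) -> Q (fun s => \sum_(j <- r | P j) f j s).
Proof.
move=> Qf; elim: r => [|j r IH].
  rewrite (_ : (fun _ => _) = fun=> 0); first exact: (rc_cst rcQ).
  by apply: funext => s; rewrite big_nil.
rewrite (_ : (fun _ => _) = fun s =>
  if P j then f j s + \sum_(j <- r | P j) f j s else \sum_(j <- r | P j) f j s).
  by case: (P j) => //; exact: (rc_add rcQ).
by apply: funext => s; rewrite big_cons.
Qed.

Lemma rc_prod (J : Type) (r : seq J) (P : pred J) (f : J -> S -> R) :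
  (forall j, Q (f j)) -> Q (fun s => \prod_(j <- r | P j) f j s).
Proof.
move=> Qf; elim: r => [|j r IH].
  rewrite (_ : (fun _ => _) = fun=> 1); first exact: (rc_cst rcQ).
  by apply: funext => s; rewrite big_nil.
rewrite (_ : (fun _ => _) = fun s =>
  if P j then f j s * \prod_(j <- r | P j) f j s else \prod_(j <- r | P j) f j s).
  by case: (P j) => //; exact: (rc_mul rcQ).
by apply: funext => s; rewrite big_cons.
Qed.

Lemma rc_det n (A : S -> 'M[R]_n) : (forall i j, Q (fun s => A s i j)) ->
  Q (fun s => \det (A s)).
Proof.
move=> QA; apply: rc_sum => p; apply: (rc_mul rcQ); first exact: (rc_cst rcQ).
by apply: rc_prod => i; exact: QA.
Qed.

Lemma rc_adj n (A : S -> 'M[R]_n) i j : (forall i j, Q (fun s => A s i j)) ->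
  Q (fun s => (\adj (A s)) i j).
Proof.
move=> QA; rewrite (_ : (fun _ => _) = fun s => cofactor (A s) j i); last first.
  by apply: funext => s; rewrite mxE.
apply: (rc_mul rcQ); first exact: (rc_cst rcQ).
apply: rc_det => k l.
by rewrite (_ : (fun _ => _) = fun s => A s (lift j k) (lift i l)) //;
   apply: funext => s; rewrite !mxE.
Qed.

Section Tensors.
Variables (n : nat) (c : 'I_n -> 'I_n -> 'I_n -> R).
Variables (g ga : S -> 'M[R]_n) (H : S -> 'I_n -> 'I_n -> 'I_n -> R).
Hypothesis Qg : forall i j, Q (fun s => g s i j).
Hypothesis Qga : forall i j, Q (fun s => ga s i j).
Hypothesis QH : forall i j k, Q (fun s => H s i j k).

Lemma rc_ext2 (b : S -> 'I_n -> 'I_n -> R) i j k :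
  (forall i j, Q (fun s => b s i j)) -> Q (fun s => ext2_const c (b s) i j k).
Proof.
move=> Qb; have T p q r : Q (fun s => \sum_m c p q m * b s m r).
  by apply: rc_sum => m; apply: (rc_mul rcQ) => //; exact: (rc_cst rcQ).
by apply: (rc_add rcQ); [apply: (rc_add rcQ) => //|]; apply: rc_opp.
Qed.

Lemma rc_chr i j k : Q (fun s => chr_const c (g s) (ga s) i j k).
Proof.
have T p q r : Q (fun s => \sum_m c p q m * g s m r).
  by apply: rc_sum => m; apply: (rc_mul rcQ) => //; exact: (rc_cst rcQ).
apply: (rc_mul rcQ); first exact: (rc_cst rcQ).
apply: rc_sum => l; apply: (rc_mul rcQ) => //.
by apply: (rc_add rcQ); [apply: (rc_add rcQ) => //|]; apply: rc_opp.
Qed.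

Lemma rc_rhs_g i j : Q (fun s => rhs_g c (g s) (ga s) (H s) i j).
Proof.
have X := rc_chr.
apply: (rc_add rcQ); apply: (rc_mul rcQ); try exact: (rc_cst rcQ).
  apply: rc_sum => k; apply: rc_sum => m; apply: (rc_add rcQ); first apply: (rc_add rcQ).
  - exact: (rc_mul rcQ).
  - by apply: rc_opp; apply: (rc_mul rcQ).
  - by apply: rc_opp; apply: (rc_mul rcQ) => //; exact: (rc_cst rcQ).
by do 4![apply: rc_sum => ?]; do 3![apply: (rc_mul rcQ) => //].
Qed.

Lemma rc_rhs_b i j : Q (fun s => rhs_b c (g s) (ga s) (H s) i j).
Proof.
have X := rc_chr.
do 2!apply: rc_opp; do 2![apply: rc_sum => ?]; apply: (rc_mul rcQ) => //; apply: rc_opp.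
by apply: rc_sum => r; apply: (rc_add rcQ); [apply: (rc_add rcQ)|]; apply: (rc_mul rcQ).
Qed.

End Tensors.

End RingClosed.

(** * Derivative of the inverse metric *)

Section InverseDerivative.
Context (R : realType) (n : nat).

(* Unlike [invmx], a rational function of the entries on all of 'M_n. *)
Definition adj_inv (g : 'M[R]_n) := (\det g)^-1 *: \adj g.

Lemma adj_invE g : g \in unitmx -> adj_inv g = invmx g.
Proof. by move=> gu; rewrite /invmx gu. Qed.

Local Notation dv f t l := (is_derive (t : R) (1 : R) (f : R -> R) (l : R)).

Lemma ring_closed_derivable t : ring_closed (fun f : R -> R => exists l, dv f t l).
Proof.
split=> [a|f g [l hl] [l' hl']|f g [l hl] [l' hl']].
- by exists 0; exact: dv_cst.
- by exists (l + l'); exact: dvD.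
- by exists (l * g t + f t * l'); exact: dvM.
Qed.

Lemma dvV (f : R -> R) t l : f t != 0 -> dv f t l ->
  dv (fun s => (f s)^-1) t (- (f t) ^- 2 * l).
Proof.
move=> ft df; have dfv : derivable f t 1 by exact: ex_derive.
apply: DeriveDef; first exact: derivableV.
by rewrite deriveV // derive_val.
Qed.

(** The determinant and the adjugate are polynomial, hence have some derivatives d and A. Their
    explicit form never matters: differentiating adj(g) g = det(g) 1 gives A in terms of d, and d
    cancels. *)
Lemma adj_inv_dv (g : R -> 'M[R]_n) (h : 'M[R]_n) t :
  g t \in unitmx -> (forall i j, dv (fun s => g s i j) t (h i j)) ->
  forall i j, dv (fun s => adj_inv (g s) i j) t
    ((- (adj_inv (g t) *m h *m adj_inv (g t))) i j).
Proof.
move=> gu dg; have rc := ring_closed_derivable t.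
have ed i j : exists l, dv (fun s => g s i j) t l by exists (h i j).
have [d dE] := rc_det rc ed.
have [A AE] : exists A : 'M[R]_n, forall i j, dv (fun s => (\adj (g s)) i j) t (A i j).
  have [l hl] := choice (fun p : 'I_n * 'I_n => rc_adj rc p.1 p.2 ed).
  by exists (\matrix_(i, j) l (i, j)) => i j; rewrite mxE; exact: (hl (i, j)).
have dn0 : \det (g t) != 0 by rewrite -unitfE -unitmxE.
pose D := - (\det (g t)) ^- 2 * d.
have key i j : dv (fun s => adj_inv (g s) i j) t
    ((D *: \adj (g t) + (\det (g t))^-1 *: A) i j).
  have -> : (D *: \adj (g t) + (\det (g t))^-1 *: A) i j =
    D * (\adj (g t)) i j + (\det (g t))^-1 * A i j by rewrite !mxE.
  rewrite (_ : (fun _ => _) = fun s => (\det (g s))^-1 * (\adj (g s)) i j).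
    exact: dvM (dvV dn0 dE) (AE i j).
  by apply: funext => s; rewrite mxE.
have prodE : A *m g t + \adj (g t) *m h = d%:M.
  apply/matrixP => i j; rewrite mxE.
  have d1 : dv (fun s => (\adj (g s) *m g s) i j) t
      ((A *m g t) i j + (\adj (g t) *m h) i j).
    rewrite (_ : (fun _ => _) = fun s => \sum_k (\adj (g s)) i k * g s k j).
      rewrite !mxE -big_split /=; apply: dv_sum => k.
      exact: dvM (AE i k) (dg k j).
    by apply: funext => s; rewrite mxE.
  have d2 : dv (fun s => (\adj (g s) *m g s) i j) t (d%:M i j).
    rewrite (_ : (fun _ => _) = fun s => (i == j)%:R * \det (g s)).
      by have -> : d%:M i j = (i == j)%:R * d by [rewrite mxE mulr_natl]; exact: dvZ.
    by apply: funext => s; rewrite mul_adj_mx mxE mulr_natl.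
  by rewrite -(@derive_val _ _ _ _ _ _ _ d1) (@derive_val _ _ _ _ _ _ _ d2).
have E : D *: \adj (g t) + (\det (g t))^-1 *: A = - (adj_inv (g t) *m h *m adj_inv (g t)).
  have gi : g t *m adj_inv (g t) = 1%:M by rewrite adj_invE // mulmxV.
  have AA : A = (d%:M - \adj (g t) *m h) *m adj_inv (g t).
    by rewrite -prodE addrK -mulmxA gi mulmx1.
  rewrite AA mulmxBl mul_scalar_mx scalerBr scalerA addrA.
  rewrite {1}/adj_inv scalerA -scalerDl (_ : D + _ = 0); last by rewrite /D; field.
  by rewrite scale0r add0r /adj_inv -!scalemxAl -!scalemxAr.
by move=> i j; rewrite -E; exact: key.
Qed.

End InverseDerivative.

Section GenScalDerivative.
Context (R : realType) (n : nat) (c : 'I_n -> 'I_n -> 'I_n -> R).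
Local Notation dv f t l := (is_derive (t : R) (1 : R) (f : R -> R) (l : R)).

Lemma dv_contract2 (M : R -> 'M[R]_n) (M' : 'M[R]_n) (F : R -> 'I_n -> 'I_n -> R) F' t :
  (forall i j, dv (fun s => M s i j) t (M' i j)) ->
  (forall i j, dv (fun s => F s i j) t (F' i j)) ->
  dv (fun s => contract2 (M s) (F s)) t (contract2 M' (F t) + contract2 (M t) F').
Proof.
move=> dM dF; rewrite /contract2 sum2D; apply: dv_sum => i; apply: dv_sum => j.
exact: dvM.
Qed.

Lemma contract2D (M : 'M[R]_n) (F F' : 'I_n -> 'I_n -> R) :
  contract2 M (fun i j => F i j + F' i j) = contract2 M F + contract2 M F'.
Proof. by rewrite /contract2 sum2D; apply: eq_sum2 => i j; rewrite mulrDr. Qed.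

Lemma contract20 (M : 'M[R]_n) : contract2 M (fun _ _ => 0) = 0.
Proof. by rewrite /contract2 big1 // => i _; rewrite big1 // => j _; rewrite mulr0. Qed.

Lemma dv_contract2_cst (M : R -> 'M[R]_n) (M' : 'M[R]_n) F t :
  (forall i j, dv (fun s => M s i j) t (M' i j)) ->
  dv (fun s => contract2 (M s) F) t (contract2 M' F).
Proof.
move=> dM; have := dv_contract2 dM (fun i j => dv_cst (F i j) t).
by rewrite contract20 addr0.
Qed.

Variables (g ga : R -> 'M[R]_n) (H : R -> 'I_n -> 'I_n -> 'I_n -> R) (t : R).
Variables (h dga : 'M[R]_n) (dH : 'I_n -> 'I_n -> 'I_n -> R).
Hypothesis dg : forall i j, dv (fun s => g s i j) t (h i j).
Hypothesis dgaE : forall i j, dv (fun s => ga s i j) t (dga i j).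
Hypothesis dHE : forall i j k, dv (fun s => H s i j k) t (dH i j k).

Lemma dv_bracket_norm :
  dv (fun s => bracket_norm c (ga s) (ga s) (g s)) t
    (bracket_norm c dga (ga t) (g t) + bracket_norm c (ga t) dga (g t)
     + bracket_norm c (ga t) (ga t) h).
Proof.
rewrite -addrA -contract2D; apply: dv_contract2 => // i p.
by apply: dv_contract2 => // j q; exact: dv_contract2_cst.
Qed.

Lemma dv_form3_dot :
  dv (fun s => form3_dot (ga s) (ga s) (ga s) (H s) (H s)) t
    (form3_dot dga (ga t) (ga t) (H t) (H t) + form3_dot (ga t) dga (ga t) (H t) (H t)
     + form3_dot (ga t) (ga t) dga (H t) (H t) + form3_dot (ga t) (ga t) (ga t) dH (H t)
     + form3_dot (ga t) (ga t) (ga t) (H t) dH).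
Proof.
rewrite -!addrA -!contract2D; apply: dv_contract2 => // i p.
rewrite -!contract2D; apply: dv_contract2 => // j q.
rewrite -!contract2D; apply: dv_contract2 => // k l.
exact: dvM.
Qed.

Lemma dv_gen_scal :
  dv (fun s => gen_scal c (g s) (ga s) (H s)) t
     (gen_scal_diff c (g t) (ga t) (H t) h dga dH).
Proof.
have d1 := dvZ (- 4^-1) dv_bracket_norm.
have d2 := dvZ 2^-1 (dv_contract2_cst (killing c) dgaE).
have d3 := dv_contract2_cst (theta2 c) dgaE.
have d4 := dvZ 12^-1 dv_form3_dot.
exact: (dvB (dvB (dvB d1 d2) d3) d4).
Qed.

End GenScalDerivative.

(** * A priori estimates *)

Section Apriori.
Context (R : realType) (n : nat) (c : 'I_n -> 'I_n -> 'I_n -> R).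
Variable H0 : 'I_n -> 'I_n -> 'I_n -> R.
Local Notation dv f t l := (is_derive (t : R) (1 : R) (f : R -> R) (l : R)).
Implicit Types (g : R -> 'M[R]_n) (b : R -> 'I_n -> 'I_n -> R).

Hypothesis calt : alternating2 c.
Hypothesis cjac : jacobi c.
Hypothesis csolv : solvable_const c.
Hypothesis H0alt : alternating3 H0.
Hypothesis H0closed : closed3_const c H0.

Definition antisym (b : 'I_n -> 'I_n -> R) := forall i j, b i j = - b j i.

Local Notation tor := (torsion_const c H0).

(** The derivatives are two-sided even at t = 0, so the values just before 0 matter there, although
    the equation is imposed only from 0 on. *)
Definition flow_on (s : R) g b := forall t, 0 <= t < s ->
  [/\ posdef (g t), antisym (b t),
    forall i j, dv (fun r => g r i j) t (rhs_g c (g t) (adj_inv (g t)) (tor (b t)) i j)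
  & forall i j, dv (fun r => b r i j) t (rhs_b c (g t) (adj_inv (g t)) (tor (b t)) i j)].

Lemma posdef_unit (M : 'M[R]_n) : posdef M -> M \in unitmx.
Proof.
move=> pM; have [m [P [onP _]]] := solvable_frame calt cjac csolv pM.
by have /mulmx1_unit[] := on_invr onP.
Qed.

Lemma torsion_alternating3 (b : 'I_n -> 'I_n -> R) : alternating3 (tor b).
Proof. by apply: alternating3D => //; exact: ext2_alternating3. Qed.

Lemma torsion_closed3 (b : 'I_n -> 'I_n -> R) : antisym b -> closed3_const c (tor b).
Proof. by move=> ba; apply: closed3D => //; exact: ext2_closed3. Qed.

Definition energy (M : 'M[R]_n) (b : 'I_n -> 'I_n -> R) :=
  gen_scal c M (adj_inv M) (tor b).

Definition energy_rate (M : 'M[R]_n) (b : 'I_n -> 'I_n -> R) :=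
  gen_scal_flow c M (adj_inv M) (tor b).

Lemma energy_le0 M (b : 'I_n -> 'I_n -> R) : posdef M -> energy M b <= 0.
Proof.
move=> pM; have [m [P [onP le0]]] := solvable_frame calt cjac csolv pM.
by rewrite /energy adj_invE ?posdef_unit.
Qed.

Lemma flow_bounds M (b : 'I_n -> 'I_n -> R) : posdef M -> antisym b ->
  let h := \matrix_(i, j) rhs_g c M (adj_inv M) (tor b) i j in
  [/\ 0 <= energy_rate M b,
    forall v, `|mform h v v| <= (2^-1 + energy_rate M b) * mform M v v
  & forall i j, `|rhs_b c M (adj_inv M) (tor b) i j| <=
      (2^-1 + energy_rate M b) * (2^-1 * (M i i + M j j))].
Proof.
move=> pM ba; have [m [P [onP _]]] := solvable_frame calt cjac csolv pM.
have ta := torsion_alternating3 b; have tc := torsion_closed3 ba.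
rewrite /energy_rate adj_invE ?posdef_unit //; split.
- exact: (gen_scal_flow_ge0 calt cjac onP).
- by move=> v; exact: (rhs_g_bound calt cjac onP).
move=> i j.
have := rhs_b_bound calt cjac onP (delta_mx 0 i) (delta_mx 0 j) ta tc.
by rewrite !mform_delta mxE.
Qed.

Lemma dv_mform (g : R -> 'M[R]_n) (h : 'M[R]_n) t u v :
  (forall i j, dv (fun r => g r i j) t (h i j)) ->
  dv (fun r => mform (g r) u v) t (mform h u v).
Proof.
move=> dg; apply: dv_sum => i; apply: dv_sum => j.
rewrite -[h i j * _]addr0 -(mulr0 (g t i j)); exact: dvM (dg i j) (dv_cst _ _).
Qed.

Lemma dv_ext2 b (b' : 'I_n -> 'I_n -> R) t i j k :
  (forall i j, dv (fun r => b r i j) t (b' i j)) ->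
  dv (fun r => ext2_const c (b r) i j k) t (ext2_const c b' i j k).
Proof.
move=> db; have T p q l : dv (fun r => \sum_m c p q m * b r m l) t (\sum_m c p q m * b' m l).
  by apply: dv_sum => m; exact: dvZ.
exact: (dvB (dvD (dvN (T i j k)) (T i k j)) (T j k i)).
Qed.

Lemma dv_torsion b (b' : 'I_n -> 'I_n -> R) t i j k :
  (forall i j, dv (fun r => b r i j) t (b' i j)) ->
  dv (fun r => tor (b r) i j k) t (ext2_const c b' i j k).
Proof.
by move=> db; have := dvD (dv_cst (H0 i j k) t) (dv_ext2 i j k db); rewrite add0r.
Qed.

Lemma flow_on_energy s g b t : flow_on s g b -> 0 <= t < s ->
  dv (fun r => energy (g r) (b r)) t (energy_rate (g t) (b t)).
Proof.
move=> fl ts; have [pg _ dg db] := fl t ts.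
have dg' i j : dv (fun r => g r i j) t
    ((\matrix_(i, j) rhs_g c (g t) (adj_inv (g t)) (tor (b t)) i j) i j).
  by rewrite mxE.
have D := adj_inv_dv (posdef_unit pg) dg'.
exact: (dv_gen_scal c dg' D (fun i j k => dv_torsion i j k db)).
Qed.

(** Bounds the increase of t/2 + Phi over [0, s), because Phi is nonpositive; it depends only on s
    and the initial value. *)
Definition growth (s : R) (M : 'M[R]_n) (b : 'I_n -> 'I_n -> R) := s / 2 - energy M b.

Section OneFlow.
Variables (s : R) (g : R -> 'M[R]_n) (b : R -> 'I_n -> 'I_n -> R).
Hypothesis fl : flow_on s g b.
Let p t := t / 2 + energy (g t) (b t).

Let p_dv t : 0 <= t < s -> dv p t (2^-1 + energy_rate (g t) (b t)).
Proof.
move=> ts; have := dvD (dvZ 2^-1 (is_derive_id (t : R) (1 : R))) (flow_on_energy fl ts).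
rewrite mulr1 (_ : (fun _ => _) = p) //.
by apply: funext => r; rewrite /p mulrC.
Qed.

Let in_s t x : 0 <= t < s -> 0 <= x <= t -> 0 <= x < s.
Proof. by move=> /andP[_ ts] /andP[-> xt]; exact: le_lt_trans ts. Qed.

Let p_growth t : 0 <= t < s -> 0 <= p t - p 0 <= growth s (g 0) (b 0).
Proof.
move=> ts; have /andP[t0 t_s] := ts; apply/andP; split.
  have := dv_le t0 (fun x _ => dv_cst 0 x) (fun x hx => p_dv (in_s ts hx)).
  rewrite subrr; apply => x hx; have [pg ba _ _] := fl (in_s ts hx).
  by rewrite addr_ge0 ?invr_ge0 ?ler0n //; have [] := flow_bounds pg ba.
have [pg _ _ _] := fl ts.
rewrite /p /growth mul0r add0r; have := energy_le0 (b t) pg.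
have : t / 2 <= s / 2 by rewrite ler_wpM2r ?invr_ge0 ?ler0n // ltW.
by lra.
Qed.

(** With m(t) = g_t(v, v) the estimate on g' reads |m'| <= p' m, so m exp(-p) is nonincreasing and m
    exp(p) nondecreasing; [p_growth] bounds the change of p. *)
Lemma flow_on_metric t v : 0 <= t < s ->
  mform (g t) v v <= expR (growth s (g 0) (b 0)) * mform (g 0) v v /\
  expR (- growth s (g 0) (b 0)) * mform (g 0) v v <= mform (g t) v v.
Proof.
move=> ts; have /andP[t0 t_s] := ts.
pose m r := mform (g r) v v.
pose h r := \matrix_(i, j) rhs_g c (g r) (adj_inv (g r)) (tor (b r)) i j.
have m_dv x : 0 <= x <= t -> dv m x (mform (h x) v v).
  move=> hx; have [_ _ dg _] := fl (in_s ts hx); apply: dv_mform => i j.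
  by rewrite mxE; exact: dg.
have m0 x : 0 <= x <= t -> 0 <= m x.
  move=> hx; have [pg _ _ _] := fl (in_s ts hx).
  have [v0|v0] := eqVneq v 0; last by rewrite ltW // pg.2.
  by rewrite /m v0 /mform big1 // => i _; rewrite big1 // => j _; rewrite !mxE mulr0 mulr0.
have hb x : 0 <= x <= t ->
    `|mform (h x) v v| <= (2^-1 + energy_rate (g x) (b x)) * m x.
  move=> hx; have [pg ba _ _] := fl (in_s ts hx).
  by have [_ + _] := flow_bounds pg ba; apply.
have /andP[pt0 pt1] := p_growth ts.
have t00 : 0 <= (0 : R) <= t by apply/andP; split.
have up : m t * expR (- p t) <= m 0 * expR (- p 0).
  have d1 x (hx : 0 <= x <= t) := dvM (m_dv x hx) (dv_comp_exp (dvN (p_dv (in_s ts hx)))).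
  have := dv_le t0 d1 (fun x _ => dv_cst 0 x).
  rewrite subrr subr_le0; apply => x hx.
  have := hb x hx; rewrite ler_norml => /andP[_ hh].
  rewrite (_ : _ + _ = expR (- p x) * (mform (h x) v v
     - (2^-1 + energy_rate (g x) (b x)) * m x)); last by ring.
  by rewrite mulr_ge0_le0 ?expR_ge0 // subr_le0.
have low : m 0 * expR (p 0) <= m t * expR (p t).
  have d1 x (hx : 0 <= x <= t) := dvM (m_dv x hx) (dv_comp_exp (p_dv (in_s ts hx))).
  have := dv_le t0 (fun x _ => dv_cst 0 x) d1.
  rewrite subrr subr_ge0; apply => x hx.
  have := hb x hx; rewrite ler_norml => /andP[hh _].
  rewrite (_ : _ + _ = expR (p x) * (mform (h x) v v
     + (2^-1 + energy_rate (g x) (b x)) * m x)); last by ring.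
  by rewrite mulr_ge0 ?expR_ge0 // -lerBlDr sub0r.
have m00 := m0 0 t00; split.
  apply: (@le_trans _ _ (expR (p t - p 0) * m 0)).
    have := ler_wpM2r (expR_ge0 (p t)) up.
    by rewrite -!mulrA -!expRD addNr expR0 mulr1 [X in _ <= X]mulrC addrC.
  by rewrite ler_wpM2r // ler_expR.
apply: (@le_trans _ _ (expR (p 0 - p t) * m 0)).
  by rewrite ler_wpM2r // ler_expR; lra.
have := ler_wpM2r (expR_ge0 (- p t)) low.
by rewrite -!mulrA -!expRD subrr expR0 mulr1 [X in X <= _]mulrC.
Qed.

(** Once the metric is bounded, the estimate on b' reads |b'| <= K p', and p increases by at most
    [growth]. *)
Lemma flow_on_form t i j : 0 <= t < s ->
  `|b t i j - b 0 i j| <= expR (growth s (g 0) (b 0)) * (2^-1 * (g 0 i i + g 0 j j))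
                          * growth s (g 0) (b 0).
Proof.
move=> ts; have /andP[t0 t_s] := ts.
have /andP[pt0 pt1] := p_growth ts.
set K := expR _ * _.
have gii x k : 0 <= x <= t -> g x k k <= expR (growth s (g 0) (b 0)) * g 0 k k.
  move=> hx; have [+ _] := flow_on_metric (delta_mx 0 k) (in_s ts hx).
  by rewrite !mform_delta.
have g0 k : 0 <= g 0 k k.
  have s0 : 0 <= (0 : R) < s by apply/andP; split; [|exact: le_lt_trans t0 t_s].
  have [pg _ _ _] := fl s0; rewrite -mform_delta ltW // pg.2 //.
  by apply/eqP => /matrixP/(_ 0 k)/eqP; rewrite !mxE !eqxx oner_eq0.
have K0 : 0 <= K.
  by rewrite !mulr_ge0 ?expR_ge0 ?invr_ge0 ?ler0n // addr_ge0.
have db x : 0 <= x <= t -> dv (fun r => b r i j) x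
    (rhs_b c (g x) (adj_inv (g x)) (tor (b x)) i j).
  by move=> hx; have [_ _ _ +] := fl (in_s ts hx); apply.
have := dv_abs_le t0 db (fun x hx => dvZ K (p_dv (in_s ts hx))).
rewrite -mulrBr => H; apply: le_trans (H _) _; last by rewrite ler_wpM2l.
move=> x hx; have [pg ba _ _] := fl (in_s ts hx).
have [e0 _ hb] := flow_bounds pg ba; apply: le_trans (hb i j) _.
have q0 : 0 <= 2^-1 + energy_rate (g x) (b x) by apply: addr_ge0; rewrite // invr_ge0 ler0n.
rewrite mulrC; apply: (ler_wpM2r q0).
have := gii x i hx; have := gii x j hx; rewrite /K; set e := expR _ => h1 h2.
rewrite (_ : e * _ = 2^-1 * (e * g 0 i i + e * g 0 j j)); last by ring.
by lra.
Qed.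

End OneFlow.
End Apriori.

(** * Existence for all times *)

Section MinMax.
Context (R : realDomainType).
Implicit Types (a x y : R).

Lemma max_dist_le a x y : `|Num.max a x - Num.max a y| <= `|x - y|.
Proof.
have h1 := ler_norm (x - y); have h2 := ler_norm (y - x); rewrite distrC in h2.
by rewrite ler_norml; case: (leP a x) => ?; case: (leP a y) => ?; lra.
Qed.

Lemma min_dist_le a x y : `|Num.min x a - Num.min y a| <= `|x - y|.
Proof.
have h1 := ler_norm (x - y); have h2 := ler_norm (y - x); rewrite distrC in h2.
by rewrite ler_norml; case: (leP x a) => ?; case: (leP y a) => ?; lra.
Qed.

End MinMax.

(** * The cut-off field *)

Section BoundedLipschitz.
Context (R : realType) (J : Type).

(** Boundedness is included because products of Lipschitz functions are Lipschitz only under bounds;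
    with it the class is a ring. Distances are taken in the supremum norm. *)
Definition bounded_lipschitz (f : (J -> R) -> R) := exists B L : R,
  [/\ 0 <= B, 0 <= L, forall y, `|f y| <= B
    & forall y z d, 0 <= d -> (forall i, `|y i - z i| <= d) -> `|f y - f z| <= L * d].

Lemma ring_closed_lipschitz : ring_closed bounded_lipschitz.
Proof.
split=> [a|f g [B [L [B0 L0 fB fL]]] [B' [L' [B0' L0' gB gL]]]
          |f g [B [L [B0 L0 fB fL]]] [B' [L' [B0' L0' gB gL]]]].
- exists `|a|, 0; split=> // y z d _ _; by rewrite subrr normr0 mul0r.
- exists (B + B'), (L + L'); split; [exact: addr_ge0|exact: addr_ge0| |].
    by move=> y; apply: le_trans (ler_normD _ _) _; exact: lerD.
  move=> y z d d0 yz; rewrite opprD addrACA mulrDl.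
  by apply: le_trans (ler_normD _ _) _; apply: lerD; [exact: fL|exact: gL].
exists (B * B'), (B * L' + B' * L); split.
- exact: mulr_ge0.
- by rewrite addr_ge0 ?mulr_ge0.
- by move=> y; rewrite normrM; apply: ler_pM.
move=> y z d d0 yz.
rewrite (_ : _ - _ = f y * (g y - g z) + g z * (f y - f z)); last by ring.
apply: le_trans (ler_normD _ _) _; rewrite !normrM mulrDl -!mulrA.
by apply: lerD; apply: ler_pM => //; [exact: gL|exact: fL].
Qed.

Definition clamp (K x : R) := Num.max (- K) (Num.min x K).

Lemma clamp_id K x : `|x| <= K -> clamp K x = x.
Proof.
by rewrite ler_norml => /andP[h1 h2]; rewrite /clamp min_l // max_r.
Qed.

Lemma bounded_lipschitz_clamp K i : 0 <= K -> bounded_lipschitz (fun y => clamp K (y i)).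
Proof.
move=> K0; exists K, 1; split=> // [y|y z d d0 /(_ i)].
  rewrite /clamp ler_norml; apply/andP; split; first by rewrite le_max lexx.
  by rewrite ge_max ge_min lexx orbT andbT; lra.
rewrite mul1r => h; apply: le_trans h.
by apply: le_trans (max_dist_le _ _ _) _; exact: min_dist_le.
Qed.

Lemma bounded_lipschitz_inv f eta : 0 < eta -> bounded_lipschitz f ->
  bounded_lipschitz (fun y => (Num.max (f y) eta)^-1).
Proof.
move=> e0 [B [L [B0 L0 fB fL]]]; exists eta^-1, (L / eta ^+ 2).
have m0 y : eta <= Num.max (f y) eta by rewrite le_max lexx orbT.
have mp y : 0 < Num.max (f y) eta by exact: lt_le_trans (m0 y).
split.
- by rewrite invr_ge0 ltW.
- by rewrite divr_ge0 // exprn_ge0 // ltW.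
- move=> y; have ip : 0 <= (Num.max (f y) eta)^-1 by rewrite invr_ge0 ltW.
  by rewrite (ger0_norm ip) lef_pV2 ?posrE.
move=> y z d d0 yz; have {yz} := fL y z d d0 yz; set a := f y; set b := f z => ab.
have mab : `|Num.max b eta - Num.max a eta| <= L * d.
  apply: le_trans ab; rewrite distrC [Num.max a _]maxC [Num.max b _]maxC.
  exact: max_dist_le.
rewrite (_ : _ - _ = (Num.max b eta - Num.max a eta)
    / (Num.max a eta * Num.max b eta)); last first.
  by field; rewrite !gt_eqF ?mp.
rewrite normrM normfV mulrAC; apply: ler_pM => //.
have pp : 0 < Num.max a eta * Num.max b eta by rewrite mulr_gt0 ?mp.
rewrite (gtr0_norm pp) lef_pV2 ?posrE ?exprn_gt0 // expr2.
by apply: ler_pM; rewrite ?m0 // ltW.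
Qed.

End BoundedLipschitz.

Section ClampedField.
Context (R : realType) (n : nat) (c H0 : 'I_n -> 'I_n -> 'I_n -> R).
Local Notation J := (bool * 'I_n * 'I_n)%type.
Local Notation tor := (torsion_const c H0).
Variables (K eta : R).

Definition pack (M : 'M[R]_n) (b : 'I_n -> 'I_n -> R) : J -> R :=
  fun j => if j.1.1 then M j.1.2 j.2 else b j.1.2 j.2.
Definition metric_of (y : J -> R) : 'M[R]_n := \matrix_(i, j) y (true, i, j).
Definition form_of (y : J -> R) i j := y (false, i, j).

Definition clamp_state (y : J -> R) : J -> R := fun j => clamp K (y j).
(** Writing 1 / det as det / det^2 allows the denominator to be cut off from below whatever the sign
    of the determinant. As soon as det^2 >= eta this is [adj_inv]. *)
Definition clamp_inv (M : 'M[R]_n) : 'M[R]_n :=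
  ((Num.max (\det M ^+ 2) eta)^-1 * \det M) *: \adj M.

(* Symmetrising the field makes the symmetry of the metric and the antisymmetry
   of the 2-form hold along every solution, whether or not the cut-off is met. *)
Definition clamped_field (y : J -> R) (j : J) : R :=
  let M := metric_of (clamp_state y) in let ga := clamp_inv M in
  let H := tor (form_of (clamp_state y)) in
  if j.1.1 then 2^-1 * (rhs_g c M ga H j.1.2 j.2 + rhs_g c M ga H j.2 j.1.2)
  else 2^-1 * (rhs_b c M ga H j.1.2 j.2 - rhs_b c M ga H j.2 j.1.2).

Hypothesis K0 : 0 <= K.
Hypothesis e0 : 0 < eta.

Lemma clamped_field_lipschitz1 j : bounded_lipschitz (fun y => clamped_field y j).
Proof.
have rc := @ring_closed_lipschitz R J.
have Qg i k : bounded_lipschitz (fun y => metric_of (clamp_state y) i k).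
  rewrite (_ : (fun _ => _) = fun y => clamp K (y (true, i, k))).
    exact: bounded_lipschitz_clamp.
  by apply: funext => y; rewrite mxE.
have Qdet := rc_det rc Qg.
have Qga i k : bounded_lipschitz (fun y => clamp_inv (metric_of (clamp_state y)) i k).
  rewrite (_ : (fun _ => _) = fun y => (Num.max (\det (metric_of (clamp_state y)) ^+ 2) eta)^-1
     * \det (metric_of (clamp_state y)) * (\adj (metric_of (clamp_state y))) i k).
    apply: (rc_mul rc); last exact: rc_adj.
    apply: (rc_mul rc) => //; apply: bounded_lipschitz_inv => //; exact: (rc_mul rc).
  by apply: funext => y; rewrite mxE.
have QH i k l : bounded_lipschitz (fun y => tor (form_of (clamp_state y)) i k l).
  apply: (rc_add rc); first exact: (rc_cst rc).
  by apply: rc_ext2 => // p q; exact: bounded_lipschitz_clamp.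
have Rg i k := rc_rhs_g rc c Qg Qga QH i k.
have Rb i k := rc_rhs_b rc c Qg Qga QH i k.
rewrite /clamped_field; case: j.1.1; apply: (rc_mul rc); try exact: (rc_cst rc).
  exact: (rc_add rc).
by apply: (rc_add rc) => //; exact: rc_opp.
Qed.

Lemma clamped_field_lipschitz : exists M L : R,
  [/\ 0 < L, forall y j, `|clamped_field y j| <= M
    & forall y z d, (forall i, `|y i - z i| <= d) ->
        forall j, `|clamped_field y j - clamped_field z j| <= L * d].
Proof.
have [B hB] := choice clamped_field_lipschitz1; have [L hL] := choice hB.
exists (\sum_j B j), (1 + \sum_j L j).
have B0 j : 0 <= B j by have [] := hL j.
have L0 j : 0 <= L j by have [] := hL j.
have sB j : B j <= \sum_j B j.
  by rewrite (bigD1 j) //= lerDl sumr_ge0.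
have sL j : L j <= \sum_j L j.
  by rewrite (bigD1 j) //= lerDl sumr_ge0.
split.
- by rewrite ltr_pwDl // sumr_ge0.
- by move=> y j; have [_ _ h _] := hL j; exact: le_trans (h y) (sB j).
move=> y z d yz j; have d0 : 0 <= d := le_trans (normr_ge0 _) (yz j).
have [_ _ _ h] := hL j; apply: le_trans (h y z d d0 yz) _.
by rewrite ler_wpM2r // (le_trans (sL j)) // lerDr.
Qed.

End ClampedField.

Section Bounds.
Context (R : realType) (n : nat).
Implicit Types (M : 'M[R]_n) (v : 'rV[R]_n).

Definition sqnorm v := \sum_i v 0 i ^+ 2.

Lemma sqnorm_ge0 v : 0 <= sqnorm v.
Proof. by apply: sumr_ge0 => i _; rewrite sqr_ge0. Qed.

Lemma sqnorm_gt0 v : v != 0 -> 0 < sqnorm v.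
Proof.
move=> v0; rewrite lt_neqAle sqnorm_ge0 andbT eq_sym; apply: contra v0.
rewrite psumr_eq0 => [/allP h|i _]; last exact: sqr_ge0.
apply/eqP/rowP => i; have := h i; rewrite mem_index_enum => /(_ isT) /=.
by rewrite sqrf_eq0 mxE => /eqP.
Qed.

Lemma sqnorm_ge v i : v 0 i ^+ 2 <= sqnorm v.
Proof. by rewrite /sqnorm (bigD1 i) //= lerDl sumr_ge0 // => j _; rewrite sqr_ge0. Qed.

Lemma mform_small M e v : (forall i j, `|M i j| <= e) ->
  `|mform M v v| <= e * n%:R * sqnorm v.
Proof.
move=> Me; apply: le_trans (ler_norm_sum _ _ _) _.
apply: (@le_trans _ _ (\sum_i \sum_j e * (2^-1 * (v 0 i ^+ 2 + v 0 j ^+ 2)))).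
  apply: ler_sum => i _; apply: le_trans (ler_norm_sum _ _ _) _.
  apply: ler_sum => j _; rewrite normrM; apply: ler_pM => //.
  have -> : v 0 i ^+ 2 = `|v 0 i| ^+ 2 by rewrite real_normK ?num_real.
  have -> : v 0 j ^+ 2 = `|v 0 j| ^+ 2 by rewrite real_normK ?num_real.
  rewrite normrM; have := sqr_ge0 (`|v 0 i| - `|v 0 j|).
  by rewrite sqrrB; lra.
have -> : \sum_i \sum_j e * (2^-1 * (v 0 i ^+ 2 + v 0 j ^+ 2)) =
    2^-1 * e * (\sum_(i < n) \sum_(j < n) v 0 i ^+ 2 + \sum_(i < n) \sum_(j < n) v 0 j ^+ 2).
  by rewrite sum2D sum2Z; apply: eq_sum2 => i j; ring.
rewrite [X in _ * (_ + X)]exchange_big /=.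
have -> : \sum_(i < n) \sum_(j < n) v 0 i ^+ 2 = n%:R * sqnorm v.
  rewrite mulr_sumr; apply: eq_bigr => i _.
  by rewrite sumr_const card_ord mulr_natl.
by rewrite le_eqVlt; apply/orP; left; apply/eqP; field.
Qed.

End Bounds.

(** * Existence and uniqueness for the flow in coordinates *)

Section Global.
Context (R : realType) (n : nat) (c : 'I_n -> 'I_n -> 'I_n -> R).
Variable H0 : 'I_n -> 'I_n -> 'I_n -> R.
Local Notation dv f t l := (is_derive (t : R) (1 : R) (f : R -> R) (l : R)).
Local Notation J := (bool * 'I_n * 'I_n)%type.
Hypothesis calt : alternating2 c.
Hypothesis cjac : jacobi c.
Hypothesis csolv : solvable_const c.
Hypothesis H0alt : alternating3 H0.
Hypothesis H0closed : closed3_const c H0.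
Local Notation tor := (torsion_const c H0).

Definition within_bounds (la K : R) (M : 'M[R]_n) (b : 'I_n -> 'I_n -> R) :=
  [/\ forall v, la * sqnorm v <= mform M v v, forall i j, `|M i j| <= K
    & forall i j, `|b i j| <= K].

(* A lower bound for the squared determinant of a metric that dominates [la]
   times the Euclidean one, from the Leibniz formula for its inverse. *)
Definition det_floor (la : R) : R := (#|{perm 'I_n}|%:R * la^-1 ^+ n) ^- 2.

Lemma within_posdef la K M b : 0 < la -> M^T = M -> within_bounds la K M b -> posdef M.
Proof.
move=> la0 MT [h _ _]; split=> // v v0; apply: lt_le_trans (h v).
by rewrite mulr_gt0 ?sqnorm_gt0.
Qed.

Lemma det_bound (A : 'M[R]_n) X : (forall i j, `|A i j| <= X) ->
  `|\det A| <= #|{perm 'I_n}|%:R * X ^+ n.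
Proof.
move=> AX; apply: le_trans (ler_norm_sum _ _ _) _.
rewrite mulr_natl -sumr_const; apply: ler_sum => s _.
rewrite normrM normrX normrN1 expr1n mul1r normr_prod.
apply: (@le_trans _ _ (\prod_(i < n) X)); last by rewrite prodr_const card_ord.
by apply: ler_prod => i _; rewrite normr_ge0 AX.
Qed.

Lemma within_det la K M b : 0 < la -> M^T = M -> within_bounds la K M b ->
  det_floor la <= \det M ^+ 2.
Proof.
move=> la0 MT wb; have pM := within_posdef la0 MT wb.
have uM := posdef_unit calt cjac csolv pM; have [h _ _] := wb.
(* For w the i-th row of the inverse, M(w, w) = w_i, so coercivity gives la |w|^2 <= w_i. This
   bounds w_i by 1/la, and then every entry of the row. *)
have inv_le i j : `|invmx M i j| <= la^-1.
  pose w : 'rV[R]_n := delta_mx 0 i *m invmx M.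
  have wE k : w 0 k = invmx M i k by rewrite /w -rowE mxE.
  have ww : mform M w w = w 0 i.
    rewrite mformE {1}/w mulmxKV // mxE -[RHS](sum_delta (fun k => w 0 k)).
    by apply: eq_bigr => k _; rewrite [w^T _ _]mxE.
  have hw := h w; rewrite ww in hw.
  have wi : w 0 i <= la^-1.
    have := le_trans (ler_wpM2l (ltW la0) (sqnorm_ge w i)) hw.
    have [wi0|wi0] := ltP 0 (w 0 i); last by move=> _; rewrite (le_trans wi0) // invr_ge0 ltW.
    by rewrite expr2 mulrA ger_pMl // -ler_pdivlMl // mulr1.
  have := le_trans (ler_wpM2l (ltW la0) (sqnorm_ge w j)) hw.
  move=> /le_trans/(_ wi); rewrite -ler_pdivlMl // -wE => w2.
  have li : 0 <= la^-1 by rewrite invr_ge0 ltW.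
  rewrite -ler_sqr ?nnegrE //.
  by rewrite real_normK ?num_real // [la^-1 ^+ 2]expr2.
have dd : \det M * \det (invmx M) = 1 by rewrite -det_mulmx mulmxV // det1.
have db := det_bound inv_le; set N := _ * _ in db.
have dI0 : \det (invmx M) != 0.
  by apply: contra_eq_neq dd => ->; rewrite mulr0 eq_sym oner_neq0.
have N0 : 0 < N by apply: lt_le_trans db; rewrite normr_gt0.
rewrite /det_floor -/N.
have -> : \det M ^+ 2 = (\det (invmx M) ^+ 2)^-1.
  by rewrite -[\det M]mulr1 -(divff dI0) mulrA dd mul1r exprVn.
have p1 : 0 < \det (invmx M) ^+ 2 by rewrite lt_neqAle sqr_ge0 eq_sym sqrf_eq0 dI0.
have p2 : 0 < N ^+ 2 by exact: exprn_gt0.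
rewrite lef_pV2 ?posrE //.
by rewrite -[X in X <= _]real_normK ?num_real // ler_sqr ?nnegrE ?(ltW N0).
Qed.

Lemma det_floor_gt0 la : 0 < la -> 0 < det_floor la.
Proof.
move=> la0; rewrite /det_floor invr_gt0 exprn_gt0 // mulr_gt0 ?exprn_gt0 ?invr_gt0 //.
by rewrite ltr0n; apply/card_gt0P; exists (1 : {perm 'I_n})%g.
Qed.

Lemma clamped_fieldE la K M b : 0 < la -> M^T = M -> antisym b ->
  within_bounds la K M b -> forall i j,
  clamped_field c H0 K (det_floor la) (pack M b) (true, i, j) =
    rhs_g c M (adj_inv M) (tor b) i j /\
  clamped_field c H0 K (det_floor la) (pack M b) (false, i, j) =
    rhs_b c M (adj_inv M) (tor b) i j.
Proof.
move=> la0 MT ba wb i j; have pM := within_posdef la0 MT wb.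
have uM := posdef_unit calt cjac csolv pM; have [_ hM hb] := wb.
have [m [P [onP _]]] := solvable_frame calt cjac csolv pM.
have cs : clamp_state K (pack M b) = pack M b.
  by apply: funext => -[[[] p] q]; apply: clamp_id; [exact: hM|exact: hb].
have mE : metric_of (clamp_state K (pack M b)) = M.
  by rewrite cs; apply/matrixP => p q; rewrite mxE.
have fE : form_of (clamp_state K (pack M b)) = b by rewrite cs.
have iE : clamp_inv (det_floor la) M = adj_inv M.
  have d0 : \det M != 0 by rewrite -unitfE -unitmxE.
  rewrite /clamp_inv max_l ?(within_det la0 MT wb) // /adj_inv; congr (_ *: _).
  by field.
have ta := torsion_alternating3 calt H0alt b.
rewrite /clamped_field /= mE fE iE adj_invE //; split.
  by rewrite (rhs_g_sym calt cjac onP _ j i); field.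
by rewrite (rhs_b_anti c M (invmx M) j i ta); field.
Qed.

Section Initial.
Variables (g0 : 'M[R]_n) (b0 : 'I_n -> 'I_n -> R).
Hypothesis pg0 : posdef g0.
Hypothesis ba0 : antisym b0.

(** [quadratic_bound] applied to the Euclidean form, whose components N are taken in a
    g0-orthonormal frame; no compactness of the sphere is involved. *)
Lemma coercive : exists2 la : R, 0 < la & forall v, la * sqnorm v <= mform g0 v v.
Proof.
have [m [P [onP _]]] := solvable_frame calt cjac csolv pg0.
pose N a b := mform 1%:M (row a P) (row b P).
pose C := 2^-1 * (1 + pairing N N).
have C0 : 0 < C by rewrite mulr_gt0 ?invr_gt0 ?ltr0n // ltr_pwDl // pairing_ge0.
exists C^-1; first by rewrite invr_gt0.
move=> v; rewrite mulrC ler_pdivrMr // mulrC.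
have -> : sqnorm v = mform 1%:M v v.
  by rewrite /mform (sum_delta2 (fun i j => v 0 i * v 0 j)).
rewrite (mform_frame onP); apply: le_trans (ler_norm _) _.
apply: le_trans (quadratic_bound _ _ _) _.
by rewrite -!(mform_gram onP) le_eqVlt; apply/orP; left; apply/eqP; rewrite /C; field.
Qed.

Variable tau : R.
Hypothesis tau0 : 0 <= tau.

Let G := growth c H0 tau g0 b0.
Let kap := expR G.
Let G0 : 0 <= G.
Proof.
rewrite /G /growth; have := energy_le0 H0 calt cjac csolv b0 pg0.
have h2 : 0 <= tau / 2 by rewrite divr_ge0.
by lra.
Qed.

(** One pair of constants serves every solution with this initial value up to time tau. The bounds
    leave a margin, 2 la against la and K - 1 against K, so that nearby states still satisfy
    [within_bounds la K]. *)
Lemma apriori : exists la K : R, [/\ 0 < la, 0 <= K,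
  within_bounds (2 * la) (K - 1) g0 b0
  & forall s g b t, s <= tau -> flow_on c H0 s g b -> g 0 = g0 -> b 0 = b0 ->
      0 <= t < s -> within_bounds (2 * la) (K - 1) (g t) (b t)].
Proof.
have [la0 la0p hla] := coercive.
pose tr := \sum_i g0 i i; pose sb := \sum_i \sum_j `|b0 i j|.
(* The metric contributes kap * tr, the initial form sb, the change of the form kap * tr * G; the 1
   is the margin. *)
pose K := 1 + kap * tr + sb + kap * tr * G.
have gii i : 0 <= g0 i i.
  have d0 : (delta_mx 0 i : 'rV[R]_n) != 0.
    by apply/eqP => /matrixP/(_ 0 i)/eqP; rewrite !mxE !eqxx oner_eq0.
  by rewrite -mform_delta ltW // pg0.2.
have trp : 0 <= tr by apply: sumr_ge0.
have gtr i : g0 i i <= tr by rewrite /tr (bigD1 i) //= lerDl sumr_ge0.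
have sbp : 0 <= sb by do 2![apply: sumr_ge0 => ? _]; rewrite normr_ge0.
have bsb i j : `|b0 i j| <= sb.
  rewrite /sb (bigD1 i) //= (bigD1 j) //= -addrA lerDl addr_ge0 //; last first.
    by do 2![apply: sumr_ge0 => ? _]; rewrite normr_ge0.
  by apply: sumr_ge0 => ? _; rewrite normr_ge0.
have kp : 0 < kap by exact: expR_gt0.
have kp1 : 1 <= kap by rewrite -expR0 ler_expR.
have ktr : 0 <= kap * tr by rewrite mulr_ge0 // ltW.
(* Evaluate the form on the sum and the difference of two basis vectors. *)
have offdiag (M : 'M[R]_n) i j : posdef M -> `|M i j| <= 2^-1 * (M i i + M j j).
  move=> pM; have q v : 0 <= mform M v v.
    have [->|v0] := eqVneq v 0; last by rewrite ltW // pM.2.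
    by rewrite /mform big1 // => k _; rewrite big1 // => l _; rewrite !mxE mulr0 mulr0.
  have E (a : R) : mform M (delta_mx 0 i + a *: delta_mx 0 j)
      (delta_mx 0 i + a *: delta_mx 0 j) = M i i + a * M i j + a * M j i + a ^+ 2 * M j j.
    have mxD (A B : 'M[R]_1) : (A + B) 0 0 = A 0 0 + B 0 0 by rewrite mxE.
    have mxZ x (A : 'M[R]_1) : (x *: A) 0 0 = x * A 0 0 by rewrite mxE.
    rewrite mformE linearD linearZ /= !mulmxDl !mulmxDr -!scalemxAl -!scalemxAr.
    by rewrite !mxD !mxZ -!mformE !mform_delta; ring.
  have := q (delta_mx 0 i + 1 *: delta_mx 0 j); have := q (delta_mx 0 i + -1 *: delta_mx 0 j).
  rewrite !E; have -> : M j i = M i j by rewrite -[in LHS]pM.1 mxE.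
  by move=> h1 h2; rewrite ler_norml; lra.
have la1 : 0 < expR (- G) * la0 / 2 by rewrite divr_gt0 // mulr_gt0 // expR_gt0.
exists (expR (- G) * la0 / 2), K; split=> //.
- by rewrite /K !addr_ge0 // mulr_ge0.
- split.
  + move=> v; apply: le_trans (hla v); rewrite ler_wpM2r ?sqnorm_ge0 //.
    have eG : expR (- G) <= 1 by rewrite -expR0 ler_expR oppr_le0.
    by rewrite (_ : 2 * _ = expR (- G) * la0) ?ger_pMl //; field.
  + move=> i j; apply: le_trans (offdiag _ i j pg0) _.
    have : tr <= kap * tr by rewrite ler_peMl.
    have : 0 <= kap * tr * G by rewrite mulr_ge0.
    by have := gtr i; have := gtr j; rewrite /K; lra.
  + move=> i j; apply: le_trans (bsb i j) _.
    have : 0 <= kap * tr * G by rewrite mulr_ge0.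
    by rewrite /K; lra.
move=> s g b t s_tau fl g00 b00 ts.
have gs : growth c H0 s g0 b0 <= G by rewrite /G /growth; lra.
have [pg ba _ _] := fl t ts.
have gs0 : 0 <= growth c H0 s g0 b0.
  have s0 : 0 <= s by have /andP[t0 /ltW] := ts; exact: le_trans.
  rewrite /growth; have := energy_le0 H0 calt cjac csolv b0 pg0.
  have h2 : 0 <= s / 2 by rewrite divr_ge0.
  by lra.
have met v := flow_on_metric calt cjac csolv H0alt H0closed fl v ts.
rewrite g00 b00 in met.
have up v : mform (g t) v v <= kap * mform g0 v v.
  apply: le_trans (met v).1 _; rewrite ler_wpM2r ?ler_expR //.
  by apply: le_trans (hla v); rewrite mulr_ge0 ?sqnorm_ge0 // ltW.
split.
- move=> v; apply: le_trans (met v).2.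
  apply: (@le_trans _ _ (expR (- G) * mform g0 v v)).
    rewrite (_ : 2 * _ * _ = expR (- G) * (la0 * sqnorm v)) ?ler_wpM2l ?expR_ge0 //.
    by field.
  rewrite ler_wpM2r ?ler_expR //; last by lra.
  by apply: le_trans (hla v); rewrite mulr_ge0 ?sqnorm_ge0 // ltW.
- move=> i j; apply: le_trans (offdiag _ i j pg) _.
  have h k : g t k k <= kap * tr.
    have := up (delta_mx 0 k); rewrite !mform_delta => /le_trans; apply.
    by rewrite ler_wpM2l // ltW.
  have : 0 <= kap * tr * G by rewrite mulr_ge0.
  by have := h i; have := h j; rewrite /K; lra.
move=> i j; have := flow_on_form calt cjac csolv H0alt H0closed fl i j ts.
rewrite g00 b00 => h; rewrite -[b t i j](subrK (b0 i j)).
apply: le_trans (ler_normD _ _) _.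
have : `|b t i j - b0 i j| <= kap * tr * G.
  apply: le_trans h _; apply: ler_pM => //.
    by rewrite mulr_ge0 ?expR_ge0 // mulr_ge0 ?invr_ge0 ?ler0n // addr_ge0.
  apply: ler_pM; rewrite ?expR_ge0 ?ler_expR //.
    by rewrite mulr_ge0 ?invr_ge0 ?ler0n // addr_ge0.
  by have := gtr i; have := gtr j; lra.
by have := bsb i j; rewrite /K; lra.
Qed.

End Initial.

Lemma within_near la K (M : 'M[R]_n) b (M' : 'M[R]_n) b' (e : R) : e <= 1 -> e * n%:R <= la ->
  within_bounds (2 * la) (K - 1) M b ->
  (forall i j, `|M' i j - M i j| <= e) -> (forall i j, `|b' i j - b i j| <= e) ->
  within_bounds la K M' b'.
Proof.
move=> e1 en [h hM hb] dM db; split=> [v|i j|i j].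
- have -> : mform M' v v = mform M v v + mform (M' - M) v v.
    by rewrite /mform sum2D; apply: eq_sum2 => i j; rewrite !mxE; ring.
  have := @mform_small _ _ (M' - M) e v; rewrite ler_norml => sm.
  have /andP[lo _] : - (e * n%:R * sqnorm v) <= mform (M' - M) v v <= e * n%:R * sqnorm v.
    by apply: sm => i j; rewrite !mxE.
  have : e * n%:R * sqnorm v <= la * sqnorm v by rewrite ler_wpM2r ?sqnorm_ge0.
  by have := h v; rewrite -mulrA; lra.
- rewrite -[M' i j](subrK (M i j)); apply: le_trans (ler_normD _ _) _.
  by have := dM i j; have := hM i j; lra.
- rewrite -[b' i j](subrK (b i j)); apply: le_trans (ler_normD _ _) _.
  by have := db i j; have := hb i j; lra.
Qed.

Lemma within_weaken la K M b : 0 < la -> within_bounds (2 * la) (K - 1) M b ->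
  within_bounds la K M b.
Proof.
move=> la0 w; apply: (within_near (e := 0) _ _ w) => //.
- by rewrite mul0r ltW.
- by move=> i j; rewrite subrr normr0.
- by move=> i j; rewrite subrr normr0.
Qed.

Lemma packE (y : J -> R) : pack (metric_of y) (form_of y) = y.
Proof. by apply: funext => -[[[] i] j]; rewrite /pack /= ?mxE. Qed.

Lemma flow_exists g0 b0 tau : posdef g0 -> antisym b0 -> 0 <= tau ->
  exists g b, [/\ g 0 = g0, b 0 = b0 & flow_on c H0 tau g b].
Proof.
move=> pg0 ba0 tau0; have [la [K [la0 K0 wb0 ap]]] := apriori b0 pg0 tau0.
pose f := clamped_field c H0 K (det_floor la).
have [Mb [L [L0 fM fL]]] := clamped_field_lipschitz c H0 K0 (det_floor_gt0 la0).
have [w [w0 dw]] := picard (pack g0 b0) L0 fM fL.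
have {}dw t j : 0 <= t -> dv (w^~ j) t (f (w t) j).
  move=> t0; have := dw t j; rewrite max_l //; apply.
  by rewrite (lt_le_trans _ t0) // ltrN10.
pose g t := metric_of (w t); pose b t := form_of (w t).
have g00 : g 0 = g0 by apply/matrixP => i j; rewrite mxE w0.
have b00 : b 0 = b0 by apply: funext => i; apply: funext => j; rewrite /b /form_of w0.
have wlip s t j : 0 <= s -> s <= t -> `|w t j - w s j| <= `|Mb| * (t - s).
  move=> s0 st.
  have d1 x : s <= x <= t -> dv (w^~ j) x (f (w x) j).
    by move=> /andP[sx _]; apply: dw; exact: le_trans sx.
  have := dv_abs_le st d1 (fun x _ => dvZ `|Mb| (is_derive_id x 1)).
  rewrite -mulrBr; apply => x _; rewrite mulr1.
  exact: le_trans (fM _ _) (ler_norm _).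
have gsym t : 0 <= t -> (g t)^T = g t.
  move=> t0; apply/matrixP => i j; rewrite !mxE.
  have d1 x : 0 <= x <= t -> dv (fun r => w r (true, j, i) - w r (true, i, j)) x
      (f (w x) (true, j, i) - f (w x) (true, i, j)).
    by move=> /andP[x0 _]; apply: dvB; apply: dw.
  have := dv_abs_le t0 d1 (fun x _ => dv_cst 0 x).
  have E0 : w 0 (true, j, i) = w 0 (true, i, j).
    by rewrite !w0 /pack /= -[in LHS]pg0.1 mxE.
  rewrite E0 !subrr subr0 normr_le0 subr_eq0 => H; apply/eqP/H => x _.
  by rewrite /f /clamped_field /= [X in _ - _ * X]addrC subrr normr0.
have banti t : 0 <= t -> antisym (b t).
  move=> t0 i j; rewrite /b /form_of.
  have d1 x : 0 <= x <= t -> dv (fun r => w r (false, i, j) + w r (false, j, i)) x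
      (f (w x) (false, i, j) + f (w x) (false, j, i)).
    by move=> /andP[x0 _]; apply: dvD; apply: dw.
  have := dv_abs_le t0 d1 (fun x _ => dv_cst 0 x).
  have E0 : w 0 (false, i, j) + w 0 (false, j, i) = 0.
    by rewrite !w0 /pack /= (ba0 i j) addNr.
  rewrite E0 subrr subr0 normr_le0 addr_eq0 => H; apply/eqP/H => x _.
  by rewrite /f /clamped_field /= -mulrDr addrC subrKA subrr mulr0 normr0.
pose good r := within_bounds la K (g r) (b r).
have good_flow s : (forall r, 0 <= r < s -> good r) -> flow_on c H0 s g b.
  move=> gd t ts; have t0 : 0 <= t by have /andP[] := ts.
  have wb := gd t ts; split.
  - exact: within_posdef la0 (gsym t t0) wb.
  - exact: banti.
  - move=> i j; have [<- _] := clamped_fieldE la0 (gsym t t0) (banti t t0) wb i j.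
    rewrite packE (_ : (fun _ => _) = w^~ (true, i, j)); first exact: dw.
    by apply: funext => r; rewrite mxE.
  - move=> i j; have [_ <-] := clamped_fieldE la0 (gsym t t0) (banti t t0) wb i j.
    by rewrite packE; exact: dw.
pose e := Num.min 1 (la / (n%:R + 1)).
have n1 : 0 < n%:R + 1 :> R by rewrite ltr_wpDl // ler0n.
have e0 : 0 < e by rewrite lt_min ltr01 divr_gt0.
have e1 : e <= 1 by rewrite ge_min lexx.
have en : e * n%:R <= la.
  apply: (@le_trans _ _ (la / (n%:R + 1) * (n%:R + 1))); last by rewrite divfK ?gt_eqF.
  apply: ler_pM; [exact: ltW|exact: ler0n| |by rewrite lerDl].
  by rewrite ge_min lexx orbT.
(* At speed at most |Mb| + 1, a solution moves by at most e during a time 2 del, and e is what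
   [within_near] tolerates. *)
pose del := e / (2 * (`|Mb| + 1)).
have M1 : 0 < `|Mb| + 1 by rewrite ltr_wpDl.
have del0 : 0 < del by rewrite divr_gt0 // mulr_gt0.
have near_good t r : 0 <= t -> t <= r -> r - t <= 2 * del ->
    within_bounds (2 * la) (K - 1) (g t) (b t) -> good r.
  move=> t0 tr rt wt.
  have D j : `|w r j - w t j| <= e.
    apply: le_trans (wlip t r j t0 tr) _.
    apply: (@le_trans _ _ ((`|Mb| + 1) * (2 * del))).
      by apply: ler_pM; [exact: normr_ge0|rewrite subr_ge0|rewrite lerDl ler01|exact: rt].
    by rewrite /del le_eqVlt; apply/orP; left; apply/eqP; field; rewrite gt_eqF.
  by apply: (within_near e1 en wt) => i j; rewrite ?mxE; exact: D.
(* Good times extend by steps of length del: at the start of the previous step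
   the a priori estimate leaves a margin that the solution cannot use up in
   time 2 del. *)
have claim k r : 0 <= r -> r <= k%:R * del -> r < tau -> good r.
  elim: k r => [|k IH] r r0 rk rt.
    apply: (near_good 0) => //; last by rewrite g00 b00.
    by rewrite subr0; apply: le_trans rk _; rewrite mul0r mulr_ge0 // ltW.
  have [/IH|kr] := leP r (k%:R * del); first exact.
  (* Up to time del the initial value itself supplies the margin. Later on the a priori estimate is
     available only strictly before k.+1 * del, so one starts at k * del and has to cover a time of
     length 2 del. *)
  case: k IH rk kr => [|k] IH rk kr.
    apply: (near_good 0) => //; last by rewrite g00 b00.
    by rewrite subr0; apply: le_trans rk _; rewrite ler_wpM2r ?ler_nat // ltW.
  have fl : flow_on c H0 (k.+1%:R * del) g b.
    apply: good_flow => x /andP[x0 xk]; apply: IH => //; first exact: ltW.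
    by apply: lt_trans rt; exact: lt_trans kr.
  apply: (near_good (k%:R * del)).
  - by rewrite mulr_ge0 ?ler0n // ltW.
  - by apply: le_trans (ltW kr); rewrite ler_wpM2r ?ler_nat // ltW.
  - by rewrite lerBlDr; apply: le_trans rk _; rewrite -mulrDl -natrD add2n.
  apply: (ap _ g b _ _ fl) => //; first by apply: ltW; exact: lt_trans rt.
  rewrite mulr_ge0 ?ler0n ?(ltW del0) //= ltr_pM2r // ltr_nat //.
exists g, b; split=> //; apply: good_flow => r /andP[r0 rt].
apply: (claim (Num.bound (r / del))) => //.
rewrite -ler_pdivrMr // ltW //; apply: archi_boundP.
by rewrite divr_ge0 // ltW.
Qed.

(** By [apriori] both solutions obey the same bounds, hence solve the same Lipschitz cut-off
    equation. The squared distance w satisfies w' <= 2 L N w, where N is the number of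
    components. *)
Lemma flow_unique s g1 b1 g2 b2 : flow_on c H0 s g1 b1 -> flow_on c H0 s g2 b2 ->
  g1 0 = g2 0 -> b1 0 = b2 0 ->
  forall t, 0 <= t < s -> g1 t = g2 t /\ b1 t = b2 t.
Proof.
move=> f1 f2 g12 b12 t ts; have /andP[t0 t_s] := ts.
have s0 : 0 <= s by apply: ltW; exact: le_lt_trans t_s.
have z0 : 0 <= (0 : R) < s by apply/andP; split; [|exact: le_lt_trans t_s].
have [pg0 ba0 _ _] := f1 0 z0.
have [la [K [la0 K0 _ ap]]] := apriori (b1 0) pg0 s0.
have [Mb [L [L0 _ fL]]] := clamped_field_lipschitz c H0 K0 (det_floor_gt0 la0).
pose f := clamped_field c H0 K (det_floor la); rewrite -/f in fL.
pose y1 r := pack (g1 r) (b1 r); pose y2 r := pack (g2 r) (b2 r).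
have ode g b : flow_on c H0 s g b -> g 0 = g1 0 -> b 0 = b1 0 ->
    forall r j, 0 <= r <= t -> dv (fun x => pack (g x) (b x) j) r (f (pack (g r) (b r)) j).
  move=> fl gg bb r [[[] i] j] /andP[r0 rt]; have rs : 0 <= r < s by rewrite r0 (le_lt_trans rt).
    have [pg ba dg _] := fl r rs.
    have wb := within_weaken la0 (ap s g b r (lexx _) fl gg bb rs).
    by rewrite /f (clamped_fieldE la0 pg.1 ba wb i j).1; exact: dg.
  have [pg ba _ db] := fl r rs.
  have wb := within_weaken la0 (ap s g b r (lexx _) fl gg bb rs).
  by rewrite /f (clamped_fieldE la0 pg.1 ba wb i j).2; exact: db.
pose w r := \sum_j (y1 r j - y2 r j) * (y1 r j - y2 r j).
pose D r j := f (y1 r) j - f (y2 r) j.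
have dw r : 0 <= r <= t -> dv w r (\sum_j (D r j * (y1 r j - y2 r j)
    + (y1 r j - y2 r j) * D r j)).
  move=> rt; apply: dv_sum => j.
  have d1 := dvB (ode g1 b1 f1 erefl erefl r j rt) (ode g2 b2 f2 (esym g12) (esym b12) r j rt).
  exact: (dvM d1 d1).
have wt : w t <= 0.
  apply: (gronwall (C := 2 * L * #|{: J}|%:R) t0 dw); last first.
    by rewrite /w big1 // => j _; rewrite /y1 /y2 g12 b12 subrr mulr0.
  move=> r rt; set z := fun j => y1 r j - y2 r j.
  have zs j : `|z j| <= \sum_j `|z j| by rewrite (bigD1 j) //= lerDl sumr_ge0.
  have DL j : `|D r j| <= L * \sum_j `|z j| by apply: fL.
  apply: (@le_trans _ _ (\sum_j \sum_k 2 * L * (`|z j| * `|z k|))).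
    apply: ler_sum => j _; apply: le_trans (ler_norm _) _.
    rewrite (_ : _ + _ = 2 * (D r j * z j)); last by rewrite /z; ring.
    rewrite !normrM ger0_norm // -!mulr_sumr -!mulrA ler_pM2l //.
    by rewrite mulrCA [X in X <= _]mulrC ler_wpM2l //; apply: DL.
  apply: (@le_trans _ _ (\sum_j \sum_k L * (z j * z j + z k * z k))).
    apply: ler_sum => j _; apply: ler_sum => k _.
    rewrite [2 * L]mulrC -mulrA ler_pM2l //.
    have -> : z j * z j = `|z j| ^+ 2 by rewrite real_normK ?num_real // expr2.
    have -> : z k * z k = `|z k| ^+ 2 by rewrite real_normK ?num_real // expr2.
    by have := sqr_ge0 (`|z j| - `|z k|); rewrite sqrrB; lra.
  rewrite -sum2Z -sum2D [X in _ * (_ + X) <= _](_ : _ = #|{: J}|%:R * w r).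
    rewrite [X in _ * (X + _) <= _](_ : _ = #|{: J}|%:R * w r); first by lra.
    rewrite mulr_sumr; apply: eq_bigr => j _.
    by rewrite sumr_const [RHS]mulr_natl.
  rewrite exchange_big mulr_sumr; apply: eq_bigr => j _.
  by rewrite sumr_const [RHS]mulr_natl.
have y12 j : y1 t j = y2 t j.
  apply/eqP; rewrite -subr_eq0 -sqrf_eq0 eq_le sqr_ge0 andbT; apply: le_trans wt.
  by rewrite /w (bigD1 j) //= expr2 lerDl sumr_ge0 // => k _; rewrite -expr2 sqr_ge0.
split; first by apply/matrixP => i j; exact: (y12 (true, i, j)).
by apply: funext => i; apply: funext => j; exact: (y12 (false, i, j)).
Qed.

Lemma flow_onS s s' g b : s' <= s -> flow_on c H0 s g b -> flow_on c H0 s' g b.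
Proof.
by move=> ss fl t /andP[t0 ts]; apply: fl; rewrite t0 (lt_le_trans ts).
Qed.

(** Solutions on all intervals [0, s) are chosen independently and glued by uniqueness. The glued
    curve must agree with a single solution near each time, not only at that time, for derivatives
    to carry over. *)
Lemma flow_global g0 b0 : posdef g0 -> antisym b0 ->
  exists g b, [/\ g 0 = g0, b 0 = b0 & forall s, flow_on c H0 s g b].
Proof.
move=> pg0 ba0.
have H (s : R) : exists gb : (R -> 'M[R]_n) * (R -> 'I_n -> 'I_n -> R),
    0 <= s -> [/\ gb.1 0 = g0, gb.2 0 = b0 & flow_on c H0 s gb.1 gb.2].
  have [s0|s0] := leP 0 s; last by exists (fun=> g0, fun=> b0).
  by have [g [b h]] := flow_exists pg0 ba0 s0; exists (g, b).
have [gb hgb] := choice H.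
have pos1 (r : R) : 0 <= Num.max r 0 + 1 by rewrite addr_ge0 // le_max lexx orbT.
(* The time r only looks at the solution on [0, r + 1). *)
pose g (r : R) := (gb (Num.max r 0 + 1)).1 r; pose b (r : R) := (gb (Num.max r 0 + 1)).2 r.
have glue (t : R) : 0 <= t -> \forall r \near t,
    (gb (t + 1)).1 r = g r /\ (gb (t + 1)).2 r = b r.
  move=> t0.
  have key (r : R) : 0 <= r -> r < t + 1 -> (gb (t + 1)).1 r = g r /\ (gb (t + 1)).2 r = b r.
    move=> r0 rt; rewrite /g /b.
    have [g1 b1 f1] := hgb _ (addr_ge0 t0 ler01); have [g2 b2 f2] := hgb _ (pos1 r).
    apply: (@flow_unique (Num.min (t + 1) (Num.max r 0 + 1))).
    - by apply: flow_onS f1; rewrite ge_min lexx.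
    - by apply: flow_onS f2; rewrite ge_min lexx orbT.
    - by rewrite g1 g2.
    - by rewrite b1 b2.
    by rewrite r0 lt_min rt max_l // ltrDl ltr01.
  have [t1|tz] : 0 < t \/ t = 0 by move: t0; rewrite le_eqVlt => /orP[/eqP|]; [right|left].
    near=> r; apply: key; first by apply: ltW; near: r; exact: lt_nbhsr.
    by near: r; apply: lt_nbhsl; rewrite ltrDl ltr01.
  near=> r; have [r0|r0] := leP 0 r.
    by apply: key => //; near: r; apply: lt_nbhsl; rewrite ltrDl ltr01.
  (* Before time 0 the glued curve is by definition the solution chosen for s = 1, which is the one
     used at t = 0. *)
  by rewrite /g /b max_r ?ltW // tz.
have z0 : Num.max (0 : R) 0 = 0 by rewrite maxxx.
have [gi bi _] := hgb _ (pos1 0).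
exists g, b; split=> // s t /andP[t0 _].
have [_ _ fl] := hgb _ (addr_ge0 t0 ler01).
have tt : 0 <= t < t + 1 by rewrite t0 ltrDl ltr01.
have [pg ba dg db] := fl t tt.
have ne := glue t t0; have [ge be] := nbhs_singleton ne.
rewrite -ge -be; split=> // i j.
- by apply: near_eq_is_derive (dg i j); apply: filterS ne => r [-> _].
- by apply: near_eq_is_derive (db i j); apply: filterS ne => r [_ ->].
Unshelve. all: by end_near. Qed.

End Global.

(** * From Lie groups to structure constants *)

Section CkClosure.
Context (R : realType) (d : nat) (U : set 'rV[R]_d).
Hypothesis oU : open U.

Lemma Ck_cst k (a : R) : Ck k U (fun=> a).
Proof.
elim: k a => [|k IH] a; first by split=> // x _; exact: cst_continuous.
split; first by move=> x _; exact: cst_continuous.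
move=> i; split; first by move=> x _; exact: derivable_cst.
have -> : (fun x : 'rV[R]_d => 'D_(delta_mx 0 i) (fun=> a) x) = fun=> 0 :> R.
  by apply: funext => x; exact: derive_cst.
exact: IH.
Qed.

Lemma Ck_ext k (f g : 'rV[R]_d -> R) :
  (forall x, U x -> f x = g x) -> Ck k U f -> Ck k U g.
Proof.
have nU x : U x -> \forall y \near x, U y by move=> Ux; exact: open_nbhs_nbhs.
elim: k f g => [|k IH] f g fg [cf df]; split=> //.
- move=> x Ux; have fgx : \near x, f x = g x by apply: filterS (nU x Ux).
  rewrite /prop_for /continuous_at -(fg x Ux).
  exact: cvg_trans (near_eq_cvg fgx) (cf x Ux).
- move=> x Ux; have fgx : \near x, f x = g x by apply: filterS (nU x Ux).
  rewrite /prop_for /continuous_at -(fg x Ux).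
  exact: cvg_trans (near_eq_cvg fgx) (cf x Ux).
move=> i; have [d1 d2] := df i; split.
  move=> x Ux; have fgx : \near x, f x = g x by apply: filterS (nU x Ux).
  exact: near_eq_derivable fgx (d1 x Ux).
apply: IH d2 => x Ux; have fgx : \near x, f x = g x by apply: filterS (nU x Ux).
exact: near_eq_derive.
Qed.

Lemma Ck_lin k (a : R) (f g : 'rV[R]_d -> R) :
  Ck k U f -> Ck k U g -> Ck k U (fun x => a * f x + g x).
Proof.
elim: k f g => [|k IH] f g [cf df] [cg dg]; split=> //.
- move=> x Ux; by apply: cvgD (cg x Ux); apply: cvgM (cf x Ux); exact: cvg_cst.
- move=> x Ux; by apply: cvgD (cg x Ux); apply: cvgM (cf x Ux); exact: cvg_cst.
move=> i; have [f1 f2] := df i; have [g1 g2] := dg i; split.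
  by move=> x Ux; apply: derivableD; [apply: derivableZ; exact: f1|exact: g1].
apply: Ck_ext (IH _ _ f2 g2) => x Ux; apply/esym.
have := @deriveD _ _ _ (a \*: f) g x (delta_mx 0 i) (derivableZ (f1 x Ux)) (g1 x Ux).
by rewrite deriveZ //; exact: f1.
Qed.

End CkClosure.

(** * The Lie algebra of G in coordinates *)

Section LeftInvariantFields.
Context (R : realType) (n : nat) (G : lieGroupType R n).
Implicit Types (f h : G -> R) (X Y : (G -> R) -> G -> R).

Lemma smooth_cst (a : R) : smooth (fun _ : G => a).
Proof. by move=> u _ k; exact: Ck_cst. Qed.

Lemma smooth_lin (a : R) f h : smooth f -> smooth h -> smooth (fun p => a * f p + h p).
Proof.
move=> sf sh u au k; apply: Ck_lin; [by have [] := atlas_chart u au|exact: sf|exact: sh].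
Qed.

Lemma smooth_sum (J : Type) (r : seq J) (a : J -> R) (f : J -> G -> R) :
  (forall j, smooth (f j)) -> smooth (fun p => \sum_(j <- r) a j * f j p).
Proof.
move=> sf; elim: r => [|j r IH].
  rewrite (_ : (fun p => _) = fun=> 0); first exact: smooth_cst.
  by apply: funext => p; rewrite big_nil.
rewrite (_ : (fun p => _) = fun p => a j * f j p + \sum_(j <- r) a j * f j p).
  exact: smooth_lin.
by apply: funext => p; rewrite big_cons.
Qed.

Lemma vf_cst X (a : R) p : vector_field X -> X (fun=> a) p = 0.
Proof.
move=> vX; have s0 := smooth_cst 0; have s1 := smooth_cst 1.
have X0 : X (fun=> 0) p = 0.
  have := vf_linear vX 1 s0 s0 p.
  rewrite (_ : (fun q => 1 * 0 + 0) = fun=> 0); last by apply: funext => q; rewrite mul1r addr0.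
  by move=> e; lra.
have X1 : X (fun=> 1) p = 0.
  have := vf_leibniz vX s1 s1 p.
  rewrite (_ : (fun q => 1 * 1) = fun=> 1); last by apply: funext => q; rewrite mul1r.
  by move=> e; lra.
transitivity (X (fun q => a * 1 + 0) p).
  by congr (X _ p); apply: funext => q; rewrite mulr1 addr0.
by rewrite (vf_linear vX a s1 s0) X0 X1; ring.
Qed.

Lemma vf_sum X (J : Type) (r : seq J) (a : J -> R) (f : J -> G -> R) p :
  vector_field X -> (forall j, smooth (f j)) ->
  X (fun q => \sum_(j <- r) a j * f j q) p = \sum_(j <- r) a j * X (f j) p.
Proof.
move=> vX sf; elim: r => [|j r IH].
  rewrite big_nil; transitivity (X (fun=> 0) p); last exact: vf_cst.
  by congr (X _ p); apply: funext => q; rewrite big_nil.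
rewrite big_cons -IH -vf_linear //; last exact: smooth_sum.
by congr (X _ p); apply: funext => q; rewrite big_cons.
Qed.

Variables (E : 'I_n -> (G -> R) -> (G -> R)) (c : 'I_n -> 'I_n -> 'I_n -> R).
Hypothesis hE : lie_alg_basis E.
Hypothesis hc : structure_constants E c.

Let vE i : vector_field (E i). Proof. exact: (hE.1 i).1. Qed.

Definition field_of (v : 'rV[R]_n) : (G -> R) -> (G -> R) :=
  fun f p => \sum_i v 0 i * E i f p.

Lemma lie_alg_field_of v : lie_alg (field_of v).
Proof.
split; first split.
- by move=> f sf; apply: smooth_sum => j; exact: vf_smooth.
- move=> a f h sf sh p; rewrite /field_of mulr_sumr -big_split /=; apply: eq_bigr => i _.
  by rewrite (vf_linear (vE i)) //; ring.
- move=> f h sf sh p; rewrite /field_of mulr_suml mulr_sumr -big_split /=.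
  by apply: eq_bigr => i _; rewrite (vf_leibniz (vE i)) //; ring.
by move=> a f sf p; apply: eq_bigr => i _; rewrite ((hE.1 i).2 a f sf p).
Qed.

Lemma field_of_eq0 v : vf_eq (field_of v) (fun _ _ => 0) -> v = 0.
Proof.
move=> v0; have [w [_ wu]] := hE.2 _ (lie_alg_field_of v).
rewrite -(wu v) //; apply: wu => f sf p; rewrite v0 //.
by rewrite big1 // => i _; rewrite mxE mul0r.
Qed.

Lemma structure_alternating : alternating2 c.
Proof.
move=> i j k; apply/eqP; rewrite -addr_eq0; apply/eqP.
suff /matrixP/(_ 0 k) : \row_k (c i j k + c j i k) = 0 :> 'rV[R]_n by rewrite !mxE.
apply: field_of_eq0 => f sf p.
transitivity (vf_bracket (E i) (E j) f p + vf_bracket (E j) (E i) f p).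
  by rewrite !hc // -big_split /=; apply: eq_bigr => l _; rewrite mxE mulrDl.
by rewrite /vf_bracket; ring.
Qed.

(** The cyclic sum of double commutators of derivations vanishes identically; uniqueness of
    components in the basis turns this into an identity for c. *)
Lemma structure_jacobi : jacobi c.
Proof.
move=> i j k m; pose Jv : 'rV[R]_n := \row_m
  \sum_l (c i j l * c l k m + c j k l * c l i m + c k i l * c l j m).
suff /matrixP/(_ 0 m) : Jv = 0 by rewrite !mxE.
apply: field_of_eq0 => f sf p.
have T a b d : \sum_l c a b l * vf_bracket (E l) (E d) f p =
    E a (E b (E d f)) p - E b (E a (E d f)) p - E d (E a (E b f)) p + E d (E b (E a f)) p.
  have sE q : smooth (E q f) by exact: vf_smooth.
  have sEE q r : smooth (E q (E r f)) by exact: vf_smooth.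
  rewrite (eq_bigr (fun l => c a b l * E l (E d f) p - c a b l * E d (E l f) p)); last first.
    by move=> l _; rewrite /vf_bracket mulrBr.
  rewrite sumrB -(hc a b (sE d)) -(vf_sum _ _ p (vE d) sE).
  have -> : (fun q => \sum_l c a b l * E l f q) =
      (fun q => -1 * E b (E a f) q + E a (E b f) q).
    by apply: funext => q; rewrite -(hc a b sf) /vf_bracket; ring.
  by rewrite (vf_linear (vE d)) // /vf_bracket; ring.
transitivity (\sum_l c i j l * vf_bracket (E l) (E k) f p
  + \sum_l c j k l * vf_bracket (E l) (E i) f p
  + \sum_l c k i l * vf_bracket (E l) (E j) f p); last by rewrite !T; ring.
rewrite /field_of -!big_split /=.
transitivity (\sum_m \sum_l (c i j l * c l k m + c j k l * c l i m + c k i l * c l j m) * E m f p).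
  by apply: eq_bigr => q _; rewrite mxE mulr_suml.
rewrite exchange_big; apply: eq_bigr => l _ /=.
rewrite !hc // !mulr_sumr -!big_split /=; apply: eq_bigr => q _; ring.
Qed.

Lemma bracket_field_of v w :
  vf_eq (vf_bracket (field_of v) (field_of w)) (field_of (bil c v w)).
Proof.
move=> f sf p; have sE q : smooth (E q f) by exact: vf_smooth.
have T v' w' : field_of v' (field_of w' f) p =
    \sum_i \sum_j v' 0 i * w' 0 j * E i (E j f) p.
  apply: eq_bigr => i _; rewrite (vf_sum _ _ p (vE i) sE) mulr_sumr.
  by apply: eq_bigr => j _; rewrite mulrA.
rewrite /vf_bracket !T [X in _ - X]exchange_big -sumrB.
rewrite /field_of; under [RHS]eq_bigr do rewrite mxE mulr_suml.
rewrite [RHS]exchange_big; apply: eq_bigr => i _ /=.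
under [RHS]eq_bigr do rewrite mulr_suml.
rewrite [RHS]exchange_big -sumrB; apply: eq_bigr => j _ /=.
transitivity (v 0 i * w 0 j * vf_bracket (E i) (E j) f p).
  by rewrite /vf_bracket; ring.
by rewrite hc // mulr_sumr; apply: eq_bigr => k _; rewrite mulrA.
Qed.

(** This inclusion of the matrix flag in the derived series transfers solvability: when the series
    reaches zero, [field_of_eq0] forces the flag to vanish. *)
Lemma field_of_derived k v : (v <= derived_flag c k)%MS ->
  iter k (@derived_alg R n G) (@lie_alg R n G) (field_of v).
Proof.
elim: k v => [|k IH] v vk; first exact: lie_alg_field_of.
split; first exact: lie_alg_field_of.
have [u uE] := derived_mxP vk; set A := derived_flag c k in IH uE.
(* [derived_alg] asks for a plain sum of brackets over an ordinal, so pairs of indices are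
   enumerated and the coefficients are absorbed into the first factors. *)
pose ix (a : 'I_#|{: 'I_n * 'I_n}|) := enum_val a : 'I_n * 'I_n.
exists #|{: 'I_n * 'I_n}|, (fun a => field_of (u (ix a).1 (ix a).2 *: row (ix a).1 A)),
  (fun a => field_of (row (ix a).2 A)); split.
  move=> a; split; apply: IH; last exact: row_sub.
  by apply: scalemx_sub; exact: row_sub.
move=> f sf p.
rewrite (eq_bigr (fun a => (fun q => u q.1 q.2 * field_of (bil c (row q.1 A) (row q.2 A)) f p)
  (ix a))); last first.
  move=> a _; rewrite bracket_field_of // /field_of mulr_sumr; apply: eq_bigr => l _.
  rewrite mulrA; congr (_ * _); rewrite !mxE mulr_sumr; apply: eq_bigr => i _.
  by rewrite mulr_sumr; apply: eq_bigr => j _; rewrite !mxE; ring.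
transitivity (\sum_(q : 'I_n * 'I_n) u q.1 q.2 * field_of (bil c (row q.1 A) (row q.2 A)) f p);
  last by rewrite (reindex _ (onW_bij _ (@enum_val_bij _))).
rewrite -(pair_bigA _ (fun i j => u i j * field_of (bil c (row i A) (row j A)) f p)) /=.
rewrite /field_of uE; under [RHS]eq_bigr do under eq_bigr do rewrite mulr_sumr.
rewrite (eq_bigr (fun l => \sum_i \sum_j u i j * (bil c (row i A) (row j A) 0 l * E l f p))).
  rewrite exchange_big; apply: eq_bigr => i _ /=.
  by rewrite exchange_big.
move=> l _; rewrite summxE mulr_suml; apply: eq_bigr => i _.
by rewrite summxE mulr_suml; apply: eq_bigr => j _; rewrite [in LHS]mxE mulrA.
Qed.

Lemma structure_solvable : solvable_lie_group G -> solvable_const c.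
Proof.
move=> [k hk]; exists k; apply/row_matrixP => i; rewrite row0.
apply: field_of_eq0; apply: hk; apply: field_of_derived; exact: row_sub.
Qed.

End LeftInvariantFields.

(** * Invariant tensors have constant components *)

Section ConstantComponents.
Context (R : realType) (n : nat) (G : lieGroupType R n).
Variables (E : 'I_n -> (G -> R) -> (G -> R)) (c : 'I_n -> 'I_n -> 'I_n -> R).
Hypothesis vE : forall i, vector_field (E i).

Definition const_tensor2 (M : 'I_n -> 'I_n -> R) : tensor2 G := fun i j _ => M i j.
Definition const_tensor3 (H : 'I_n -> 'I_n -> 'I_n -> R) : tensor3 G := fun i j k _ => H i j k.

Lemma left_invariant_cst (f : G -> R) : left_invariant f -> f = fun=> f 1%g.
Proof. by move=> lf; apply: funext => p; rewrite -[in LHS](mulg1 p) lf. Qed.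

Lemma E_cst i (a : R) p : E i (fun=> a) p = 0.
Proof. exact: vf_cst. Qed.

Variable M : 'M[R]_n.
Let gM := const_tensor2 (fun i j => M i j).

Lemma gram_const p : gram gM p = M.
Proof. by apply/matrixP => i j; rewrite mxE. Qed.

Lemma ginv_const i j p : ginv gM i j p = invmx M i j.
Proof. by rewrite /ginv gram_const. Qed.

Lemma christoffel_const i j k :
  christoffel E c gM i j k = fun=> chr_const c M (invmx M) i j k.
Proof.
apply: funext => p; rewrite /christoffel /chr_const; congr (_ * _).
apply: eq_bigr => l _; rewrite ginv_const; congr (_ * _).
by rewrite /koszul !E_cst addr0 subr0 add0r.
Qed.

Lemma ricci_const j k p : ricci E c gM j k p = ric_const c M (invmx M) j k.
Proof.
apply: eq_bigr => i _; rewrite /riemann !christoffel_const !E_cst subr0 add0r.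
by apply: eq_bigr => m _; rewrite !christoffel_const.
Qed.

Lemma H_square_const H i j p :
  H_square gM (const_tensor3 H) i j p = Hsq_const (invmx M) H i j.
Proof. by do 4![apply: eq_bigr => ? _]; rewrite !ginv_const. Qed.

Lemma codiff3_const H i j p :
  codiff3 E c gM (const_tensor3 H) i j p = cod_const c M (invmx M) H i j.
Proof.
congr (- _); apply: eq_sum2 => k l; rewrite ginv_const; congr (_ * _).
rewrite /nabla3 E_cst sub0r; congr (- _); apply: eq_bigr => r _.
by rewrite !christoffel_const.
Qed.

Lemma torsion_constE H0 b :
  torsion E c (const_tensor3 H0) (const_tensor2 b) = const_tensor3 (torsion_const c H0 b).
Proof.
do 3![apply: funext => ?]; apply: funext => p; congr (_ + _).
by rewrite /ext_d2 /ext2_const !E_cst subr0 addr0 sub0r.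
Qed.

Lemma closed3_of_const H : (forall i j k l p, ext_d3 E c (const_tensor3 H) i j k l p = 0) ->
  closed3_const c H.
Proof.
move=> hd i j k l; rewrite -[RHS](hd i j k l 1%g) /ext_d3 !E_cst.
by rewrite !subr0 addr0 sub0r.
Qed.

End ConstantComponents.

(** * One-sided and two-sided time derivatives *)

Section TimeDerivative.
Context (R : realType).
Local Notation dv f t l := (is_derive (t : R) (1 : R) (f : R -> R) (l : R)).

Lemma dvP (f : R -> R) t l : (fun s => (s - t)^-1 * (f s - f t)) @ t^' --> l -> dv f t l.
Proof.
move=> h; have h' : (fun x => x^-1 *: ((f \o shift t) (x *: (1 : R)) - f t)) @ (0 : R)^' --> l.
  apply/cvgrPdist_lt => e e0; move/cvgrPdist_lt/(_ e e0) : h.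
  rewrite !near_withinE !near_nbhs_norm /= => -[d /= d0 hd].
  exists d => //= x; rewrite /= sub0r normrN => xd x0.
  have := hd (x + t); rewrite /= opprD addrCA subrr addr0 normrN => /(_ xd).
  rewrite -[X in X != t]addrC => /(_ _).
  rewrite /GRing.scale /= mulr1 addrK; apply.
  by rewrite addrC -subr_eq0 addrK.
apply: DeriveDef; first by apply/cvg_ex; exists l.
exact/cvg_lim.
Qed.

(* Extending u affinely to negative times turns the one-sided derivative at 0
   into a two-sided one. *)
Lemma time_deriv_dv (T : \bar R) (u : R -> R) (t l l0 : R) :
  time_dom T t -> time_deriv T u t l -> (t = 0 -> l = l0) ->
  dv (fun s => if s < 0 then u 0 + s * l0 else u s) t l.
Proof.
move=> [t0 tT] td tl; apply: dvP; apply/cvgrPdist_lt => e e0.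
move/cvgrPdist_lt/(_ e e0) : td.
rewrite !near_withinE !near_nbhs_norm /= => -[d /= d0 hd].
have [r [tr rT]] : exists r : R, t < r /\ forall x, x < r -> (x%:E < T)%E.
  move: tT; case: T {hd} => [x|_|//].
    by rewrite lte_fin => tx; exists x; split=> // y; rewrite lte_fin.
  by exists (t + 1); split=> [|x _]; rewrite ?ltrDl ?ltry.
have [tz|tp] := eqVneq t 0.
  exists (Num.min d (r - t)); first by rewrite /= lt_min d0 subr_gt0.
  move=> s /=; rewrite lt_min => /andP[sd sr] st; rewrite [t < 0](_ : _ = false); last first.
    by apply/negbTE; rewrite -leNgt.
  have [s0|s0] := ltP s 0.
    rewrite tl // tz subr0 addrAC subrr add0r mulrA mulVf ?mul1r ?subrr ?normr0 //.
    by rewrite lt_eqF.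
  apply: hd => //; split=> //; apply: rT; have := ler_norm (s - t); rewrite distrC; lra.
have tgt : 0 < t by rewrite lt_neqAle eq_sym tp.
exists (Num.min d (Num.min t (r - t))); first by rewrite /= !lt_min d0 tgt subr_gt0.
move=> s /=; rewrite !lt_min => /and3P[sd s_t sr] st.
have s0 : 0 <= s by have := ler_norm (t - s); lra.
rewrite [t < 0](_ : _ = false); last by apply/negbTE; rewrite -leNgt.
rewrite [s < 0](_ : _ = false); last by apply/negbTE; rewrite -leNgt.
apply: hd => //; split=> //; apply: rT; have := ler_norm (s - t); rewrite distrC; lra.
Qed.

Lemma dv_time_deriv (T : \bar R) (u : R -> R) (t l : R) : dv u t l -> time_deriv T u t l.
Proof.
move=> du; have : (fun x => x^-1 *: ((u \o shift t) (x *: (1 : R)) - u t)) @ (0 : R)^' --> l.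
  have := @ex_derive _ _ _ _ _ _ _ du; rewrite /derivable => /cvg_ex[l' hl'].
  by have <- : l' = l by rewrite -(@derive_val _ _ _ _ _ _ _ du); exact/esym/cvg_lim.
move=> h; apply/cvgrPdist_lt => e e0; move/cvgrPdist_lt/(_ e e0) : h.
rewrite !near_withinE !near_nbhs_norm /= => -[d /= d0 hd].
exists d => //= s ts st _; have := hd (s - t); rewrite /= sub0r opprB.
move=> /(_ ts); rewrite subr_eq0 => /(_ st).
by rewrite /GRing.scale /= mulr1 subrK.
Qed.

End TimeDerivative.

Section Smoothness.
Context (R : realType).
Local Notation dv f t l := (is_derive (t : R) (1 : R) (f : R -> R) (l : R)).

(** Class C^k at nonnegative times, with two-sided derivatives there as in [flow_on]; nothing is
    asked at negative times. *)
Fixpoint Ck_forward (k : nat) (u : R -> R) : Prop :=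
  (forall t, 0 <= t -> {for t, continuous u}) /\
  match k with
  | 0 => True
  | k'.+1 => exists u' : R -> R,
      (forall t, 0 <= t -> dv u t (u' t)) /\ Ck_forward k' u'
  end.

Lemma Ck_forwardW k u : Ck_forward k.+1 u -> Ck_forward k u.
Proof.
elim: k u => [|k IH] u [cu [u' [du cu']]]; split=> //.
by exists u'; split=> //; exact: IH.
Qed.

Lemma Ck_forward_dv k u u' : (forall t, 0 <= t -> dv u t (u' t)) ->
  Ck_forward k u' -> Ck_forward k.+1 u.
Proof.
move=> du cu'; split; last by exists u'.
by move=> t t0; exact: dv_continuous (du t t0).
Qed.

Lemma Ck_forward_continuous k u : Ck_forward k u -> forall t, 0 <= t -> {for t, continuous u}.
Proof. by case: k => [|k] []. Qed.

Lemma ring_closed_Ck k : ring_closed (Ck_forward k).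
Proof.
elim: k => [|k IH]; split.
- by move=> a; split=> // t _; exact: cst_continuous.
- by move=> f g [cf _] [cg _]; split=> // t t0; apply: cvgD; [exact: cf|exact: cg].
- by move=> f g [cf _] [cg _]; split=> // t t0; apply: cvgM; [exact: cf|exact: cg].
- move=> a; exact: (Ck_forward_dv (fun t _ => dv_cst a t) (rc_cst IH 0)).
- move=> f g [_ [f' [df cf']]] [_ [g' [dg cg']]].
  exact: (Ck_forward_dv (fun t t0 => dvD (df t t0) (dg t t0)) (rc_add IH cf' cg')).
move=> f g cf cg; have wf := Ck_forwardW cf; have wg := Ck_forwardW cg.
have [_ [f' [df cf']]] := cf; have [_ [g' [dg cg']]] := cg.
apply: Ck_forward_dv (fun t t0 => dvM (df t t0) (dg t t0)) _.
by apply: (rc_add IH); exact: (rc_mul IH).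
Qed.

Lemma Ck_forward_inv k u : (forall t, 0 <= t -> u t != 0) -> Ck_forward k u ->
  Ck_forward k (fun t => (u t)^-1).
Proof.
move=> u0; elim: k u u0 => [|k IH] u u0 cu.
  by split=> // t t0; apply: cvgV; [exact: u0|exact: (Ck_forward_continuous cu)].
have wu := IH u u0 (Ck_forwardW cu); have [_ [u' [du cu']]] := cu.
have rc := ring_closed_Ck k.
have dV t : 0 <= t -> dv (fun s => (u s)^-1) t (- ((u t)^-1 * (u t)^-1) * u' t).
  by move=> t0; rewrite -expr2 exprVn; exact: (dvV (u0 t t0) (du t t0)).
apply: (Ck_forward_dv dV).
by apply: (rc_mul rc) => //; apply: (rc_opp rc); exact: (rc_mul rc).
Qed.

Section Families.
Context (n : nat) (G : lieGroupType R n) (E : 'I_n -> (G -> R) -> (G -> R)).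
Hypothesis vE : forall i, vector_field (E i).

(** The family is constant on G, so every derivative along the frame vanishes and only smoothness in
    time is at stake. *)
Lemma Ck_family_forward k u : Ck_forward k u ->
  @Ck_family R n G E k +oo%E (fun t _ => u t).
Proof.
have W (v : R -> R) : (forall t : R, 0 <= t -> {for t, continuous v}) ->
    {within [set z : R * G | time_dom +oo%E z.1], continuous (fun z : R * G => v z.1)}.
  move=> cv; apply/continuous_in_subspaceT => -[t p] /set_mem [/= t0 _].
  apply: (@cvg_comp _ _ _ fst v (nbhs (t, p)) (nbhs t)); first exact: cvg_fst.
  exact: cv.
elim: k u => [|k IH] u cu.
  split=> //; first by move=> t _; exact: smooth_cst.
  by apply: W; exact: (Ck_forward_continuous cu).
split; [by move=> t _; exact: smooth_cst|by apply: W; exact: (Ck_forward_continuous cu)|].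
have [_ [u' [du cu']]] := cu; split.
  move=> i; have -> : (fun t : R => E i (fun _ : G => u t)) = fun t _ => (fun=> 0) t.
    by apply: funext => t; apply: funext => p; exact: E_cst.
  apply: IH; exact: (rc_cst (ring_closed_Ck k)).
exists (fun t _ => u' t); split; last exact: IH.
by move=> t p [t0 _]; apply: dv_time_deriv; exact: du.
Qed.

End Families.

Section FlowSmooth.
Context (n : nat) (c H0 : 'I_n -> 'I_n -> 'I_n -> R).
Hypothesis calt : alternating2 c.
Hypothesis cjac : jacobi c.
Hypothesis csolv : solvable_const c.

(** Bootstrapping: the right-hand side is polynomial in g, its inverse and b, so if the solution is
    C^k then its derivative is C^k as well. *)
Lemma flow_on_smooth g b : (forall s, flow_on c H0 s g b) -> forall k i j,
  Ck_forward k (fun t => g t i j) /\ Ck_forward k (fun t => b t i j).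
Proof.
move=> fl; have at_t (t : R) (t0 : 0 <= t) : 0 <= t < t + 1 by rewrite t0 ltrDl ltr01.
elim=> [|k IH] i j.
  split; split=> // t t0; have [_ _ dg db] := fl _ t (at_t t t0).
    exact: dv_continuous (dg i j).
  exact: dv_continuous (db i j).
have rc := ring_closed_Ck k.
have cg i' j' := (IH i' j').1; have cb i' j' := (IH i' j').2.
have cga i' j' : Ck_forward k (fun t => adj_inv (g t) i' j').
  rewrite (_ : (fun _ => _) = fun t => (\det (g t))^-1 * (\adj (g t)) i' j'); last first.
    by apply: funext => t; rewrite mxE.
  apply: (rc_mul rc); last exact: rc_adj.
  apply: Ck_forward_inv; last exact: rc_det.
  move=> t t0; have [pg _ _ _] := fl _ t (at_t t t0).
  by rewrite -unitfE -unitmxE; exact: (posdef_unit calt cjac csolv pg).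
have cH i' j' l : Ck_forward k (fun t => torsion_const c H0 (b t) i' j' l).
  by apply: (rc_add rc); [exact: (rc_cst rc)|exact: rc_ext2].
split.
  apply: Ck_forward_dv (rc_rhs_g rc c cg cga cH i j) => t t0.
  by have [_ _ dg _] := fl _ t (at_t t t0); exact: dg.
apply: Ck_forward_dv (rc_rhs_b rc c cg cga cH i j) => t t0.
by have [_ _ _ db] := fl _ t (at_t t t0); exact: db.
Qed.

End FlowSmooth.
End Smoothness.

(** * Extension of invariant solutions to all positive times *)

Section Main.
Context (R : realType) (n : nat) (G : lieGroupType R n) (Gam : set G).
Variables (E : 'I_n -> (G -> R) -> (G -> R)) (c : 'I_n -> 'I_n -> 'I_n -> R).
Local Notation dv f t l := (is_derive (t : R) (1 : R) (f : R -> R) (l : R)).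
Hypothesis hG : solvable_lie_group G.
Hypothesis hE : lie_alg_basis E.
Hypothesis hc : structure_constants E c.
Variable H0 : tensor3 G.
Hypothesis hH0 : closed_form3 E c Gam H0.

Let vE i : vector_field (E i). Proof. exact: (hE.1 i).1. Qed.
Let calt := structure_alternating hE hc.
Let cjac := structure_jacobi hE hc.
Let csolv := structure_solvable hE hc hG.

Lemma metric_posdef (M : 'M[R]_n) :
  is_metric (const_tensor2 (G := G) (fun i j => M i j)) <-> posdef M.
Proof.
split=> [[sM pM]|[sM pM]].
  split; first by apply/matrixP => i j; rewrite mxE; exact: (sM j i 1%g).
  by move=> v v0; have := pM 1%g v v0; rewrite gram_const -mformE.
split; first by move=> i j p; rewrite /const_tensor2 -[in LHS]sM mxE.
by move=> p v v0; rewrite gram_const -mformE; exact: pM.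
Qed.

(** Evaluated at the identity of G, the given solution becomes a solution of the coordinate
    equation, and uniqueness identifies it with the global solution having the same initial
    value. *)
Lemma invariant_solution_extends T (g b : R -> tensor2 G) :
  invariant_solution E c Gam H0 T g b ->
  exists g' b' : R -> tensor2 G,
    invariant_solution E c Gam H0 +oo%E g' b' /\ agree_on T g b g' b'.
Proof.
move=> [fl H0inv inv].
have [T0 met frm _ _ eqg eqb] := fl.
pose H0c i j k := H0 i j k 1%g.
have H0E : H0 = const_tensor3 H0c.
  by apply: funext => i; apply: funext => j; apply: funext => k; exact: left_invariant_cst.
have H0alt : alternating3 H0c by move=> i j k; have [h _ _ _] := hH0; exact: h.
have H0cl : closed3_const c H0c.
  apply: (closed3_of_const vE) => i j k l p; rewrite -H0E; have [_ _ _ h] := hH0; exact: h.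
pose M (t : R) : 'M[R]_n := \matrix_(i, j) g t i j 1%g.
pose B (t : R) i j := b t i j 1%g.
have gE t : time_dom T t -> g t = const_tensor2 (fun i j => M t i j).
  move=> tT; apply: funext => i; apply: funext => j; rewrite /const_tensor2 mxE.
  exact: left_invariant_cst (inv t i j tT).1.
have bE t : time_dom T t -> b t = const_tensor2 (B t).
  move=> tT; apply: funext => i; apply: funext => j.
  exact: left_invariant_cst (inv t i j tT).2.
have pM t : time_dom T t -> posdef (M t).
  by move=> tT; apply/metric_posdef; rewrite -gE //; exact: met.
have aB t : time_dom T t -> antisym (B t) by move=> tT i j; exact: frm.
have iM t : time_dom T t -> adj_inv (M t) = invmx (M t).
  by move=> tT; apply: adj_invE; exact: (posdef_unit calt cjac csolv (pM t tT)).
have rg t i j : time_dom T t -> time_deriv T (fun s => M s i j) t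
    (rhs_g c (M t) (adj_inv (M t)) (torsion_const c H0c (B t)) i j).
  move=> tT; have := eqg t i j 1%g tT.
  rewrite gE // bE // H0E (torsion_constE c vE) (ricci_const c vE) H_square_const.
  rewrite /rhs_g iM // (_ : (fun s => M s i j) = fun s => g s i j 1%g) //.
  by apply: funext => s; rewrite mxE.
have rb t i j : time_dom T t -> time_deriv T (fun s => B s i j) t
    (rhs_b c (M t) (adj_inv (M t)) (torsion_const c H0c (B t)) i j).
  move=> tT; have := eqb t i j 1%g tT.
  by rewrite gE // bE // H0E (torsion_constE c vE) (codiff3_const c vE) /rhs_b iM.
have z0 : time_dom T 0 by split.
pose tor0 := torsion_const c H0c (B 0).
(* The given solution has only a one-sided derivative at 0. Its values before 0 are replaced by the
   affine extension whose slope is the one prescribed by the equation at 0. *)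
pose Mx (t : R) : 'M[R]_n := \matrix_(i, j) (if t < 0
  then M 0 i j + t * rhs_g c (M 0) (adj_inv (M 0)) tor0 i j else M t i j).
pose Bx (t : R) i j := if t < 0 then B 0 i j + t * rhs_b c (M 0) (adj_inv (M 0)) tor0 i j else B t i j.
have MxE (t : R) : 0 <= t -> Mx t = M t.
  by move=> t0; apply/matrixP => i j; rewrite mxE ltNge t0.
have BxE (t : R) : 0 <= t -> Bx t = B t.
  by move=> t0; apply: funext => i; apply: funext => j; rewrite /Bx ltNge t0.
have flx s : (forall x, x < s -> (x%:E < T)%E) -> flow_on c H0c s Mx Bx.
  move=> sT t /andP[t0 ts]; have tT : time_dom T t by split=> //; exact: sT.
  rewrite MxE // BxE //; split; [exact: pM|exact: aB| |] => i j.
    rewrite (_ : (fun r => Mx r i j) = fun r => if r < 0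
      then M 0 i j + r * rhs_g c (M 0) (adj_inv (M 0)) tor0 i j else M r i j).
      by apply: time_deriv_dv tT (rg t i j tT) _ => ->.
    by apply: funext => r; rewrite mxE.
  by apply: time_deriv_dv tT (rb t i j tT) _ => ->.
have [g' [b' [g0 b0 fl']]] :=
  flow_global calt cjac csolv H0alt H0cl (pM 0 z0) (aB 0 z0).
have pos (t : R) : 0 <= t -> 0 <= t < t + 1 by move=> t0; rewrite t0 ltrDl ltr01.
exists (fun t => const_tensor2 (fun i j => g' t i j)), (fun t => const_tensor2 (b' t)); split.
  split=> //; split=> //.
  - by move=> t [t0 _]; apply/metric_posdef; have [] := fl' _ t (pos t t0).
  - by move=> t [t0 _] i j p; have [_ h _ _] := fl' _ t (pos t t0); exact: h.
  - by move=> i j; split=> k; apply: (Ck_family_forward vE);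
      have [] := flow_on_smooth calt cjac csolv fl' k i j.
  - move=> t i j p [t0 _]; have [pg _ dg _] := fl' _ t (pos t t0).
    rewrite H0E (torsion_constE c vE) (ricci_const c vE) H_square_const.
    by apply: dv_time_deriv; rewrite -adj_invE ?(posdef_unit calt cjac csolv pg) //; exact: dg.
  - move=> t i j p [t0 _]; have [pg _ _ db] := fl' _ t (pos t t0).
    rewrite H0E (torsion_constE c vE) (codiff3_const c vE).
    by apply: dv_time_deriv; rewrite -adj_invE ?(posdef_unit calt cjac csolv pg) //; exact: db.
move=> t i j p tT; have [t0 tlt] := tT.
(* [flow_on] takes a finite end time, while T may be infinite. *)
have [s [ts sT]] : exists s : R, t < s /\ forall x, x < s -> (x%:E < T)%E.
  move: tlt; clear; case: T => [x|_|//].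
    by rewrite lte_fin => tx; exists x; split=> // y; rewrite lte_fin.
  by exists (t + 1); split=> [|x _]; rewrite ?ltrDl ?ltry.
have [gg bb] := flow_unique calt cjac csolv H0alt H0cl (fl' s) (flx s sT)
  (etrans g0 (esym (MxE 0 (lexx 0)))) (etrans b0 (esym (BxE 0 (lexx 0))))
  (t := t) (introT andP (conj t0 ts)).
by rewrite /const_tensor2 gg bb MxE // BxE // (gE t tT) (bE t tT).
Qed.

End Main.

Theorem theorem1 (R : realType) (n : nat) (G : lieGroupType R n)
    (Gam : set G)
    (E : 'I_n -> (G -> R) -> (G -> R)) (c : 'I_n -> 'I_n -> 'I_n -> R)
    (hG : solvable_lie_group G)
    (hGam : discrete_subgroup Gam)
    (hE : lie_alg_basis E)
    (hc : structure_constants E c)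
    (H0 : tensor3 G) (hH0 : closed_form3 E c Gam H0)
    (T : \bar R) (g b : R -> tensor2 G)
    (hsol : invariant_solution E c Gam H0 T g b) :
  (exists g' b' : R -> tensor2 G,
      invariant_solution E c Gam H0 +oo%E g' b' /\ agree_on T g b g' b') /\
  (maximal_invariant_solution E c Gam H0 T g b -> T = +oo%E).
Proof.
have [g' [b' [sol agr]]] := invariant_solution_extends hG hE hc hH0 hsol.
split; first by exists g', b'.
by move=> [_ mx]; rewrite (mx _ _ _ sol (leey T) agr).
Qed.
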